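(* Let $A$ be a finite-dimensional formally real Jordan algebra with unit $u$, let $A_+^\circ$ be the interior of its cone of squares, let $PA_+^\circ=\{x\in A_+^\circ:\det x=1\}$ and $T_u=\{w\in A:\mathrm{tr}\,w=0\}$. (a) The exponential map $\exp_u\colon A\to A_+^\circ$, $x\mapsto e^x$, extends to a homeomorphism from the horofunction compactification of the normed space $(A,\|\cdot\|_u)$ onto the horofunction compactification of $(A_+^\circ,d_T)$, such that each part of the horofunction boundary of $(A,\|\cdot\|_u)$ is mapped onto a part of the horofunction boundary of $(A_+^\circ,d_T)$. (b) The exponential map $\exp_u\colon T_u\to PA_+^\circ$, $x\mapsto e^x$, extends to a homeomorphism from the horofunction compactification of the normed space $(T_u,|\cdot|_u)$ onto the horofunction compactification of $(PA_+^\circ,d_H)$, such that each part of the horofunction boundary of $(T_u,|\cdot|_u)$ is mapped onto a part of the horofunction boundary of $(PA_+^\circ,d_H)$.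
   Context: A finite-dimensional formally real Jordan algebra is a finite-dimensional real vector space $A$ with a commutative bilinear product $\bullet$ satisfying $x^2\bullet(x\bullet y)=x\bullet(x^2\bullet y)$ and such that $x^2+y^2=0$ implies $x=y=0$; $u$ is its unit. $A_+=\{x^2:x\in A\}$, $A_+^\circ$ is its interior, and $x\le y$ means $y-x\in A_+$. Every $x\in A$ has a spectral decomposition $x=\sum_{i=1}^r\lambda_ip_i$ with $p_1,\dots,p_r$ a Jordan frame (mutually orthogonal primitive idempotents summing to $u$); $\sigma(x)=\{\lambda_i\}$, $\mathrm{tr}\,x=\sum_i\lambda_i$, $\det x=\prod_i\lambda_i$, and $e^x=\sum_i e^{\lambda_i}p_i$. The spectral norm is $\|x\|_u=\max\{|\lambda|:\lambda\in\sigma(x)\}$ and the variation norm on $T_u$ is $|w|_u=\max\sigma(w)-\min\sigma(w)$. For $x\in A$ and $y\in A_+^\circ$ let $M(x/y)=\inf\{\beta\in\mathbb{R}:x\le\beta y\}$. The Thompson distance on $A_+^\circ$ is $d_T(x,y)=\max\{\log M(x/y),\log M(y/x)\}$ and the Hilbert distance on $PA_+^\circ$ is $d_H(x,y)=\log M(x/y)+\log M(y/x)$. Horofunction compactification: for a metric space $(M,d)$ with basepoint $b$ (here $b=0$ for the normed spaces and $b=u$ for $A_+^\circ$ and $PA_+^\circ$), let $h_y(z)=d(z,y)-d(b,y)$ for $y,z\in M$; the horofunction compactification $\overline{M}^h$ is the closure of $\{h_y:y\in M\}$ in $\mathbb{R}^M$ with the topology of pointwise convergence, the point $y\in M$ being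 identified with $h_y$; its horofunction boundary is $\overline{M}^h\setminus\{h_y:y\in M\}$, whose elements are horofunctions. For horofunctions $h,h'$ the detour cost is $H(h,h')=\sup_{W}\inf\{d(b,x)+h'(x): x\in M, h_x\in W\}$, the supremum over neighbourhoods $W$ of $h$ in $\overline{M}^h$, and the detour distance is $\delta(h,h')=H(h,h')+H(h',h)$. Parts of the horofunction boundary are the equivalence classes of horofunctions under $h\equiv h'$ iff $\delta(h,h')<\infty$ (in all four spaces here every horofunction is a Busemann point, i.e. a limit of an almost geodesic, and $\delta$ is a possibly infinite metric on them). *)

(* Defs.v *)
From HB Require Import structures.
From mathcomp Require Import all_boot all_order all_algebra.
From mathcomp Require Import all_classical all_reals all_analysis.
Set Implicit Arguments. Unset Strict Implicit. Unset Printing Implicit Defensive.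
Import Order.TTheory GRing.Theory Num.Theory.
Import numFieldNormedType.Exports.
Local Open Scope classical_set_scope.
Local Open Scope ring_scope.

Section Horo.
Variables (R : realType) (X : Type) (M : set X) (d : X -> X -> R) (b : X).

Definition horo (y : X) : {ptws {x : X | M x} -> R} :=
  fun z => d (proj1_sig z) y - d b y.

Definition horo_compact : set {ptws {x : X | M x} -> R} :=
  closure (horo @` M).

Definition horo_boundary : set {ptws {x : X | M x} -> R} :=
  horo_compact `\` (horo @` M).

Definition detour_cost (h h' : {ptws {x : X | M x} -> R}) : \bar R :=
  ereal_sup [set ereal_inf
      [set ((d b (proj1_sig x) + h' x)%:E) | x in [set x | W (horo (proj1_sig x))]]
    | W in nbhs h].

Definition detour (h h' : {ptws {x : X | M x} -> R}) : \bar R :=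
  (detour_cost h h' + detour_cost h' h)%E.

Definition horo_part (h : {ptws {x : X | M x} -> R}) : set {ptws {x : X | M x} -> R} :=
  [set h' | horo_boundary h' /\ (detour h h' < +oo)%E].

End Horo.
Arguments horo {R X} M d b y _.
Arguments horo_compact {R X} M d b _.
Arguments horo_boundary {R X} M d b _.
Arguments detour_cost {R X} M d b h h'.
Arguments detour {R X} M d b h h'.
Arguments horo_part {R X} M d b h _.

Definition homeo_onto (T1 T2 : topologicalType) (S1 : set T1) (S2 : set T2)
    (Phi : T1 -> T2) : Prop :=
  [/\ (forall x, S1 x -> S2 (Phi x)),
      {within S1, continuous Phi} &
      exists Psi : T2 -> T1,
        [/\ (forall y, S2 y -> S1 (Psi y)),
            {within S2, continuous Psi},
            (forall x, S1 x -> Psi (Phi x) = x) &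
            (forall y, S2 y -> Phi (Psi y) = y)]].

Section Jordan.
Variables (R : realType) (A : vectType R) (mul : A -> A -> A) (u : A).

Definition jordan_algebra : Prop :=
  [/\ (forall (a : R) (x y z : A), mul (a *: x + y) z = a *: mul x z + mul y z),
      (forall x y, mul x y = mul y x),
      (forall x y, mul (mul x x) (mul x y) = mul x (mul (mul x x) y)),
      (forall x y, mul x x + mul y y = 0 -> x = 0 /\ y = 0) &
      (forall x, mul u x = x)].

Definition jidem (p : A) : Prop := mul p p = p.
Definition jorth (p q : A) : Prop := mul p q = 0.
Definition jprimitive (p : A) : Prop :=
  [/\ jidem p, p != 0 &
      ~ (exists q1 q2, [/\ jidem q1, jidem q2, (q1 != 0) /\ (q2 != 0),
                         jorth q1 q2 & p = q1 + q2])].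

Definition jframe (r : nat) (p : 'I_r -> A) : Prop :=
  [/\ (forall i, jprimitive (p i)),
      (forall i j, i != j -> jorth (p i) (p j)) &
      \sum_(i < r) p i = u].

Definition spec_decomp (x : A) (r : nat) (p : 'I_r -> A) (lam : 'I_r -> R) : Prop :=
  jframe p /\ x = \sum_(i < r) lam i *: p i.

Definition spectrum (x : A) : set R :=
  [set l | exists r (p : 'I_r -> A) (lam : 'I_r -> R),
           spec_decomp x p lam /\ exists i, lam i = l].

Definition jtr (x : A) : R :=
  xget 0 [set t | exists r (p : 'I_r -> A) (lam : 'I_r -> R),
                  spec_decomp x p lam /\ t = \sum_(i < r) lam i].

Definition jdet (x : A) : R :=
  xget 0 [set t | exists r (p : 'I_r -> A) (lam : 'I_r -> R),
                  spec_decomp x p lam /\ t = \prod_(i < r) lam i].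

Definition jexp (x : A) : A :=
  xget 0 [set y | exists r (p : 'I_r -> A) (lam : 'I_r -> R),
                  spec_decomp x p lam /\ y = \sum_(i < r) expR (lam i) *: p i].

Definition spec_norm (x : A) : R := sup [set `|l| | l in spectrum x].
Definition var_norm (w : A) : R := sup (spectrum w) - inf (spectrum w).

Definition squares : set A := [set mul x x | x in [set: A]].
Definition cone_int : set A :=
  [set x | exists2 e : R, 0 < e & forall y, spec_norm (y - x) < e -> squares y].

Definition jle (x y : A) : Prop := squares (y - x).
Definition Mfun (x y : A) : R := inf [set beta : R | jle x (beta *: y)].

Definition thompson (x y : A) : R := Num.max (ln (Mfun x y)) (ln (Mfun y x)).
Definition hilbert (x y : A) : R := ln (Mfun x y) + ln (Mfun y x).

Definition PA : set A := [set x | cone_int x /\ jdet x = 1].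
Definition Tu : set A := [set w | jtr w = 0].

End Jordan.

(* Main.v *)
Require Import Defs.
From HB Require Import structures.
From mathcomp Require Import all_boot all_order all_algebra.
From mathcomp Require Import all_classical all_reals all_analysis.
From mathcomp Require Import ring lra.
From mathcomp Require Import complex.
Import Order.TTheory GRing.Theory Num.Theory.
Import numFieldNormedType.Exports.
Local Open Scope classical_set_scope.
Local Open Scope ring_scope.
Set Implicit Arguments. Unset Strict Implicit. Unset Printing Implicit Defensive.

(* Both distances are explicit: writing e_y = exp (y - r u) and
   f_y = exp (- y - s u), with r, s normalizing the maximal eigenvalues, the
   horofunction of y at z is log of the max, in (a), or of the product, in (b),
   of exp max sigma(ln e_y - z) and exp max sigma(ln f_y + z), and that of e^y
   is the same expression in M(e_y/z) and M(z/f_y^-1).  Along an ultrafilter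
   (e_y, f_y) converges to a pair (a, b) in the cone of squares, and both kinds
   of expression converge to functions of a and b only, governed by the states
   on the faces of a and b.  Either b is a multiple of a^-1 and the limit is
   attained, or a and b have orthogonal supports and the limit is a
   horofunction.  Since (a, b) is determined by either horofunction,
   the two compactifications are both parametrized by the pairs (a, b), and
   continuity of the bijection in both directions follows from compactness.
   Since the horofunctions are limits along paths that are almost geodesic, the
   detour distance of two of them is finite iff their difference is bounded,
   which on both sides means that the pairs have the same supports. *)

(** * Limits along ultrafilters and horofunctions *)

(** The logarithm of e_y diverges on the kernel of its limit, so continuity of the functional
    calculus cannot give the limit formulas. Instead frames of a fixed length converge, possibly to
    systems with zero members, and positivity of f(e_y) - z is tested against states, for functions
    f that blow up at 0. Recovering (a, b) takes different arguments in the two parts. Under the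
    maximum, moving z along u separates the two factors. A product leaves them coupled, and the
    pairs are then compared at special points z where every state of a face gives the same value.
    The supports are found beforehand, from rates of exponential decay along t (2 e - u). The form
    tr L_(xy), associative and positive definite, carries the algebra: self-duality of the cone,
    bounds on idempotents and the independence of trace and determinant from the frame all come from
    it. For u = 0 all spectra are empty; then A is a point and is treated apart. *)

Section RealLimits.
Context {R : realType} {T : Type} (F : set_system T) {FF : ProperFilter F}.

Lemma cvg_sumr n (f : 'I_n -> T -> R) (l : 'I_n -> R) (P : pred 'I_n) :
  (forall i, P i -> f i @ F --> l i) ->
  (fun y => \sum_(i | P i) f i y) @ F --> \sum_(i | P i) l i.
Proof. by move=> h; apply: cvg_big => //; exact: add_continuous. Qed.

Lemma cvg_ler (f g : T -> R) (k l : R) : f @ F --> k -> g @ F --> l ->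
  (\forall y \near F, f y <= g y) -> k <= l.
Proof.
move=> fk gl h; rewrite -subr_ge0.
have h' : \forall y \near F, 0 <= (g \- f) y.
  by apply: filterS h => y; rewrite /= subr_ge0.
exact: (@closed_cvg _ _ _ FF (g \- f) (fun x : R => 0 <= x) (@closed_ge R 0) h' _ (cvgB gl fk)).
Qed.

Lemma cvg_between (f : T -> R) (l : R) :
  (forall s, l < s -> \forall y \near F, f y <= s) ->
  (forall s, s < l -> \forall y \near F, s <= f y) -> f @ F --> l.
Proof.
move=> h1 h2; apply/cvgrPdist_le => e e0.
have h3 := h1 (l + e) (_ : l < l + e); have h4 := h2 (l - e) (_ : l - e < l).
apply: filterS2 (h3 _) (h4 _) => [y a b||]; rewrite ?ltrDl ?gtrBl //.
by rewrite ler_norml; lra.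
Qed.

End RealLimits.

(** * Extending maps to closures along ultrafilters *)

Section UltraExtension.
Context {Y : Type} {T1 T2 : topologicalType}.
Context (M : set Y) (f : Y -> T1) (g : Y -> T2).

(** For a closure point the preimages of its neighbourhoods, cut down to [M], generate a proper
    filter, and any finer ultrafilter will do. *)
Lemma closure_ultra (s : T1) : closure (f @` M) s <->
  exists F : set_system Y, [/\ UltraFilter F, F M & f @ F --> s].
Proof.
split=> [cs|[F [FU FM fs]] U Us]; last first.
  have /filter_ex[y [My Uy]] : F (M `&` f @^-1` U) by apply: filterI => //; apply: fs.
  by exists (f y); split=> //; exists y.
pose B (U : set T1) := M `&` f @^-1` U.
have PB : ProperFilter (filter_from (nbhs s) B).
  apply: filter_from_proper; last first.
    by move=> U Us; have [_ [[y My <-] Uy]] := cs U Us; exists y.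
  apply: filter_from_filter; first by exists setT; apply: filterT.
  move=> U V Us Vs; exists (U `&` V); first exact: filterI.
  by move=> y [My [Uy Vy]].
have [F [FU sF]] := ultraFilterLemma PB; exists F; split=> //.
- by apply: sF; exists setT; [apply: filterT|move=> y []].
- by move=> U Us; apply: sF; exists U => // y [].
Qed.

Hypothesis hT1 : hausdorff_space T1.
Hypothesis hT2 : hausdorff_space T2.
Hypothesis rT2 : regular_space T2.
Hypothesis f_lim : forall F : set_system Y, UltraFilter F -> F M -> exists s : T1, f @ F --> s.
Hypothesis g_lim : forall F : set_system Y, UltraFilter F -> F M -> exists t : T2, g @ F --> t.
Hypothesis fg_lim : forall (F G : set_system Y) (s : T1) (t : T2), UltraFilter F -> UltraFilter G -> F M -> G M ->
  f @ F --> s -> f @ G --> s -> g @ F --> t -> g @ G --> t.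

(** The value at [s] is the limit of [g] along any ultrafilter with [f] tending to [s]; [fg_lim]
    makes it unique. If continuity failed, the points with [f] near [s] and [g] outside [V'] would
    lie in an ultrafilter along which [g] still tends to [Phi s]. Regularity of [T2] passes from
    points of [M] to closure points, whose values are only known to lie in the closure of [V']. *)
Lemma ultra_extension (t0 : T2) : exists Phi : T1 -> T2,
  {within closure (f @` M), continuous Phi} /\
  (forall (F : set_system Y) (s : T1), UltraFilter F -> F M -> f @ F --> s -> g @ F --> Phi s).
Proof.
pose P (s : T1) (t : T2) := exists F : set_system Y, [/\ UltraFilter F, F M, f @ F --> s & g @ F --> t].
pose Phi s := xget t0 (P s); exists Phi.
have ext (F : set_system Y) (s : T1) : UltraFilter F -> F M -> f @ F --> s -> g @ F --> Phi s.
  move=> FU FM fs; rewrite /Phi; case: xgetP => [t _ [G [GU GM fGs gGt]]|no].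
    exact: (@fg_lim G F s t).
  by have [t gt] := g_lim FU FM; exfalso; apply: (no t); exists F.
split=> //; apply/subspace_continuousP => s cs V /= /rT2[V' V's V'V].
have [U Us UV] : exists2 U, nbhs s U & forall y, M y -> U (f y) -> V' (g y).
  apply: contrapT => no.
  pose B (U : set T1) := [set y | [/\ M y, U (f y) & ~ V' (g y)]].
  have PB : ProperFilter (filter_from (nbhs s) B).
    apply: filter_from_proper; last first.
      move=> U Us; apply: contrapT => B0; apply: no; exists U => // y My Uy.
      by apply: contrapT => nV; apply: B0; exists y.
    apply: filter_from_filter; first by exists setT; apply: filterT.
    move=> U W Us Ws; exists (U `&` W); first exact: filterI.
    by move=> y [My [Uy Wy] nV].
  have [F [FU sF]] := ultraFilterLemma PB.
  have FM : F M by apply: sF; exists setT; [apply: filterT|move=> y []].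
  have fs : f @ F --> s by move=> U Us; apply: sF; exists U => // y [].
  have FV : F (g @^-1` V') by apply: (ext F s).
  have FnV : F (g @^-1` (~` V')) by apply: sF; exists setT; [apply: filterT|move=> y []].
  by have /filter_ex[y []] : F (g @^-1` V' `&` g @^-1` (~` V')) by exact: filterI.
rewrite /= /within; apply: filterS (nbhs_interior Us) => s' Us' cs'.
apply: V'V; have [F [FU FM fs']] := (closure_ultra s').1 cs'.
move=> W Ws'; have FW : F (g @^-1` W) by apply: (ext F s').
have FfU : F (f @^-1` U) by apply: fs'.
have /filter_ex[y [[Wy Uy] My]] : F (g @^-1` W `&` f @^-1` U `&` M).
  by apply: filterI => //; apply: filterI.
by exists (g y); split=> //; apply: UV.
Qed.

End UltraExtension.

(** The extensions in both directions follow the same ultrafilters on [Y], so uniqueness of limits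
    makes them inverse to each other. *)
Lemma ultra_homeo (Y : Type) (T1 T2 : topologicalType) (M : set Y) (f : Y -> T1) (g : Y -> T2)
  (t1 : T1) (t2 : T2) :
  hausdorff_space T1 -> hausdorff_space T2 -> regular_space T1 -> regular_space T2 ->
  (forall F : set_system Y, UltraFilter F -> F M -> exists s : T1, f @ F --> s) ->
  (forall F : set_system Y, UltraFilter F -> F M -> exists t : T2, g @ F --> t) ->
  (forall (F G : set_system Y) (s : T1) (t : T2), UltraFilter F -> UltraFilter G -> F M -> G M ->
    f @ F --> s -> f @ G --> s -> g @ F --> t -> g @ G --> t) ->
  (forall (F G : set_system Y) (s : T1) (t : T2), UltraFilter F -> UltraFilter G -> F M -> G M ->
    g @ F --> t -> g @ G --> t -> f @ F --> s -> f @ G --> s) ->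
  exists Phi : T1 -> T2, homeo_onto (closure (f @` M)) (closure (g @` M)) Phi /\
  (forall (F : set_system Y) (s : T1), UltraFilter F -> F M -> f @ F --> s -> g @ F --> Phi s).
Proof.
move=> h1 h2 r1 r2 fl gl fg gf.
have [Phi [cPhi hPhi]] := ultra_extension r2 gl fg t2.
have [Psi [cPsi hPsi]] := ultra_extension r1 fl (fun F G t s => @gf F G s t) t1.
exists Phi; split=> //; split=> //.
  move=> s /closure_ultra[F [FU FM fs]]; apply/closure_ultra.
  by exists F; split=> //; apply: hPhi.
exists Psi; split=> //.
- move=> t /closure_ultra[F [FU FM gt]]; apply/closure_ultra.
  by exists F; split=> //; apply: hPsi.
- move=> s /closure_ultra[F [FU FM fs]].
  exact: (cvg_unique h1 (hPsi F _ FU FM (hPhi F _ FU FM fs)) fs).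
- move=> t /closure_ultra[F [FU FM gt]].
  exact: (cvg_unique h2 (hPhi F _ FU FM (hPsi F _ FU FM gt)) gt).
Qed.

Lemma ptws_cvg (R : realType) (Y I : Type) (F : set_system Y) {FF : Filter F}
  (f : Y -> {ptws I -> R}) (h : {ptws I -> R}) :
  f @ F --> h <-> forall z, (fun y => f y z) @ F --> h z.
Proof.
have surj z : range (fun k : {ptws I -> R} => k z) = setT.
  by apply/seteqP; split=> // x _; exists (fun=> x).
have -> : (f @ F --> h) <-> forall z, f @ F --> (h : initial_topology (fun k : {ptws I -> R} => k z)).
  exact: cvg_sup.
split=> h1 z; [have := h1 z|]; rewrite cvg_image //.
  move=> c U Uz; have [B FB BU] := c U Uz.
  by apply: (@filterS _ F _ (f @^-1` B) _ _ FB) => y By; rewrite /= -BU; exists (f y).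
move=> U Uz; exists ((fun k : {ptws I -> R} => k z) @^-1` U).
  exact: (h1 z U Uz).
by rewrite image_preimage.
Qed.

Lemma ptws_hausdorff (R : realType) (I : Type) : hausdorff_space {ptws I -> R}.
Proof.
move=> p q pq; apply/funext => z; apply: (@Rhausdorff R) => U V Up Vq.
have c (r : {ptws I -> R}) : (fun k : {ptws I -> R} => k z) @ nbhs r --> r z.
  by apply: (ptws_cvg id _).1; apply: cvg_id.
by have [k [Uk Vk]] := pq _ _ (c p U Up) (c q V Vq); exists (k z).
Qed.

(** * Detour distance and bounded differences of horofunctions *)

Section Detour.
Context {R : realType} {X : Type} (M : set X) (d : X -> X -> R) (b : X).
Hypothesis Mb : M b.
Hypothesis d_tri : forall x y z, M x -> M y -> M z -> d x z <= d x y + d y z.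
Local Notation horo := (horo M d b).

Lemma horo_compact_lip h (z x : {x | M x}) : horo_compact M d b h ->
  h z <= d (proj1_sig z) (proj1_sig x) + h x.
Proof.
case/closure_ultra => F [FU FM hh]; have FP : ProperFilter F := @ultra_proper _ _ FU.
have cz := (ptws_cvg (FF := FP) _ _).1 hh z; have cx := (ptws_cvg (FF := FP) _ _).1 hh x.
have c2 : (fun y => d (proj1_sig z) (proj1_sig x) + horo y x) @ F -->
    d (proj1_sig z) (proj1_sig x) + h x.
  by apply: cvgD; [exact: cvg_cst|exact: cx].
apply: (cvg_ler cz c2).
apply: filterS FM => y My; rewrite /Defs.horo.
have := d_tri (proj2_sig z) (proj2_sig x) My; rewrite /=; lra.
Qed.

Lemma horo_compact_base h : horo_compact M d b h -> h (exist _ b Mb) = 0.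
Proof.
case/closure_ultra => F [FU FM hh]; have FP : ProperFilter F := @ultra_proper _ _ FU.
have cz := (ptws_cvg (FF := FP) _ _).1 hh (exist _ b Mb).
apply: (cvg_unique _ cz) => //.
rewrite (_ : (fun y => _) = fun=> 0); first exact: cvg_cst.
by apply/funext => y; rewrite /Defs.horo /= subrr.
Qed.

(* What remains of being a limit of an almost geodesic: [h] is approximated by
   points x at which d(b,x) + h(x) is bounded. *)
Definition quasi_busemann (h : {ptws {x | M x} -> R}) := exists C,
  forall W : set {ptws {x | M x} -> R}, nbhs h W ->
    exists x : {x | M x}, W (horo (proj1_sig x)) /\ d b (proj1_sig x) + h x <= C.

Lemma detour_cost_ge0 h h' : horo_compact M d b h -> horo_compact M d b h' ->
  (0 <= detour_cost M d b h h')%E.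
Proof.
move=> ch ch'; apply: (@le_trans _ _ (ereal_inf
  [set ((d b (proj1_sig x) + h' x)%:E) | x in [set x | setT (horo (proj1_sig x))]])).
  apply: le_ereal_inf_tmp => _ [x _ <-]; rewrite lee_fin -(horo_compact_base ch').
  exact: (horo_compact_lip (exist _ b Mb) x ch').
by apply: ereal_sup_ubound; exists setT => //; apply: filterT.
Qed.

(* Finite detour cost means that h' - h is bounded above, because along points
   x approximating h the distance d(b,x) + h(x) stays bounded. *)
Lemma detour_cost_lty h h' : horo_compact M d b h -> horo_compact M d b h' ->
  quasi_busemann h ->
  (detour_cost M d b h h' < +oo)%E <-> exists C, forall z, h' z <= h z + C.
Proof.
move=> ch ch' [C0 hC0]; split=> [fin|[C hC]]; last first.
  apply: (@le_lt_trans _ _ (C0 + C)%:E); last exact: ltry.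
  apply: ge_ereal_sup => _ [W Wh <-]; have [x [Wx hx]] := hC0 W Wh.
  apply: (@le_trans _ _ (d b (proj1_sig x) + h' x)%:E).
    by apply: ereal_inf_lbound; exists x.
  by rewrite lee_fin; have := hC x; lra.
have ge0 := detour_cost_ge0 ch ch'; set H := detour_cost M d b h h' in fin ge0.
have HE : H = (fine H)%:E by rewrite fineK // ge0_fin_numE.
exists (fine H + 2) => z.
(* If the horofunction of x lies in [W], then d(z,x) < d(b,x) + h z + 1; together with h' z <=
   d(z,x) + h' x this bounds h' z - h z by the value d(b,x) + h' x, up to 1. *)
pose W : set {ptws {x | M x} -> R} := [set k | k z < h z + 1].
have Wh : nbhs h W.
  have c : (fun k : {ptws {x | M x} -> R} => k z) @ nbhs h --> h z.
    by apply: (ptws_cvg id _).1; apply: cvg_id.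
  by apply: (cvgr_lt _ c); rewrite ltrDl.
have [x [Wx hx]] : exists x : {x | M x}, W (horo (proj1_sig x)) /\
    d b (proj1_sig x) + h' x < fine H + 1.
  apply: contrapT => no.
  have : (ereal_inf [set ((d b (proj1_sig x) + h' x)%:E) | x in [set x | W (horo (proj1_sig x))]]
     <= H)%E by apply: ereal_sup_ubound; exists W.
  apply/negP; rewrite -ltNge HE; apply: (@lt_le_trans _ _ (fine H + 1)%:E).
    by rewrite lte_fin ltrDl.
  apply: le_ereal_inf_tmp => _ [x Wx <-]; rewrite lee_fin leNgt; apply/negP => lt.
  by apply: no; exists x.
have := horo_compact_lip z x ch'; move: Wx; rewrite /W /Defs.horo /=; lra.
Qed.

Lemma detour_lty h h' : horo_compact M d b h -> horo_compact M d b h' ->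
  quasi_busemann h -> quasi_busemann h' ->
  (detour M d b h h' < +oo)%E <->
  (exists C, forall z, h' z <= h z + C) /\ (exists C, forall z, h z <= h' z + C).
Proof.
move=> ch ch' qh qh'; rewrite -detour_cost_lty // -[X in _ /\ X]detour_cost_lty //.
have g1 := detour_cost_ge0 ch ch'; have g2 := detour_cost_ge0 ch' ch.
rewrite /detour; split=> [lt|[l1 l2]]; last exact: lte_add_pinfty.
by split; apply: le_lt_trans lt; rewrite ?leeDl ?leeDr.
Qed.

End Detour.
Arguments quasi_busemann {R X} M d b h.

(** Reduces the theorem to statements about ultrafilters on [M]: limits of the two families exist
    and determine each other, boundary limits are quasi-Busemann, and bounded difference means the
    same on both sides. The last two turn into equality of parts through [detour_lty]. *)
Lemma horo_transfer (R : realType) (X : Type) (M M' : set X) (d d' : X -> X -> R)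
  (b b' : X) (e : X -> X) :
  M b -> M' b' -> M' = e @` M ->
  (forall x y z, M x -> M y -> M z -> d x z <= d x y + d y z) ->
  (forall x y z, M' x -> M' y -> M' z -> d' x z <= d' x y + d' y z) ->
  (forall F : set_system X, UltraFilter F -> F M -> exists h : {ptws {x | M x} -> R}, horo M d b @ F --> h) ->
  (forall F : set_system X, UltraFilter F -> F M ->
    exists k : {ptws {x | M' x} -> R}, (horo M' d' b' \o e) @ F --> k) ->
  (forall (F G : set_system X) (h : {ptws {x | M x} -> R}) (k : {ptws {x | M' x} -> R}),
    UltraFilter F -> UltraFilter G -> F M -> G M ->
    horo M d b @ F --> h -> horo M d b @ G --> h ->
    (horo M' d' b' \o e) @ F --> k -> (horo M' d' b' \o e) @ G --> k) ->
  (forall (F G : set_system X) (h : {ptws {x | M x} -> R}) (k : {ptws {x | M' x} -> R}),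
    UltraFilter F -> UltraFilter G -> F M -> G M ->
    (horo M' d' b' \o e) @ F --> k -> (horo M' d' b' \o e) @ G --> k ->
    horo M d b @ F --> h -> horo M d b @ G --> h) ->
  (forall (F : set_system X) (h : {ptws {x | M x} -> R}) (k : {ptws {x | M' x} -> R}),
    UltraFilter F -> F M -> horo_boundary M d b h ->
    horo M d b @ F --> h -> (horo M' d' b' \o e) @ F --> k ->
    quasi_busemann M d b h /\ quasi_busemann M' d' b' k) ->
  (forall (F G : set_system X) (h h2 : {ptws {x | M x} -> R}) (k k2 : {ptws {x | M' x} -> R}),
    UltraFilter F -> UltraFilter G -> F M -> G M ->
    horo_boundary M d b h -> horo_boundary M d b h2 ->
    horo M d b @ F --> h -> (horo M' d' b' \o e) @ F --> k ->
    horo M d b @ G --> h2 -> (horo M' d' b' \o e) @ G --> k2 ->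
    (exists C, forall z, h2 z <= h z + C) /\ (exists C, forall z, h z <= h2 z + C) <->
    (exists C, forall z, k2 z <= k z + C) /\ (exists C, forall z, k z <= k2 z + C)) ->
  exists Phi, [/\ homeo_onto (horo_compact M d b) (horo_compact M' d' b') Phi,
    forall x, M x -> Phi (horo M d b x) = horo M' d' b' (e x) &
    forall h, horo_boundary M d b h -> exists2 h2, horo_boundary M' d' b' h2 &
      Phi @` horo_part M d b h = horo_part M' d' b' h2].
Proof.
move=> Mb Mb' ME tri tri' fl gl fg gf qb bd.
have [Phi [hom hPhi]] := @ultra_homeo X _ _ M (horo M d b) (horo M' d' b' \o e) (fun=> 0) (fun=> 0)
  (@ptws_hausdorff R _) (@ptws_hausdorff R _) uniform_regular uniform_regular fl gl fg gf.
have ME1 x : M' x -> exists2 y, M y & e y = x by rewrite ME => -[y My <-]; exists y.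
have ME2 y : M y -> M' (e y) by rewrite ME; exists y.
have gM : (horo M' d' b' \o e) @` M = horo M' d' b' @` M'.
  apply/seteqP; split=> [_ [y My <-]|_ [x /ME1[y My <-] <-]]; last by exists y.
  by exists (e y) => //; apply: ME2.
rewrite gM in hom; exists Phi.
have PhiE x : M x -> Phi (horo M d b x) = horo M' d' b' (e x).
  (* Along the principal ultrafilter at [x] both families are constant, so the extension takes the
     prescribed value there. *)
  move=> Mx; have FU := principal_filter_ultra x.
  have c1 : horo M d b @ principal_filter x --> horo M d b x.
    by move=> U Ux; apply/principal_filterP; apply: nbhs_singleton.
  have c2 := hPhi _ _ FU ((principal_filterP _ _).2 Mx) c1.
  apply: (cvg_unique (@ptws_hausdorff R _) c2) => U Ux.
  by apply/principal_filterP; apply: nbhs_singleton Ux.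
have [Phi_in cPhi [Psi [Psi_in cPsi PsiK PhiK]]] := hom.
have bnd h : horo_boundary M d b h -> horo_boundary M' d' b' (Phi h).
  move=> [ch nh]; split; first exact: Phi_in.
  move=> [_ /ME1[x Mx <-]]; rewrite -PhiE // => /(congr1 Psi).
  have cx : horo_compact M d b (horo M d b x) by apply: subset_closure; exists x.
  by rewrite !PsiK // => xh; apply: nh; exists x.
have bnd' k : horo_boundary M' d' b' k -> horo_boundary M d b (Psi k).
  move=> [ck nk]; split; first exact: Psi_in.
  move=> [x Mx /(congr1 Phi)]; rewrite PhiE // PhiK // => xk; apply: nk.
  by exists (e x) => //; apply: ME2.
have part h h2 : horo_boundary M d b h -> horo_boundary M d b h2 ->
    (detour M d b h h2 < +oo)%E <-> (detour M' d' b' (Phi h) (Phi h2) < +oo)%E.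
  move=> bh bh2; have [[ch _] [ch2 _]] := (bh, bh2).
  have [F [FU FM fh]] := (closure_ultra _ _ _).1 ch.
  have [G [GU GM gh2]] := (closure_ultra _ _ _).1 ch2.
  have kh := hPhi _ _ FU FM fh; have kh2 := hPhi _ _ GU GM gh2.
  have [q1 q1'] := qb F _ _ FU FM bh fh kh; have [q2 q2'] := qb G _ _ GU GM bh2 gh2 kh2.
  rewrite (detour_lty Mb tri ch ch2 q1 q2) (detour_lty Mb' tri' (Phi_in _ ch) (Phi_in _ ch2) q1' q2').
  exact: (bd F G).
split=> // h bh; exists (Phi h); first exact: bnd.
apply/seteqP; split=> [_ [h2 [bh2 dh2] <-]|k [bk dk]].
  by split; [apply: bnd|apply/part].
have [ck _] := bk; exists (Psi k); last exact: PhiK.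
by split; [apply: bnd'|apply/part; rewrite ?PhiK //; apply: bnd'].
Qed.

(** * Traces of linear operators *)

Section Trace.
Context {R : realType} {A : vectType R}.
Implicit Types (f g : A -> A).

Local Notation B := (vbasis (fullv : {vspace A})).

(** The rows are the images of the basis vectors, so composition reverses the matrix product. *)
Definition opmx f : 'M[R]_(\dim (fullv : {vspace A})) :=
  \matrix_(i, j) coord B j (f B`_i).

Definition optr f : R := \tr (opmx f).

Lemma basis_sum x : x = \sum_(i < \dim (fullv : {vspace A})) coord B i x *: B`_i.
Proof. exact: (coord_vbasis (memvf x)). Qed.

Lemma coord_eqP x y : (forall i, coord B i x = coord B i y) -> x = y.
Proof.
move=> h; rewrite (basis_sum x) (basis_sum y).
by apply: eq_bigr => i _; rewrite h.
Qed.

Lemma coordE i : (forall x y, coord B i (x + y) = coord B i x + coord B i y) *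
  (forall x, coord B i (- x) = - coord B i x) *
  (forall a x, coord B i (a *: x) = a * coord B i x) * (coord B i 0 = 0).
Proof. by do !split => *; rewrite ?linearD ?linearN ?linearZ ?linear0. Qed.

Lemma opmxM f g : linear g -> opmx (g \o f) = opmx f *m opmx g.
Proof.
move=> lg; pose gL : {linear A -> A} := HB.pack g (GRing.isLinear.Build R A A _ g lg).
apply/matrixP => i j; rewrite !mxE /=.
rewrite {1}(basis_sum (f B`_i)) -[g _]/(gL _) linear_sum linear_sum.
by apply: eq_bigr => k _; rewrite linearZ linearZ /= !mxE.
Qed.

Lemma optrC f g : linear f -> linear g -> optr (f \o g) = optr (g \o f).
Proof. by move=> lf lg; rewrite /optr (opmxM f lg) (opmxM g lf) mxtrace_mulC. Qed.

Lemma optrD f g : optr (fun x => f x + g x) = optr f + optr g.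
Proof.
by rewrite /optr /mxtrace -big_split; apply: eq_bigr => i _; rewrite !mxE linearD.
Qed.

Lemma optrZ c f : optr (fun x => c *: f x) = c * optr f.
Proof.
by rewrite /optr /mxtrace mulr_sumr; apply: eq_bigr => i _; rewrite !mxE linearZ.
Qed.

Lemma eq_optr f g : f =1 g -> optr f = optr g.
Proof. by move=> h; rewrite (_ : f = g) //; apply/funext. Qed.

(** The trace of an idempotent matrix is its rank: in a full rank factorization E = C R, idempotence
    cancels to R C = 1. *)
Lemma optr_idem f : linear f -> f \o f =1 f ->
  0 <= optr f /\ (optr f = 0 -> f =1 (fun=> 0)).
Proof.
move=> lf ff; set E := opmx f.
have EE : E *m E = E by rewrite -opmxM // /E; congr opmx; apply/funext.
have trE : optr f = (\rank E)%:R.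
  rewrite /optr -/E -[in LHS](mulmx_base E) mxtrace_mulC.
  suff -> : row_base E *m col_base E = 1%:M by rewrite mxtrace1.
  have := EE; rewrite -{1 2 3}(mulmx_base E) => h.
  apply: (row_free_inj (row_base_free E)).
  apply: (row_full_inj (col_base_full E)).
  by move: h; rewrite mul1mx !mulmxA.
split; first by rewrite trE ler0n.
rewrite trE => /eqP; rewrite pnatr_eq0 mxrank_eq0 => /eqP E0 x.
pose fL : {linear A -> A} := HB.pack f (GRing.isLinear.Build R A A _ f lf).
rewrite (basis_sum x) -[f _]/(fL _) linear_sum /= big1 // => i _.
rewrite -[f _]/(fL _) linearZ /= (_ : f _ = 0) ?scaler0 //.
apply: coord_eqP => j; have /matrixP/(_ i j) := E0.
by rewrite !mxE linear0.
Qed.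

End Trace.

(* Decides linear identities in A coordinatewise. *)
Ltac vring := apply: coord_eqP => ?; rewrite ?coordE; ring.
Existing Class jordan_algebra.

(** * Jordan algebras: trace form, functional calculus, cone of squares *)

Section JordanAlgebra.
Context {R : realType} {A : vectType R} {mul : A -> A -> A} {u : A}.
Context {JA : jordan_algebra mul u}.

Local Notation "x ** y" := (mul x y) (at level 40, left associativity).
Local Notation B := (vbasis (fullv : {vspace A})).

Lemma jmulC x y : x ** y = y ** x.
Proof. by case: JA. Qed.
Lemma jmulDl x y z : (x + y) ** z = x ** z + y ** z.
Proof. by case: JA => h _ _ _ _; have := h 1 x y z; rewrite !scale1r. Qed.
Lemma jmul0 x : 0 ** x = 0.
Proof.
by apply: (addrI (0 ** x)); rewrite -jmulDl !addr0.
Qed.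
Lemma jmulZl a x z : (a *: x) ** z = a *: (x ** z).
Proof. by case: JA => h _ _ _ _; have := h a x 0 z; rewrite addr0 jmul0 addr0. Qed.
Lemma jmulDr x y z : z ** (x + y) = z ** x + z ** y.
Proof. by rewrite jmulC jmulDl !(jmulC z). Qed.
Lemma jmulZr a x z : z ** (a *: x) = a *: (z ** x).
Proof. by rewrite jmulC jmulZl (jmulC z). Qed.
Lemma jmul0r x : x ** 0 = 0.
Proof. by rewrite jmulC jmul0. Qed.
Lemma jmulNl x z : (- x) ** z = - (x ** z).
Proof. by rewrite -scaleN1r jmulZl scaleN1r. Qed.
Lemma jmulNr x z : z ** (- x) = - (z ** x).
Proof. by rewrite jmulC jmulNl jmulC. Qed.
Lemma jmulBl x y z : (x - y) ** z = x ** z - y ** z.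
Proof. by rewrite jmulDl jmulNl. Qed.
Lemma jmulBr x y z : z ** (x - y) = z ** x - z ** y.
Proof. by rewrite jmulDr jmulNr. Qed.
Lemma jmul1 x : u ** x = x.
Proof. by case: JA. Qed.
Lemma jmul1r x : x ** u = x.
Proof. by rewrite jmulC jmul1. Qed.
Lemma jmul_suml (I : Type) (r : seq I) (P : pred I) (F : I -> A) y :
  (\sum_(i <- r | P i) F i) ** y = \sum_(i <- r | P i) (F i ** y).
Proof. by elim/big_rec2: _ => [|i a b _ <-]; rewrite ?jmul0 ?jmulDl. Qed.
Lemma jmul_sumr (I : Type) (r : seq I) (P : pred I) (F : I -> A) y :
  y ** (\sum_(i <- r | P i) F i) = \sum_(i <- r | P i) (y ** F i).
Proof. by rewrite jmulC jmul_suml; apply: eq_bigr => i _; rewrite jmulC. Qed.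
Lemma jmul_linear x : linear (mul x).
Proof. by move=> a y z; rewrite jmulDr jmulZr. Qed.
Lemma jsq_eq0 x y : x ** x + y ** y = 0 -> x = 0.
Proof. by case: JA => _ _ _ h _ /h[]. Qed.

Definition jexpand := (jmulDl, jmulDr, jmulNl, jmulNr, jmulZl, jmulZr).

(* The Jordan identity F(x) is cubic in x; its full polarization comes from
   F(x+z+t) - F(x+z) - F(x+t) - F(z+t) + F(x) + F(z) + F(t). *)
Lemma jordan_lin x z t y :
  (x ** z) ** (t ** y) + (z ** t) ** (x ** y) + (t ** x) ** (z ** y) =
  x ** ((z ** t) ** y) + z ** ((t ** x) ** y) + t ** ((x ** z) ** y).
Proof.
case: JA => _ _ J _ _; apply: coord_eqP => i.
have key a : coord B i ((a ** a) ** (a ** y)) = coord B i (a ** ((a ** a) ** y)) by rewrite J.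
have := key (x + z + t); have := key (x + z); have := key (x + t); have := key (z + t).
have := key x; have := key z; have := key t.
rewrite !(jmulC z x, jmulC t x, jmulC t z).
rewrite !jexpand !(jmulC z x, jmulC t x, jmulC t z) !coordE.
lra.
Qed.

(** The left side of [jordan_lin] does not change when y and t are exchanged, so its two right sides
    agree. Solved for one term, this writes the multiplication by (x z) y through multiplications by
    x, y, z and their pairwise products. *)
Lemma jordan_op x y z t :
  ((x ** z) ** y) ** t =
  x ** ((z ** y) ** t) + z ** ((y ** x) ** t) + y ** ((x ** z) ** t)
  - x ** (y ** (z ** t)) - z ** (y ** (x ** t)).
Proof.
have h1 := jordan_lin x z t y; have h2 := jordan_lin x z y t.
have e : (x ** z) ** (t ** y) + (z ** t) ** (x ** y) + (t ** x) ** (z ** y) =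
         (x ** z) ** (y ** t) + (z ** y) ** (x ** t) + (y ** x) ** (z ** t).
  by rewrite (jmulC t y) (jmulC (z ** t)) (jmulC x y) (jmulC (t ** x)) (jmulC t x) addrAC.
move: h1; rewrite e h2 (jmulC (z ** t) y) (jmulC t x) (jmulC (x ** t) y).
move=> h; apply: coord_eqP => i; have := congr1 (coord B i) h.
by rewrite !coordE (jmulC t); lra.
Qed.

(** * The trace form and the Peirce rules *)

Section TraceForm.

(** The form tr L_(xy) serves as inner product. Unlike [jtr], it is bilinear by construction and
    involves no choice of a frame. *)
Definition jip x y : R := optr (mul (mul x y)).

Lemma jipC x y : jip x y = jip y x.
Proof. by rewrite /jip jmulC. Qed.

Lemma jipDl x y z : jip (x + y) z = jip x z + jip y z.
Proof. by rewrite /jip jmulDl -optrD; apply: eq_optr => t; rewrite jmulDl. Qed.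
Lemma jipDr x y z : jip z (x + y) = jip z x + jip z y.
Proof. by rewrite jipC jipDl !(jipC z). Qed.
Lemma jipZl a x z : jip (a *: x) z = a * jip x z.
Proof. by rewrite /jip jmulZl -optrZ; apply: eq_optr => t; rewrite jmulZl. Qed.
Lemma jipZr a x z : jip z (a *: x) = a * jip z x.
Proof. by rewrite jipC jipZl jipC. Qed.
Lemma jip0l z : jip 0 z = 0.
Proof. by have := jipZl 0 0 z; rewrite scale0r mul0r. Qed.
Lemma jip0r z : jip z 0 = 0.
Proof. by rewrite jipC jip0l. Qed.
Lemma jipNl x z : jip (- x) z = - jip x z.
Proof. by rewrite -scaleN1r jipZl mulN1r. Qed.
Lemma jipNr x z : jip z (- x) = - jip z x.
Proof. by rewrite jipC jipNl jipC. Qed.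
Lemma jipBl x y z : jip (x - y) z = jip x z - jip y z.
Proof. by rewrite jipDl jipNl. Qed.
Lemma jipBr x y z : jip z (x - y) = jip z x - jip z y.
Proof. by rewrite jipDr jipNr. Qed.
Lemma jip_suml (I : Type) (r : seq I) (P : pred I) (F : I -> A) y :
  jip (\sum_(i <- r | P i) F i) y = \sum_(i <- r | P i) jip (F i) y.
Proof. by elim/big_rec2: _ => [|i a b _ <-]; rewrite ?jip0l ?jipDl. Qed.
Lemma jip_sumr (I : Type) (r : seq I) (P : pred I) (F : I -> A) y :
  jip y (\sum_(i <- r | P i) F i) = \sum_(i <- r | P i) jip y (F i).
Proof. by rewrite jipC jip_suml; apply: eq_bigr => i _; rewrite jipC. Qed.

Definition jipE := (jipDl, jipDr, jipNl, jipNr, jipZl, jipZr, jip0l, jip0r).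

Lemma optr_cycle x y z :
  optr (fun t => x ** (y ** (z ** t))) = optr (fun t => z ** (x ** (y ** t))).
Proof.
have h1 : linear (fun t => x ** (y ** t)).
  by move=> a s t; rewrite !(jmul_linear x, jmul_linear y).
exact: (optrC h1 (jmul_linear z)).
Qed.

(* The trace of L_((xz)y) - L_(x(zy)) vanishes, by jordan_op and cyclicity. *)
Lemma jip_assoc x y z : jip (x ** z) y = jip x (z ** y).
Proof.
rewrite /jip; pose T a b c := optr (fun t => a ** (b ** (c ** t))).
pose S a b c := optr (fun t => a ** ((b ** c) ** t)).
have E x' y' z' : optr (mul ((x' ** z') ** y')) =
    S x' z' y' + S z' y' x' + S y' x' z' - T x' y' z' - T z' y' x'.
  rewrite /S /T -!optrD -2!(mulN1r (optr _)) -!optrZ -!optrD.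
  by apply: eq_optr => t; rewrite !scaleN1r jordan_op.
rewrite (jmulC x (z ** y)) (jmulC z y) (E x y z) (E y x z).
have Sc a b c : S a b c = S a c b.
  by apply: eq_optr => t; rewrite (jmulC b).
have h1 := optr_cycle x y z; have h2 := optr_cycle z y x.
rewrite (Sc y z x) (Sc z x y) (Sc x y z) /T h1 h2; rewrite -/(T z x y) -/(T x z y) -/(T y x z).
have -> : T y x z = T z y x by rewrite /T optr_cycle.
have -> : T z y x = T x z y by rewrite /T optr_cycle.
by ring.
Qed.

(* Peirce polynomial 2 t^3 - 3 t^2 + t, i.e. eigenvalues 0, 1/2, 1. *)
Lemma peirce_poly p x : p ** p = p ->
  p ** x = 3 *: (p ** (p ** x)) - 2 *: (p ** (p ** (p ** x))).
Proof.
move=> pp; have := jordan_op p p p x; rewrite !pp => h; rewrite [LHS]h.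
by apply: coord_eqP => i; rewrite !coordE; ring.
Qed.

(** The linearized Jordan identity at p, p, t makes L_p and L_t commute when t lies in the Peirce
    space A_1(p) or A_0(p). The multiplication rules of these spaces follow from it. *)
Lemma peirce_comm p t x : p ** p = p -> (p ** t = t \/ p ** t = 0) ->
  p ** (t ** x) = t ** (p ** x).
Proof.
move=> pp h.
have := jordan_lin p p t x; rewrite !pp !(jmulC t p).
case: h => ->; rewrite ?jmul0 ?jmul0r ?add0r ?addr0 // => h.
apply: coord_eqP => i; move: (congr1 (coord B i) h).
by rewrite !coordE; lra.
Qed.

Lemma peirce11 p x y : p ** p = p -> p ** x = x -> p ** y = y ->
  p ** (x ** y) = x ** y.
Proof. by move=> pp px py; rewrite peirce_comm ?py //; left. Qed.

Lemma peirce10 p x y : p ** p = p -> p ** x = x -> p ** y = 0 -> x ** y = 0.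
Proof.
move=> pp px py; have h1 : p ** (x ** y) = 0.
  by rewrite peirce_comm ?py ?jmul0r //; left.
by rewrite -h1 (jmulC x) peirce_comm ?px //; right.
Qed.

Lemma idemC p : p ** p = p -> (u - p) ** (u - p) = u - p.
Proof.
by move=> pp; rewrite jmulBl jmul1 jmulBr pp jmul1r subrr subr0.
Qed.

End TraceForm.

(** * Power associativity and annihilating polynomials *)

Section PowerAssociativity.

Implicit Types (g h : {poly R}).

Definition jpow (x : A) k := iter k (mul x) u.

(** By [jordan_op], L of x^(k+2) is a polynomial in L_x and the L of x^2, x^k and x^(k+1). The
    induction therefore carries two consecutive exponents and commutation with both L_x and L of
    x^2. *)
Lemma jpow_comm x k :
  (forall t, x ** (jpow x k ** t) = jpow x k ** (x ** t)) /\
  (forall t, (x ** x) ** (jpow x k ** t) = jpow x k ** ((x ** x) ** t)).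
Proof.
pose P k := (forall t, x ** (jpow x k ** t) = jpow x k ** (x ** t)) /\
  (forall t, (x ** x) ** (jpow x k ** t) = jpow x k ** ((x ** x) ** t)).
have J t : (x ** x) ** (x ** t) = x ** ((x ** x) ** t) by case: JA.
suff: P k /\ P k.+1 by case.
elim: k => [|k [[a1 a2] [b1 b2]]].
  by rewrite /P /jpow /= jmul1r; split; split=> t; rewrite ?jmul1 ?J.
split=> //; set a := jpow x k in a1 a2 *.
have ab : jpow x k.+1 = a ** x by rewrite jmulC.
have E t : jpow x k.+2 ** t = a ** ((x ** x) ** t) + x ** ((a ** x) ** t)
    + x ** ((a ** x) ** t) - a ** (x ** (x ** t)) - x ** (x ** (a ** t)).
  by rewrite -[jpow _ _.+2]/(x ** jpow x k.+1) ab (jmulC x (a ** x)) jordan_op (jmulC x a).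
rewrite ab in b1 b2; split=> t; rewrite !E !(jmulNr, jmulDr).
  by rewrite !(a1, b1) !J.
by rewrite !(J, a2, b2).
Qed.

Definition jev x (g : {poly R}) := \sum_(i < size g) g`_i *: jpow x i.

Lemma jevE n x g : (size g <= n)%N -> jev x g = \sum_(i < n) g`_i *: jpow x i.
Proof.
move=> sg; rewrite /jev (big_ord_widen _ (fun i => g`_i *: jpow x i) sg).
rewrite [RHS](bigID (fun i : 'I_n => i < size g)%N) /= [X in _ + X]big1 ?addr0 // => i.
by rewrite -leqNgt => /(nth_default 0) ->; rewrite scale0r.
Qed.

Lemma jevD x g h : jev x (g + h) = jev x g + jev x h.
Proof.
pose n := maxn (size g) (size h).
rewrite (jevE x (leq_maxl (size g) (size h))) (jevE x (leq_maxr (size g) (size h))).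
rewrite (jevE x (size_polyD g h)) -big_split; apply: eq_bigr => i _.
by rewrite coefD scalerDl.
Qed.

Lemma jevZ x c g : jev x (c *: g) = c *: jev x g.
Proof.
rewrite (jevE x (size_scale_leq c g)) scaler_sumr; apply: eq_bigr => i _.
by rewrite coefZ scalerA.
Qed.

Lemma jevMX x g : jev x (g * 'X) = x ** jev x g.
Proof.
have s : (size (g * 'X)%R <= (size g).+1)%N.
  by rewrite (leq_trans (size_polyMleq _ _)) // size_polyX addn2.
rewrite (jevE x s) big_ord_recl coefMX eqxx scale0r add0r jmul_sumr.
by apply: eq_bigr => i _; rewrite coefMX /= jmulZr.
Qed.

Lemma jevC x c : jev x c%:P = c *: u.
Proof.
by rewrite (jevE x (size_polyC_leq1 c)) big_ord_recl big_ord0 coefC eqxx addr0.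
Qed.

Lemma jev0 x : jev x 0 = 0.
Proof. by have := jevC x 0; rewrite scale0r polyC0. Qed.

Lemma jevX x : jev x 'X = x.
Proof. by rewrite -(mul1r 'X) jevMX -[1]/(1%:P) jevC scale1r jmul1r. Qed.

Lemma jevB x g h : jev x (g - h) = jev x g - jev x h.
Proof. by rewrite jevD -scaleN1r jevZ scaleN1r. Qed.

Lemma jev_comm x g t : x ** (jev x g ** t) = jev x g ** (x ** t).
Proof.
rewrite /jev !jmul_suml jmul_sumr; apply: eq_bigr => i _.
by rewrite !jmulZl jmulZr (proj1 (jpow_comm x i)).
Qed.

(** Power associativity: a factor X of h can be moved past g because multiplication by g(x) commutes
    with L_x. *)
Lemma jevM x g h : jev x (g * h) = jev x g ** jev x h.
Proof.
elim/poly_ind: h => [|h c IH].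
  by rewrite mulr0 jev0 jmul0r.
rewrite mulrDr mulrA jevD jevMX IH jevD jevMX jmulDr jev_comm.
by rewrite mulrC mul_polyC jevZ jevC jmulZr jmul1r.
Qed.

(* If e ** x = x, every polynomial in x without constant term lies in the
   Peirce space A_1(e). *)
Lemma jev_peirce1 e x g : e ** e = e -> e ** x = x -> g.[0] = 0 ->
  e ** jev x g = jev x g.
Proof.
move=> ee ex g0.
have pe k : e ** jpow x k.+1 = jpow x k.+1.
  elim: k => [|k IH]; first by rewrite /jpow /= jmul1r.
  by rewrite -[jpow x k.+2]/(x ** jpow x k.+1) peirce11.
rewrite (jevE x (leqnSn _)) big_ord_recl -horner_coef0 g0 scale0r add0r jmul_sumr.
by apply: eq_bigr => i _; rewrite jmulZr pe.
Qed.

(** In dimension n the n + 1 powers of x up to x^n are linearly dependent; a row in the kernel of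
    their coordinate matrix gives the coefficients. *)
Lemma jev_annihil x : exists2 g, g != 0 & jev x g = 0.
Proof.
set n := \dim (fullv : {vspace A}).
pose M : 'M[R]_(n.+1, n) := \matrix_(i, j) coord (vbasis fullv) j (jpow x i).
have rM : ~~ row_free M by rewrite /row_free neq_ltn ltnS rank_leq_col.
have : kermx M != 0 by rewrite kermx_eq0.
case/rowV0Pn => v /sub_kermxP vM v0.
exists (\poly_(i < n.+1) v ord0 (inord i)).
  apply: contra v0 => /eqP g0; apply/eqP/rowP => i; rewrite mxE.
  have := congr1 (fun g : {poly R} => g`_i) g0.
  by rewrite coef_poly coef0 ltn_ord inord_val.
rewrite (jevE x (size_poly _ _)); apply: coord_eqP => j; rewrite linear0.
rewrite linear_sum; move/rowP: vM => /(_ j); rewrite !mxE => e; rewrite -[RHS]e.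
by apply: eq_bigr => i _; rewrite linearZ /= coef_poly ltn_ord inord_val !mxE.
Qed.

(** Formal reality excludes nilpotents: a vanishing square has a vanishing root, and the exponent is
    halved k times. *)
Lemma jev_nilp x g k : jev x (g ^+ (2 ^ k)) = 0 -> jev x g = 0.
Proof.
elim: k g => [|k IH] g; first by rewrite expr1.
rewrite expnS exprM => /IH; rewrite expr2 jevM => h.
by apply: (jsq_eq0 (y := 0)); rewrite jmul0 addr0.
Qed.

(** Take a complex root a + bi. If b is not 0, the remainder modulo (X - a)^2 + b^2 is a real
    polynomial of degree at most 1 that vanishes at a nonreal point, hence it is 0. *)
Lemma poly_rcf_factor (g : {poly R}) : (1 < size g)%N ->
  (exists a h, g = ('X - a%:P) * h) \/
  (exists a b h, b != 0 /\ g = (('X - a%:P) ^+ 2 + (b ^+ 2)%:P) * h).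
Proof.
move=> sg; pose C := complex.complex R.
pose gC := map_poly (complex.real_complex R) g.
have : size gC != 1%N by rewrite size_map_poly neq_ltn sg orbT.
case/closed_rootP => -[a b] rt.
have [b0|b0] := eqVneq b 0.
  left; exists a; rewrite b0 in rt.
  have : root g a by rewrite -(fmorph_root (complex.real_complex R)).
  by rewrite -dvdp_XsubCl => /dvdpP[h ->]; exists h; rewrite mulrC.
right; exists a, b; set Q := _ + _.
have sXa : size (('X - a%:P) ^+ 2) = 3%N by rewrite size_exp_XsubC.
have sQ : size Q = 3%N.
  by rewrite size_polyDl sXa // (leq_ltn_trans (size_polyC_leq1 _)).
have Q0 : Q != 0 by rewrite -size_poly_eq0 sQ.
pose z := complex.Complex a b; pose rc := complex.real_complex R.
have rQ : (map_poly rc Q).[z] = 0.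
  rewrite rmorphD rmorphXn rmorphB /= map_polyX !map_polyC !hornerE.
  by apply/eqP; rewrite complex.eq_complex /= expr2 /=; apply/andP; split; apply/eqP; ring.
have : (map_poly rc (g %% Q)).[z] = 0.
  have := congr1 (fun p => (map_poly rc p).[z]) (divp_eq g Q).
  by rewrite rmorphD rmorphM /= hornerD hornerM rQ mulr0 add0r (rootP rt) => <-.
have sr : (size (g %% Q)%R < 3)%N by rewrite -sQ ltn_modp.
have er : g %% Q = (g %% Q)`_1 *: 'X + ((g %% Q)`_0)%:P.
  apply/polyP => -[|[|i]]; rewrite coefD coefZ coefX coefC /= ?mulr0 ?mulr1 ?add0r ?addr0 //.
  by rewrite nth_default // (leq_trans _ (_ : 2 <= i.+2)%N) // -ltnS.
rewrite er rmorphD /= map_polyZ map_polyX map_polyC hornerD hornerZ hornerX hornerC.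
move/eqP; rewrite complex.eq_complex /= => /andP[/eqP h1 /eqP h2].
have r1 : (g %% Q)`_1 = 0.
  by apply: (mulIf b0); move: h2; rewrite !mul0r !addr0.
have r0 : (g %% Q)`_0 = 0 by move: h1; rewrite r1; lra.
exists (g %/ Q); split=> //; rewrite mulrC {1}(divp_eq g Q) er r1 r0.
by rewrite scale0r !addr0.
Qed.

(** All spectra are real because a factor (X - a)^2 + b^2 can be cancelled from an annihilating
    polynomial: if v is the value of the cofactor at x, the squares of b v and of (x - a) v add up
    to 0, so v = 0 by formal reality. *)
Lemma jev_annihil_split x : exists s : seq R,
  uniq s /\ jev x (\prod_(a <- s) ('X - a%:P)) = 0.
Proof.
have key n g h : (size g <= n)%N -> g != 0 -> jev x (g * h) = 0 ->
    exists s : seq R, jev x (\prod_(a <- s) ('X - a%:P) * h) = 0.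
  elim: n g h => [|n IH] g h sg g0 gh.
    by move: g0; rewrite -size_poly_eq0 -leqn0 sg.
  have [s1|s1] := leqP (size g) 1.
    exists [::]; rewrite big_nil mul1r.
    have e := size1_polyC s1; move: g0 gh; rewrite e polyC_eq0 mul_polyC jevZ => c0.
    by move/eqP; rewrite scaler_eq0 (negPf c0) => /eqP.
  case: (poly_rcf_factor s1) => [[a [g1 eg]]|[a [b [g1 [b0 eg]]]]].
    have g10 : g1 != 0 by apply: contraNneq g0 => e; rewrite eg e mulr0.
    have sg1 : (size g1 <= n)%N.
      by move: sg; rewrite eg mulrC size_Mmonic ?monicXsubC // size_XsubC addn2 /= ltnS.
    have [s hs] : exists s : seq R,
        jev x (\prod_(a <- s) ('X - a%:P) * (('X - a%:P) * h)) = 0.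
      by apply: (IH g1) => //; rewrite mulrCA mulrA -eg.
    by exists (a :: s); rewrite big_cons -mulrA mulrCA.
  have g10 : g1 != 0 by apply: contraNneq g0 => e; rewrite eg e mulr0.
  apply: (IH g1) => //.
    have := sg; rewrite eg size_mul //; last first.
      by apply: contraNneq g0 => e; rewrite eg e mul0r.
    rewrite size_polyDl size_exp_XsubC //= => [|]; last first.
      by rewrite (leq_ltn_trans (size_polyC_leq1 _)).
    by rewrite !addSn /= ltnS => /ltnW.
  have h1 : jev x (g1 * h * (g * h)) = 0 by rewrite jevM gh jmul0r.
  have e2 : g1 * h * (g * h) = (b *: (g1 * h)) * (b *: (g1 * h))
     + (g1 * h * ('X - a%:P)) * (g1 * h * ('X - a%:P)).
    rewrite eg -!mul_polyC rmorphXn /=; ring.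
  move: h1; rewrite e2 jevD !jevM => /jsq_eq0 /eqP.
  by rewrite jevZ scaler_eq0 (negPf b0) jevM => /eqP.
have [g g0 hg] := jev_annihil x.
have [|s] := key (size g) g 1 (leqnn _) g0; first by rewrite mulr1.
(* Repeated roots are removed by [jev_nilp]: the full product divides the power [size s] of the
   squarefree one, and [size s] is below 2 ^ [size s]. *)
rewrite mulr1 => hs; exists (undup s); split; first exact: undup_uniq.
set f := \prod_(a <- undup s) _.
apply: (@jev_nilp x f (size s)).
have : \prod_(a <- s) ('X - a%:P) %| f ^+ (size s).
  have dv a : a \in s -> 'X - a%:P %| f.
    by rewrite -mem_undup => /(bigD1_seq a) /(_ (undup_uniq s)); rewrite /f => ->; rewrite dvdp_mulr.
  elim: (s) dv => [|a t IH] dv; first by rewrite big_nil dvd1p.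
  rewrite big_cons exprS dvdp_mul ?dv ?mem_head //.
  by apply: IH => b bt; rewrite dv // in_cons bt orbT.
case/dvdpP => q e.
have [k ek] : exists k, (2 ^ size s = size s + k)%N.
  by exists (2 ^ size s - size s)%N; rewrite subnKC // ltnW // ltn_expl.
by rewrite ek exprD e !jevM hs jmul0r jmul0.
Qed.

End PowerAssociativity.

(** * Spectral theorem, functional calculus, self-duality of the cone *)

Section Spectral.
Implicit Types (g h : {poly R}).

(* Members may vanish, so that all systems can be padded to the same length. *)
Definition osys r (p : 'I_r -> A) : Prop :=
  [/\ (forall i, p i ** p i = p i), (forall i j, i != j -> p i ** p j = 0) &
      \sum_i p i = u].

Lemma osys_mul r (p : 'I_r -> A) (lam : 'I_r -> R) j : osys p ->
  p j ** (\sum_i lam i *: p i) = lam j *: p j.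
Proof.
case=> pp po _; rewrite jmul_sumr (bigD1 j) //= jmulZr pp big1 ?addr0 // => i ij.
by rewrite jmulZr po ?scaler0 // eq_sym.
Qed.

Lemma osys_mulS r (p : 'I_r -> A) (lam mu : 'I_r -> R) : osys p ->
  (\sum_i lam i *: p i) ** (\sum_i mu i *: p i) = \sum_i (lam i * mu i) *: p i.
Proof.
move=> op; rewrite jmul_suml; apply: eq_bigr => i _.
by rewrite jmulZl osys_mul // scalerA.
Qed.

Lemma osys_jev r (p : 'I_r -> A) (lam : 'I_r -> R) g : osys p ->
  jev (\sum_i lam i *: p i) g = \sum_i g.[lam i] *: p i.
Proof.
move=> op; elim/poly_ind: g => [|g c IH].
  by rewrite jev0 big1 // => i _; rewrite horner0 scale0r.
rewrite jevD jevMX IH osys_mulS // jevC.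
case: (op) => _ _ <-; rewrite scaler_sumr -big_split; apply: eq_bigr => i _ /=.
by rewrite !hornerE -scalerDl mulrC.
Qed.

Lemma interpolation (s : seq R) (f : R -> R) : uniq s ->
  exists g, forall a, a \in s -> g.[a] = f a.
Proof.
elim: s => [|a s IH] /=; first by exists 0.
case/andP=> as_ /IH[g hg]; pose m := \prod_(b <- s) ('X - b%:P).
have ma : m.[a] != 0.
  by rewrite -[_ == 0]/(root m a) root_prod_XsubC.
exists (g + ((f a - g.[a]) / m.[a]) *: m) => b; rewrite in_cons => /orP[/eqP ->|bs].
  by rewrite !hornerE mulfVK // addrC subrK.
have -> : (g + ((f a - g.[a]) / m.[a]) *: m).[b] = g.[b].
  have /eqP mb : root m b by rewrite root_prod_XsubC.
  by rewrite hornerD hornerZ mb mulr0 addr0.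
exact: hg.
Qed.

(** The idempotents are the values at x of the Lagrange polynomials of the roots [s]: polynomials
    that agree on [s] have the same value at x. *)
Lemma spectral x : exists r (p : 'I_r -> A) (lam : 'I_r -> R),
  osys p /\ x = \sum_i lam i *: p i.
Proof.
have [s [us hs]] := jev_annihil_split x.
have van g : (forall a, a \in s -> g.[a] = 0) -> jev x g = 0.
  move=> h; have : \prod_(a <- s) ('X - a%:P) %| g.
    by rewrite uniq_roots_dvdp ?uniq_rootsE //; apply/allP => a /h /eqP.
  by case/dvdpP => q ->; rewrite jevM hs jmul0r.
have eqv g h : (forall a, a \in s -> g.[a] = h.[a]) -> jev x g = jev x h.
  move=> e; apply/eqP; rewrite -subr_eq0 -jevB; apply/eqP/van => a /e.
  by rewrite !hornerE => ->; rewrite subrr.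
have /choice[ell hell] : forall i : 'I_(size s), exists g, forall a, a \in s ->
    g.[a] = (a == s`_i)%:R.
  by move=> i; apply: (interpolation (fun a => (a == s`_i)%:R)).
have memi (i : 'I_(size s)) : s`_i \in s by rewrite mem_nth.
have nthE (i j : 'I_(size s)) : (s`_i == s`_j) = (i == j) by rewrite nth_uniq.
have jsum (F : 'I_(size s) -> {poly R}) : jev x (\sum_i F i) = \sum_i jev x (F i).
  elim/big_rec2: _ => [|i a b _ <-]; last by rewrite jevD.
  by rewrite jev0.
have sumE (c : R -> R) a : a \in s -> (\sum_(i < size s) c (s`_i) *: ell i).[a] = c a.
  move=> as_; have ia : (index a s < size s)%N by rewrite index_mem.
  rewrite horner_sum (bigD1 (Ordinal ia)) //= !hornerE hell // nth_index // eqxx mulr1.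
  rewrite big1 ?addr0 // => i /eqP ne; rewrite !hornerE hell //.
  case: eqP => [e|]; last by rewrite mulr0.
  by case: ne; apply/val_inj => /=; rewrite e index_uniq.
exists (size s), (fun i => jev x (ell i)), (fun i : 'I_(size s) => s`_i); split; first split.
- by move=> i; rewrite -jevM; apply: eqv => a as_; rewrite hornerM hell //; case: eqP; rewrite ?mulr1 ?mulr0.
- move=> i j ij; rewrite -jevM; apply: van => a as_; rewrite hornerM !hell //.
  case: eqP => [->|]; last by rewrite mul0r.
  by rewrite nthE (negPf ij) mulr0.
- rewrite -jsum -[RHS]scale1r -(jevC x); apply: eqv => a as_.
  by have := sumE (fun=> 1) a as_; under eq_bigr do rewrite scale1r; rewrite hornerC.
- rewrite -[LHS]jevX -(eqv (\sum_(i < size s) s`_i *: ell i) 'X); last first.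
    by move=> a as_; rewrite (sumE id) // hornerX.
  by rewrite jsum; apply: eq_bigr => i _; rewrite jevZ.
Qed.

(* The value does not depend on the decomposition, see [fcE]. *)
Definition fc (f : R -> R) (x : A) : A :=
  xget 0 [set y | exists r (p : 'I_r -> A) (lam : 'I_r -> R),
    [/\ osys p, x = \sum_i lam i *: p i & y = \sum_i f (lam i) *: p i]].

Lemma fc_poly2 (f : R -> R) (s : seq R) : exists g, forall a, a \in s -> g.[a] = f a.
Proof.
have [g hg] := interpolation f (undup_uniq s); exists g => a as_.
by apply: hg; rewrite mem_undup.
Qed.

(** On the finitely many eigenvalues of two decompositions f agrees with one polynomial, and the
    value of a polynomial at x refers to no decomposition. *)
Lemma fcE f r (p : 'I_r -> A) lam : osys p ->
  fc f (\sum_i lam i *: p i) = \sum_i f (lam i) *: p i.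
Proof.
move=> op; rewrite /fc; case: xgetP => [y _ [r' [p' [lam' [op' e ->]]]]|no]; last first.
  by exfalso; apply: (no (\sum_i f (lam i) *: p i)); exists r, p, lam.
have [g hg] := fc_poly2 f (codom lam ++ codom lam').
transitivity (jev (\sum_i lam i *: p i) g).
  rewrite e osys_jev //; apply: eq_bigr => i _; rewrite hg //.
  by rewrite mem_cat codom_f orbT.
rewrite osys_jev //; apply: eq_bigr => i _; rewrite hg //.
by rewrite mem_cat codom_f.
Qed.

Lemma fc_peirce1 e x f : e ** e = e -> e ** x = x -> f 0 = 0 ->
  e ** fc f x = fc f x.
Proof.
move=> ee ex f0; have [r [p [lam [op xE]]]] := spectral x.
have [g hg] := fc_poly2 f (0 :: codom lam).
have -> : fc f x = jev x g.
  rewrite xE osys_jev // fcE //; apply: eq_bigr => i _.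
  by rewrite hg // in_cons codom_f orbT.
by apply: jev_peirce1 => //; rewrite hg ?mem_head.
Qed.

(* Projection onto the Peirce space A_1(p); [jV] below projects onto A_(1/2)(p). *)
Definition jU p x : A := 2 *: (p ** (p ** x)) - p ** x.

Lemma jU_sum (x : A) (p : A) : p ** x = jU p x + 2^-1 *: (4 *: (p ** x) - 4 *: (p ** (p ** x))).
Proof.
apply: coord_eqP => i; rewrite /jU !coordE.
by field.
Qed.

Lemma peirce_cube p x : p ** p = p ->
  p ** (p ** (p ** x)) = (3 / 2) *: (p ** (p ** x)) - 2^-1 *: (p ** x).
Proof.
move=> pp; have h := peirce_poly x pp; apply: coord_eqP => i.
have := congr1 (coord (vbasis fullv) i) h.
rewrite !coordE => e; rewrite -[RHS]/(_ - _).
by apply: (mulfI (_ : 2 != 0 :> R)); rewrite ?pnatr_eq0 //; lra.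
Qed.

Definition jV p x : A := 4 *: (p ** x) - 4 *: (p ** (p ** x)).

Lemma jU_linear p : linear (jU p).
Proof.
move=> a x y; rewrite /jU !(jmulDr, jmulZr); apply: coord_eqP => i.
by rewrite !coordE; ring.
Qed.
Lemma jV_linear p : linear (jV p).
Proof.
move=> a x y; rewrite /jV !(jmulDr, jmulZr); apply: coord_eqP => i.
by rewrite !coordE; ring.
Qed.

Lemma jU_idem p x : p ** p = p -> jU p (jU p x) = jU p x.
Proof.
move=> pp; rewrite /jU !(jmulDr, jmulNr, jmulZr) !(peirce_cube _ pp).
apply: coord_eqP => i.
by rewrite !coordE; field.
Qed.
Lemma jV_idem p x : p ** p = p -> jV p (jV p x) = jV p x.
Proof.
move=> pp; rewrite /jV !(jmulDr, jmulNr, jmulZr) !(peirce_cube _ pp).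
rewrite !(jmulDr, jmulNr, jmulZr) !(peirce_cube _ pp); apply: coord_eqP => i.
by rewrite !coordE; field.
Qed.

Lemma jip_mul p x y : jip (p ** x) y = jip x (p ** y).
Proof. by rewrite (jmulC p) jip_assoc. Qed.

Lemma jU_sym p x y : jip (jU p x) y = jip x (jU p y).
Proof. by rewrite /jU !jipE !jip_mul. Qed.
Lemma jV_sym p x y : jip (jV p x) y = jip x (jV p y).
Proof. by rewrite /jV !jipE !jip_mul. Qed.

(** The number is tr L_p = tr U_p + (tr V_p) / 2, a sum of traces of projections. If it vanishes,
    both projections vanish, so L_p = 0 and p = p p = 0. *)
Lemma jip_idem_gt0 p : p ** p = p -> p != 0 -> 0 < jip p p.
Proof.
move=> pp p0; have [U0 UE] := optr_idem (jU_linear p) (fun x => jU_idem x pp).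
have [V0 VE] := optr_idem (jV_linear p) (fun x => jV_idem x pp).
have e : jip p p = optr (jU p) + 2^-1 * optr (jV p).
  by rewrite /jip pp -optrZ -optrD; apply: eq_optr => x; rewrite {1}jU_sum.
rewrite lt_neqAle {2}e addr_ge0 ?mulr_ge0 ?invr_ge0 // andbT eq_sym e.
rewrite paddr_eq0 ?mulr_ge0 ?invr_ge0 //; apply: contra p0 => /andP[/eqP/UE hU].
rewrite mulf_eq0 invr_eq0 pnatr_eq0 /= => /eqP/VE hV.
by rewrite -pp jU_sum -/(jV p p) hU hV scaler0 addr0.
Qed.

Lemma jip_osys r (p : 'I_r -> A) (lam mu : 'I_r -> R) : osys p ->
  jip (\sum_i lam i *: p i) (\sum_i mu i *: p i) = \sum_i lam i * mu i * jip (p i) (p i).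
Proof.
move=> op; rewrite jip_suml; apply: eq_bigr => i _.
have e : (\sum_j mu j *: p j) ** p i = mu i *: p i by rewrite jmulC osys_mul.
by case: (op) => pp _ _; rewrite jipZl -{1}(pp i) jip_assoc jmulC e jipZr mulrA.
Qed.

Lemma jip_idem_ge0 p : p ** p = p -> 0 <= jip p p.
Proof.
by move=> pp; have [->|/(jip_idem_gt0 pp)/ltW //] := eqVneq p 0; rewrite jip0l.
Qed.

Lemma jip_ge0 x : 0 <= jip x x.
Proof.
have [r [p [lam [op ->]]]] := spectral x; rewrite jip_osys //.
apply: sumr_ge0 => i _; apply: mulr_ge0; first by rewrite -expr2 sqr_ge0.
by case: op => pp _ _; apply: jip_idem_ge0.
Qed.

Lemma jip_eq0 x : jip x x = 0 -> x = 0.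
Proof.
have [r [p [lam [op ->]]]] := spectral x; rewrite jip_osys //.
case: (op) => pp _ _.
move/eqP; rewrite psumr_eq0 => [/allP h|i _]; last first.
  by rewrite mulr_ge0 ?jip_idem_ge0 // -expr2 sqr_ge0.
apply: big1 => i _; have := h i (mem_index_enum i); rewrite /= !mulf_eq0.
have [->|p0] := eqVneq (p i) 0; first by rewrite scaler0.
by rewrite (gt_eqF (jip_idem_gt0 (pp i) p0)) orbF orbb => /eqP ->; rewrite scale0r.
Qed.

(** L_p is positive semidefinite, being U_p + V_p / 2 with symmetric projections U_p and V_p. *)
Lemma jip_mulp_ge0 p x : p ** p = p ->
  0 <= jip (p ** x) x /\ (jip (p ** x) x = 0 -> p ** x = 0).
Proof.
move=> pp; have e : jip (p ** x) x = jip (jU p x) (jU p x) + 2^-1 * jip (jV p x) (jV p x).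
  rewrite jU_sum -/(jV p x) jipDl jipZl [in RHS]jU_sym jU_idem // (jipC x).
  by rewrite [in RHS]jV_sym jV_idem // (jipC x (jV p x)).
split; first by rewrite e addr_ge0 ?mulr_ge0 ?jip_ge0 ?invr_ge0.
move/eqP; rewrite e paddr_eq0 ?mulr_ge0 ?jip_ge0 ?invr_ge0 //.
rewrite mulf_eq0 invr_eq0 pnatr_eq0 /= => /andP[/eqP/jip_eq0 hU /eqP/jip_eq0 hV].
by rewrite jU_sum -/(jV p x) hU hV scaler0 addr0.
Qed.

Lemma jip_idem2_ge0 p q : p ** p = p -> q ** q = q -> 0 <= jip p q.
Proof. by move=> pp qq; rewrite -qq -jip_assoc; apply: (jip_mulp_ge0 q pp).1. Qed.

Lemma jip_idem2_eq0 p q : p ** p = p -> q ** q = q -> jip p q = 0 -> p ** q = 0.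
Proof. by move=> pp qq; rewrite -qq -jip_assoc qq; apply: (jip_mulp_ge0 q pp).2. Qed.

Local Notation pos := (squares mul).

Lemma pos_sum r (p : 'I_r -> A) (lam : 'I_r -> R) : osys p ->
  (forall i, 0 <= lam i) -> pos (\sum_i lam i *: p i).
Proof.
move=> op l0; exists (\sum_i Num.sqrt (lam i) *: p i) => //.
by rewrite osys_mulS //; apply: eq_bigr => i _; rewrite -expr2 sqr_sqrtr.
Qed.

Lemma pos_spec x : pos x -> exists r (p : 'I_r -> A) (lam : 'I_r -> R),
  [/\ osys p, x = \sum_i lam i *: p i & forall i, 0 <= lam i].
Proof.
case=> y _ <-; have [r [p [lam [op ->]]]] := spectral y.
exists r, p, (fun i => lam i * lam i); split; rewrite ?osys_mulS // => i.
by rewrite -expr2 sqr_ge0.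
Qed.

Lemma pos_idem e : e ** e = e -> pos e.
Proof. by exists e. Qed.

(** One half of self-duality, tested on idempotents only: the eigenvalue of x at a nonzero p i has
    the sign of <p i, x>. Membership in the cone thereby becomes a family of linear inequalities,
    from which convexity and closedness follow. *)
Lemma pos_dual x : (forall e, e ** e = e -> 0 <= jip e x) -> pos x.
Proof.
have [r [p [lam [op ->]]]] := spectral x; case: (op) => pp _ _ h.
have -> : \sum_i lam i *: p i = \sum_i (if p i == 0 then 0 else lam i) *: p i.
  by apply: eq_bigr => i _; case: eqP => // ->; rewrite !scaler0.
apply: pos_sum => // i; case: eqP => // /eqP pi0.
have := h _ (pp i); rewrite -{1}(pp i) jip_assoc osys_mul // jipZr.
by rewrite pmulr_lge0 // jip_idem_gt0.
Qed.

Lemma pos_ip_idem x e : pos x -> e ** e = e -> 0 <= jip e x.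
Proof.
case/pos_spec=> r [p [lam [op -> l0]]] ee; rewrite jip_sumr; apply: sumr_ge0 => i _.
by rewrite jipZr mulr_ge0 // jip_idem2_ge0 //; case: op.
Qed.

Lemma pos_ip x y : pos x -> pos y -> 0 <= jip x y.
Proof.
move=> px /pos_spec[r [p [lam [op -> l0]]]]; rewrite jip_sumr; apply: sumr_ge0 => i _.
by rewrite jipZr mulr_ge0 // jipC pos_ip_idem //; case: op.
Qed.

Lemma posD x y : pos x -> pos y -> pos (x + y).
Proof.
by move=> px py; apply: pos_dual => e ee; rewrite jipDr addr_ge0 // pos_ip_idem.
Qed.

Lemma posZ c x : 0 <= c -> pos x -> pos (c *: x).
Proof.
by move=> c0 px; apply: pos_dual => e ee; rewrite jipZr mulr_ge0 // pos_ip_idem.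
Qed.

Lemma pos0 : pos 0. Proof. by exists 0 => //; rewrite jmul0. Qed.
Lemma pos1 : pos u. Proof. by apply: pos_idem; rewrite jmul1. Qed.

Lemma pos_anti x : pos x -> pos (- x) -> x = 0.
Proof.
move=> px pNx; apply: jip_eq0; apply/eqP; rewrite eq_le jip_ge0 andbT.
by have := pos_ip px pNx; rewrite jipNr oppr_ge0.
Qed.

Lemma pos_ip0 w e : pos w -> e ** e = e -> jip w e = 0 -> e ** w = 0.
Proof.
case/pos_spec=> r [p [lam [op -> l0]]] ee; case: (op) => pp _ _.
rewrite jip_suml => /eqP; rewrite psumr_eq0 => [/allP h|i _]; last first.
  by rewrite jipZl mulr_ge0 // jip_idem2_ge0.
rewrite jmul_sumr big1 // => i _; have := h i (mem_index_enum i).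
rewrite /= jipZl mulf_eq0 => /orP[/eqP ->|/eqP h0]; first by rewrite scale0r jmul0r.
by rewrite jmulZr jmulC (jip_idem2_eq0 (pp i) ee h0) scaler0.
Qed.

Lemma pos_ip_eq0 w v : pos w -> pos v -> jip w v = 0 -> v ** w = 0.
Proof.
move=> pw /pos_spec[r [p [lam [op -> l0]]]]; case: (op) => pp _ _.
rewrite jip_sumr => /eqP; rewrite psumr_eq0 => [/allP h|i _]; last first.
  by rewrite jipZr mulr_ge0 // jipC pos_ip_idem.
rewrite jmul_suml big1 // => i _; have := h i (mem_index_enum i).
rewrite /= jipZr mulf_eq0 jmulZl => /orP[/eqP ->|/eqP h0]; first by rewrite scale0r.
by rewrite (pos_ip0 pw (pp i) h0) scaler0.
Qed.

Lemma jU_fix p x : p ** x = x -> jU p x = x.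
Proof. by move=> px; rewrite /jU !px -{2}[x]scale1r -scalerBl (_ : 2 - 1 = 1) ?scale1r //; ring. Qed.

Lemma jU_mul p x : p ** p = p -> p ** jU p x = jU p x.
Proof.
move=> pp; rewrite /jU jmulBr jmulZr (peirce_cube _ pp); apply: coord_eqP => i.
by rewrite !coordE; field.
Qed.

(* The negative part n of w = U_p x lies in A_1(p), hence
   0 <= <x, n> = <x, U_p n> = <w, n> <= 0. *)
Lemma jU_pos p x : p ** p = p -> pos x -> pos (jU p x).
Proof.
move=> pp px; set w := jU p x; have pw : p ** w = w by apply: jU_mul.
pose f t : R := Num.max 0 (- t).
have f0 : f 0 = 0 by rewrite /f oppr0 maxxx.
have := fc_peirce1 pp pw f0; have [r [q [lam [oq wE]]]] := spectral w.
rewrite wE fcE // => pn; set n := \sum_i f (lam i) *: q i in pn.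
have fge t : 0 <= f t by rewrite /f le_max lexx.
have ft t : t * f t <= 0.
  rewrite /f; have [|] := leP 0 (- t); last by rewrite mulr0.
  by move=> t0; rewrite mulrN oppr_le0 -expr2 sqr_ge0.
have pn0 : pos n by apply: pos_sum.
have : jip w n = jip x n by rewrite /w jU_sym (jU_fix pn).
have := pos_ip px pn0 => h0 e; rewrite -e wE jip_osys // in h0.
case: (oq) => qq _ _; have le0 i : lam i * f (lam i) * jip (q i) (q i) <= 0.
  by rewrite mulr_le0_ge0 ?jip_idem_ge0.
have /eqP : \sum_i lam i * f (lam i) * jip (q i) (q i) = 0.
  by apply/eqP; rewrite eq_le h0 andbT sumr_le0.
rewrite -oppr_eq0 -sumrN psumr_eq0 => [/allP h|i _]; last by rewrite oppr_ge0.
have -> : \sum_i lam i *: q i = \sum_i (if q i == 0 then 0 else lam i) *: q i.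
  by apply: eq_bigr => i _; case: eqP => // ->; rewrite !scaler0.
apply: pos_sum => // i; case: eqP => // /eqP qi0.
have := h i (mem_index_enum i); rewrite /= oppr_eq0 mulf_eq0 (gt_eqF (jip_idem_gt0 _ _)) //.
rewrite orbF mulf_eq0 => /orP[/eqP ->//|].
rewrite /f; case: (leP 0 (- lam i)) => [_|]; first by rewrite oppr_eq0 => /eqP ->.
by rewrite oppr_lt0 => /ltW.
Qed.

End Spectral.

Local Notation pos := (squares mul).

Lemma fcM f g x : fc f x ** fc g x = fc (fun t => f t * g t) x.
Proof. by have [r [p [lam [op ->]]]] := spectral x; rewrite !fcE // osys_mulS. Qed.

Lemma fc_id x : fc id x = x.
Proof. by have [r [p [lam [op ->]]]] := spectral x; rewrite !fcE. Qed.

Lemma fc_comp f g x : fc f (fc g x) = fc (f \o g) x.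
Proof. by have [r [p [lam [op ->]]]] := spectral x; rewrite !fcE. Qed.

Lemma fc_pos f x : (forall t, 0 <= f t) -> pos (fc f x).
Proof.
by move=> f0; have [r [p [lam [op ->]]]] := spectral x; rewrite !fcE //; apply: pos_sum.
Qed.

(** * Jordan frames, spectrum and extreme eigenvalues *)

Lemma osys_le_dim r (p : 'I_r -> A) : osys p -> (forall i, p i != 0) ->
  (r <= \dim (fullv : {vspace A}))%N.
Proof.
move=> op p0; pose M := \matrix_(i < r, j < \dim (fullv : {vspace A})) coord (vbasis fullv) j (p i).
suff /eqP rM : row_free M by rewrite -rM rank_leq_col.
apply/row_freeP; apply/row_freeP; rewrite -kermx_eq0; apply/rowV0P => v /sub_kermxP vM.
have s0 : \sum_i v 0 i *: p i = 0.
  apply: coord_eqP => j; rewrite linear0 linear_sum; move/rowP: vM => /(_ j).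
  rewrite !mxE => e; rewrite -[RHS]e.
  by apply: eq_bigr => i _; rewrite linearZ !mxE.
apply/rowP => i; rewrite !mxE; have := osys_mul (v 0) i op.
by rewrite s0 jmul0r => /esym/eqP; rewrite scaler_eq0 (negPf (p0 i)) orbF => /eqP.
Qed.

Lemma spectral_neq0 x : exists r (p : 'I_r -> A) (lam : 'I_r -> R),
  [/\ osys p, forall i, p i != 0 & x = \sum_i lam i *: p i].
Proof.
have [r [p [lam [[pp po ps] xE]]]] := spectral x.
pose S := [pred i | p i != 0].
have sumS (F : 'I_r -> A) : (forall i, p i = 0 -> F i = 0) ->
    \sum_i F i = \sum_(i < #|S|) F (enum_val i).
  move=> F0; rewrite -(big_enum_val F) [LHS](bigID S) /= [X in _ + X]big1 ?addr0 // => i.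
  by rewrite negbK => /eqP /F0.
exists #|S|, (fun i => p (enum_val i)), (fun i => lam (enum_val i)); split.
- split=> [i|i j ij|] //; last by rewrite -ps sumS.
  by apply: po; rewrite (inj_eq enum_val_inj).
- by move=> i; have := enum_valP i.
- by rewrite xE sumS // => i ->; rewrite scaler0.
Qed.

(** The refinement step towards primitive members: [q1] takes the new slot 0 and [q2] the slot of
    [p k]. Both lie in A_1(p k), so the Peirce rules make them orthogonal to the other members. *)
Lemma osys_split r (p : 'I_r -> A) k q1 q2 : osys p ->
  q1 ** q1 = q1 -> q2 ** q2 = q2 -> q1 ** q2 = 0 -> p k = q1 + q2 ->
  osys (fun i : 'I_r.+1 => if unlift ord0 i is Some j then if j == k then q2 else p j else q1).
Proof.
case=> pp po ps qq1 qq2 q12 pk; have q21 : q2 ** q1 = 0 by rewrite jmulC.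
have p1 : p k ** q1 = q1 by rewrite pk jmulDl qq1 q21 addr0.
have p2 : p k ** q2 = q2 by rewrite pk jmulDl qq2 q12 add0r.
have po1 j : j != k -> p j ** q1 = 0.
  by move=> jk; rewrite jmulC; apply: (peirce10 (pp k) p1); rewrite po // eq_sym.
have po2 j : j != k -> p j ** q2 = 0.
  by move=> jk; rewrite jmulC; apply: (peirce10 (pp k) p2); rewrite po // eq_sym.
split.
- by move=> i; case: unliftP => [j _|_] //; case: eqP.
- move=> i i'; case: unliftP => [j ->|->]; case: unliftP => [j' ->|->]; last by rewrite eqxx.
  + rewrite (inj_eq lift_inj) => jj'.
    have [jk|jk] := eqVneq j k; have [jk'|jk'] := eqVneq j' k.
    * by rewrite jk jk' eqxx in jj'.
    * by rewrite jmulC po2.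
    * by rewrite po2.
    * exact: po.
  + by move=> _; case: eqP => [//|/eqP jk]; rewrite po1.
  + by move=> _; rewrite jmulC; case: eqP => [//|/eqP jk]; rewrite po1.
- rewrite big_ord_recl unlift_none -ps (bigD1 k) //= liftK eqxx addrA -pk.
  rewrite [RHS](bigD1 k) //=; congr (_ + _); apply: eq_bigr => i ik.
  by rewrite liftK (negPf ik).
Qed.

(** A decomposition with the largest number of nonzero members, which the dimension bounds, is a
    Jordan frame: splitting a member and repeating its eigenvalue would give a longer one. *)
Lemma spec_decomp_exists x : exists r (p : 'I_r -> A) (lam : 'I_r -> R),
  spec_decomp mul u x p lam.
Proof.
pose P r := `[< exists (p : 'I_r -> A) (lam : 'I_r -> R),
  [/\ osys p, forall i, p i != 0 & x = \sum_i lam i *: p i] >].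
have exP : exists r, P r by have [r h] := spectral_neq0 x; exists r; apply/asboolP.
have bP r : P r -> (r <= \dim (fullv : {vspace A}))%N.
  by move/asboolP => [p [lam [op p0 _]]]; apply: osys_le_dim op p0.
case: (ex_maxnP exP bP) => r /asboolP[p [lam [op p0 xE]]] rmax.
exists r, p, lam; split=> //; case: (op) => pp po ps; split=> // k; split=> //.
case=> q1 [q2 [qq1 qq2 [q10 q20] q12 pk]].
suff /rmax : P r.+1 by rewrite ltnn.
apply/asboolP.
exists (fun i => if unlift ord0 i is Some j then if j == k then q2 else p j else q1).
exists (fun i => if unlift ord0 i is Some j then lam j else lam k); split.
- exact: osys_split.
- by move=> i; case: unliftP => [j _|_] //; case: (j == k).
- rewrite xE big_ord_recl unlift_none [RHS]addrC (bigD1 k) //= [in RHS](bigD1 k) //= liftK eqxx.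
  rewrite addrAC -scalerDr (addrC q2) -pk; congr (_ + _); apply: eq_bigr => i ik.
  by rewrite liftK (negPf ik).
Qed.

Lemma spec_decomp_osys x r (p : 'I_r -> A) lam : spec_decomp mul u x p lam ->
  [/\ osys p, forall i, p i != 0 & x = \sum_i lam i *: p i].
Proof.
case=> -[pp po ps] xE; split=> //; last by move=> i; case: (pp i).
by split=> // i; case: (pp i).
Qed.

(** Applying the indicator function of one eigenvalue to two decompositions of x shows that it
    occurs in both; otherwise a nonzero idempotent would be 0. *)
Lemma osys_spectrum x r (p : 'I_r -> A) lam : osys p -> (forall i, p i != 0) ->
  x = \sum_i lam i *: p i -> spectrum mul u x = range lam.
Proof.
move=> op p0 xE.
have key s (q : 'I_s -> A) mu t (p' : 'I_t -> A) lam' : osys q -> osys p' ->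
    (forall i, p' i != 0) -> \sum_i lam' i *: p' i = \sum_i mu i *: q i ->
    forall i, exists j, mu j = lam' i.
  move=> oq op' p0' e i; apply: contrapT => no.
  have := congr1 (fc (fun t => (t == lam' i)%:R)) e; rewrite !fcE // => /(congr1 (mul (p' i))).
  rewrite osys_mul // eqxx scale1r big1 => [|j _]; last first.
    by case: eqP => [ej|_]; rewrite ?scale0r //; case: no; exists j.
  by rewrite jmul0r => /eqP; rewrite (negPf (p0' i)).
apply/seteqP; split => l.
  case=> s [q [mu [/spec_decomp_osys[oq q0 xE'] [i <-]]]].
  by have [j <-] := key _ _ _ _ _ _ op oq q0 (etrans (esym xE') xE) i; exists j.
case=> i _ <-; have [s [q [mu d]]] := spec_decomp_exists x.
have [oq q0 xE'] := spec_decomp_osys d.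
have [j e] := key _ _ _ _ _ _ oq op p0 (etrans (esym xE) xE') i.
by exists s, q, mu; split=> //; exists j.
Qed.

Lemma jexpE x : jexp mul u x = fc expR x.
Proof.
rewrite /jexp; case: xgetP => [y _ [r [p [lam [d ->]]]]|no].
  by have [op p0 ->] := spec_decomp_osys d; rewrite fcE.
exfalso; have [r [p [lam d]]] := spec_decomp_exists x.
by apply: (no (\sum_i expR (lam i) *: p i)); exists r, p, lam.
Qed.

Lemma pos_osys r (p : 'I_r -> A) lam : osys p ->
  pos (\sum_i lam i *: p i) <-> (forall i, p i != 0 -> 0 <= lam i).
Proof.
move=> op; case: (op) => pp _ _; split=> [ps i pi0|l0].
  have := pos_ip_idem ps (pp i).
  by rewrite -{1}(pp i) jip_assoc osys_mul // jipZr pmulr_lge0 // jip_idem_gt0.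
have -> : \sum_i lam i *: p i = \sum_i (if p i == 0 then 0 else lam i) *: p i.
  by apply: eq_bigr => i _; case: eqP => // ->; rewrite !scaler0.
by apply: pos_sum => // i; case: eqP => // /eqP /l0.
Qed.

Lemma osysB r (p : 'I_r -> A) lam s : osys p ->
  s *: u - \sum_i lam i *: p i = \sum_i (s - lam i) *: p i.
Proof.
case=> _ _ <-; rewrite scaler_sumr -sumrB; apply: eq_bigr => i _.
by rewrite scalerBl.
Qed.

Definition jmax x : R := sup (spectrum mul u x).

Lemma spectrum_sup x : u != 0 -> has_sup (spectrum mul u x).
Proof.
move=> u0; have [r [p [lam [op p0 xE]]]] := spectral_neq0 x.
rewrite (osys_spectrum op p0 xE).
have [i _] : exists i : 'I_r, true.
  case: r p lam op p0 xE => [|r] p lam op p0 xE; last by exists ord0.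
  by case: op => _ _; rewrite big_ord0 => e; rewrite -e eqxx in u0.
split; first by exists (lam i), i.
exists (\sum_i `|lam i|) => _ [j _ <-]; rewrite (bigD1 j) //=.
by rewrite (le_trans (ler_norm _)) // lerDl sumr_ge0.
Qed.

(** Turns bounds on the largest eigenvalue into membership in the cone, where sums, scalings and
    limits are available. *)
Lemma jmax_le x s : u != 0 -> (jmax x <= s) <-> pos (s *: u - x).
Proof.
move=> u0; have sx := spectrum_sup x u0.
have [r [p [lam [op p0 xE]]]] := spectral_neq0 x.
move: sx; rewrite /jmax (osys_spectrum op p0 xE) xE osysB // pos_osys // => sx.
split=> [h i _|h].
  by rewrite subr_ge0 (le_trans _ h) //; apply: ub_le_sup; [case: sx|exists i].
by apply: ge_sup => [|_ [i _ <-]]; [case: sx|rewrite -subr_ge0 h].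
Qed.

Lemma spectrumN x : spectrum mul u (- x) = -%R @` spectrum mul u x.
Proof.
have [r [p [lam [op p0 xE]]]] := spectral_neq0 x.
rewrite (osys_spectrum op p0 xE) (@osys_spectrum (- x) _ p (fun i => - lam i)) //.
  by rewrite image_comp.
by rewrite xE -sumrN; apply: eq_bigr => i _; rewrite scaleNr.
Qed.

Lemma var_normE x : var_norm mul u x = jmax x + jmax (- x).
Proof. by rewrite /var_norm /inf opprK /jmax spectrumN. Qed.

Lemma spec_norm_le x s : u != 0 ->
  spec_norm mul u x <= s <-> jmax x <= s /\ jmax (- x) <= s.
Proof.
move=> u0; have [[sx bx] [sx' bx']] := (spectrum_sup x u0, spectrum_sup (- x) u0).
have nx : [set `|l| | l in spectrum mul u x] !=set0 by case: sx => l xl; exists `|l|, l.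
split=> [h|[h1 h2]].
  have key l : spectrum mul u x l -> `|l| <= s.
    move=> xl; rewrite (le_trans _ h) // ub_le_sup //; last by exists l.
    case: bx bx' => b hb [b' hb']; exists (Num.max b b') => _ [k xk <-].
    rewrite ler_norml le_max lerNl; apply/andP; split; last by rewrite hb.
    by rewrite le_max orbC hb' // spectrumN; exists k.
  split; apply: ge_sup => //; first by move=> l /key; apply: le_trans; apply: ler_norm.
  rewrite spectrumN => _ [l /key xl <-]; apply: le_trans xl.
  by rewrite -normrN ler_norm.
apply: ge_sup => // _ [l xl <-]; rewrite ler_norml lerNl; apply/andP; split.
  by rewrite (le_trans _ h2) // ub_le_sup // spectrumN; exists l.
by rewrite (le_trans _ h1) // ub_le_sup.
Qed.

Lemma spec_normE x : u != 0 -> spec_norm mul u x = Num.max (jmax x) (jmax (- x)).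
Proof.
move=> u0; apply/eqP; rewrite eq_le; apply/andP; split.
  by apply/(spec_norm_le _ _ u0); rewrite !le_max !lexx orbT.
by rewrite ge_max; apply/andP; apply/(spec_norm_le _ _ u0).
Qed.

(** * Trace and determinant are independent of the frame *)

Lemma primitive_jU p x : jprimitive mul p -> exists c, jU p x = c *: p.
Proof.
case=> pp p0 prim; set w := jU p x; have pw : p ** w = w by apply: jU_mul.
have [r [q [lam [oq wE]]]] := spectral w.
have [w0|/eqP w0] := pselect (w = 0); first by exists 0; rewrite w0 scale0r.
have [i li] : exists i, lam i *: q i != 0.
  apply: contrapT => no; case/eqP: w0; rewrite wE big1 // => i _.
  by apply/eqP/negP => h; apply: no; exists i; apply/negP.
move: li; rewrite scaler_eq0 negb_or => /andP[li qi].
(* The spectral idempotent of a nonzero eigenvalue of w lies in A_1(p), so e and p - e would split p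
   unless e = p. Hence A_1(p) is spanned by p. *)
pose f t : R := (t == lam i)%:R; set e := fc f w.
have pe : p ** e = e by apply: fc_peirce1 => //; rewrite /f eq_sym (negPf li).
have ee : e ** e = e.
  rewrite /e fcM; congr (fc _ w); apply/funext => t; rewrite /f.
  by case: eqP; rewrite ?mulr1 ?mulr0.
have e0 : e != 0.
  apply: contra qi => /eqP e0; have := congr1 (mul (q i)) e0.
  by rewrite /e wE fcE // osys_mul // /f eqxx scale1r jmul0r => ->.
have pE : p = e.
  apply/eqP; rewrite -subr_eq0; apply/negPn/negP => pe0; apply: prim.
  exists e, (p - e); split; rewrite /jidem /jorth //.
  - by rewrite jmulBl !jmulBr ee pp (jmulC e) pe subrr subr0.
  - by rewrite jmulBr ee (jmulC e) pe subrr.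
  - by rewrite addrC subrK.
have := fcM f id w; rewrite fc_id -/e -pE pw => h.
exists (lam i); rewrite -/w h pE /e wE !fcE // scaler_sumr; apply: eq_bigr => j _; rewrite /f scalerA.
by case: eqP => [->|]; rewrite ?mul1r ?mulr1 ?mul0r ?mulr0.
Qed.

(* <U_p q, q> = 2 <pq, pq> - <p, q> is symmetric in p and q. *)
Lemma primitive_jip p q : jprimitive mul p -> jprimitive mul q -> jip p q != 0 ->
  jip p p = jip q q.
Proof.
move=> hp hq pq0; have [c cE] := primitive_jU q hp; have [c' cE'] := primitive_jU p hq.
case: hp hq => pp p0 _ [qq q0 _].
have h1 : c * jip p p = jip p q by rewrite -jipZl -cE jU_sym jU_fix // jipC.
have h2 : c' * jip q q = jip p q by rewrite -jipZl -cE' jU_sym jU_fix.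
have h3 : c * jip p q = c' * jip p q.
  have -> : c * jip p q = jip (jU p q) q by rewrite cE jipZl.
  have -> : c' * jip p q = jip (jU q p) p by rewrite cE' jipZl jipC.
  have e1 : jip (q ** p) p = jip p q by rewrite jmulC jip_mul pp jipC.
  rewrite /jU !(jipBl, jipZl) (jip_mul p (p ** q)) (jip_mul q (q ** p)) e1.
  by rewrite (jmulC p q) (jip_mul q p q) qq.
have cc : c = c' by apply: (mulIf pq0).
have c0 : c != 0 by apply: contraNneq pq0 => e; rewrite -h1 e mul0r.
by apply: (mulfI c0); rewrite h1 cc h2.
Qed.

(** The weights <p_i, q_j> / <p_i, p_i> have row sums 1. A nonzero weight forces lam i = mu j,
    because x is self-adjoint for the form, and equal norms by [primitive_jip], so the column sums
    are 1 as well. *)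
Lemma spec_decomp_sum x r (p : 'I_r -> A) lam s (q : 'I_s -> A) mu (F : R -> R) :
  spec_decomp mul u x p lam -> spec_decomp mul u x q mu ->
  \sum_i F (lam i) = \sum_j F (mu j).
Proof.
move=> dp dq; have [op p0 xp] := spec_decomp_osys dp; have [oq q0 xq] := spec_decomp_osys dq.
have row v : v ** v = v -> v != 0 -> jip u v / jip v v = 1.
  by move=> vv v0; rewrite -{1}vv -jip_assoc jmul1 divff // gt_eqF // jip_idem_gt0.
case: (op) (oq) dp dq => pp _ sp [qq _ sq] [[prp _ _] _] [[prq _ _] _].
transitivity (\sum_i \sum_j F (lam i) * (jip (q j) (p i) / jip (p i) (p i))).
  apply: eq_bigr => i _; rewrite -mulr_sumr -mulr_suml -jip_suml sq.
  by rewrite row ?mulr1.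
rewrite exchange_big; apply: eq_bigr => j _.
transitivity (\sum_i F (mu j) * (jip (p i) (q j) / jip (q j) (q j))); last first.
  by rewrite -mulr_sumr -mulr_suml -jip_suml sp row ?mulr1.
apply: eq_bigr => i _; rewrite (jipC (q j)).
have [->|n0] := eqVneq (jip (p i) (q j)) 0; first by rewrite !mul0r !mulr0.
rewrite (primitive_jip (prp i) (prq j) n0); congr (F _ * _).
apply: (mulIf n0); rewrite -jipZl -(osys_mul lam i op) -xp jip_assoc xq.
by rewrite jmulC osys_mul // jipZr.
Qed.

Lemma jtrE x r (p : 'I_r -> A) lam : spec_decomp mul u x p lam ->
  jtr mul u x = \sum_i lam i.
Proof.
move=> d; rewrite /jtr; case: xgetP => [y _ [s [q [mu [d' ->]]]]|no].
  exact: (spec_decomp_sum id d' d).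
by exfalso; apply: (no (\sum_i lam i)); exists r, p, lam.
Qed.

Lemma spec_decomp_fc f x r (p : 'I_r -> A) lam : spec_decomp mul u x p lam ->
  spec_decomp mul u (fc f x) p (f \o lam).
Proof.
by move=> d; have [op p0 xE] := spec_decomp_osys d; case: d => fr _; split; rewrite // xE fcE.
Qed.

Lemma jtr_shift x s : jtr mul u (x + s *: u) = jtr mul u x + s * jtr mul u u.
Proof.
have [r [p [lam d]]] := spec_decomp_exists x.
have [op p0 xE] := spec_decomp_osys d; case: (d) => fr _.
have uE : u = \sum_i 1 *: p i by case: op => _ _ <-; apply: eq_bigr => i _; rewrite scale1r.
rewrite (jtrE d) (@jtrE (x + s *: u) _ p (fun i => lam i + s)).
  rewrite (@jtrE u _ p (fun=> 1)) // big_split /= mulr_sumr; congr (_ + _).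
  by apply: eq_bigr => i _; rewrite mulr1.
have -> : s *: u = \sum_i s *: p i by rewrite -scaler_sumr; case: op => _ _ ->.
by split=> //; rewrite xE -big_split; apply: eq_bigr => i _ /=; rewrite scalerDl.
Qed.

Lemma jtr1_neq0 : u != 0 -> jtr mul u u != 0.
Proof.
move=> u0; have [r [p [lam d]]] := spec_decomp_exists 0.
have [op p0 xE] := spec_decomp_osys d; case: (d) => fr _.
rewrite (@jtrE u _ p (fun=> 1)); last first.
  by split=> //; case: op => _ _ <-; apply: eq_bigr => i _; rewrite scale1r.
case: (r) p {lam d p0 xE} op fr => [|r'] p op fr; last first.
  by rewrite sumr_const pnatr_eq0 card_ord.
by case: op => _ _; rewrite big_ord0 => e; rewrite -e eqxx in u0.
Qed.

(** Taking [ln] of the eigenvalues turns any decomposition of e^w into one of w, so the product is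
    independent of the frame because the sum [jtr] is. *)
Lemma jdet_exp w : jdet mul u (fc expR w) = expR (jtr mul u w).
Proof.
have key r (p : 'I_r -> A) mu : spec_decomp mul u (fc expR w) p mu ->
    \prod_i mu i = expR (jtr mul u w).
  move=> d; have [op p0 xE] := spec_decomp_osys d.
  have mu0 i : 0 < mu i.
    have [s [q [lam [oq q0 wE]]]] := spectral_neq0 w.
    have : spectrum mul u (fc expR w) (mu i) by exists r, p, mu; split=> //; exists i.
    rewrite (@osys_spectrum _ _ q (expR \o lam)) //; last by rewrite wE fcE.
    by case=> j _ <-; apply: expR_gt0.
  have := spec_decomp_fc (@ln R) d; rewrite fc_comp.
  have -> : fc (@ln R \o expR) w = w.
    by rewrite -[RHS]fc_id; congr (fc _ w); apply/funext => t; apply: expRK.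
  move/jtrE => ->; rewrite expR_sum; apply: eq_bigr => i _.
  by rewrite /= lnK ?posrE //.
rewrite /jdet; case: xgetP => [y _ [r [p [lam [d ->]]]]|no]; first exact: key d.
have [r [p [lam d]]] := spec_decomp_exists (fc expR w).
by exfalso; apply: (no (\prod_i lam i)); exists r, p, lam.
Qed.

Lemma cone_intP x : u != 0 ->
  cone_int mul u x <-> exists2 e, 0 < e & pos (x - e *: u).
Proof.
move=> u0; split=> [[e e0 h]|[e e0 h]].
  exists (e / 2); first by rewrite divr_gt0.
  apply: h; rewrite addrC addrA addNr add0r.
  apply: (@le_lt_trans _ _ (e / 2)); last by rewrite gtr_pMr // invf_lt1 // ltr1n.
  apply/(spec_norm_le _ _ u0); split; apply/(jmax_le _ _ u0).
    by rewrite opprK -scalerDl; apply: posZ pos1; lra.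
  by rewrite opprK subrr; apply: pos0.
exists e => // y /ltW /(spec_norm_le _ _ u0)[_ /(jmax_le _ _ u0)].
rewrite opprK => hy; have := posD hy h; congr (pos _).
by vring.
Qed.

(** As [ln] is 0 on nonpositive numbers, the equation fails at any eigenvalue that is not positive.
    It encodes positivity of the whole spectrum in a form usable for rewriting. *)
Lemma cone_int_exp x : u != 0 -> cone_int mul u x <-> x = fc expR (fc (@ln R) x).
Proof.
move=> u0; have [r [p [lam [op p0 xE]]]] := spectral_neq0 x.
have uE s : s *: u = \sum_i s *: p i by rewrite -scaler_sumr; case: op => _ _ ->.
rewrite cone_intP // fc_comp; split=> [[e e0]|xE'].
  rewrite xE uE -sumrB fcE // => h; apply: eq_bigr => i _ /=; rewrite lnK //.
  have : pos (\sum_i (lam i - e) *: p i).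
    by move: h; congr pos; apply: eq_bigr => j _; rewrite scalerBl.
  rewrite pos_osys // => /(_ i (p0 i)); rewrite subr_ge0 posrE; exact: lt_le_trans.
have l0 i : 0 < lam i.
  have : spectrum mul u x (lam i) by rewrite (osys_spectrum op p0 xE); exists i.
  rewrite (@osys_spectrum x _ p (fun i => expR (ln (lam i)))) //; last by rewrite xE' xE fcE.
  by case=> j _ <-; apply: expR_gt0.
exists (\big[Num.min/1]_i lam i).
  by elim/big_ind: _ => // a b a0 b0; rewrite lt_min a0.
have -> : x - (\big[Num.min/1]_i lam i) *: u =
    \sum_i (lam i - (\big[Num.min/1]_i lam i)) *: p i.
  by rewrite xE uE -sumrB; apply: eq_bigr => i _; rewrite scalerBl.
rewrite pos_osys // => i _; rewrite subr_ge0; exact: bigmin_le_cond.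
Qed.

Lemma cone_int_fc_exp y : u != 0 -> cone_int mul u (fc expR y).
Proof.
move=> u0; apply/(cone_int_exp _ u0); rewrite !fc_comp; congr (fc _ y).
by apply/funext => t /=; rewrite expRK.
Qed.

(** * Limits of the distance functions *)

Local Notation N := (\dim (fullv : {vspace A})).

(** The Gram matrix of the basis is invertible since the trace form is definite. Limits in the
    algebra thus reduce to finitely many scalar limits. *)
Lemma dual_basis : exists f : 'I_N -> A, forall x,
  x = \sum_i jip (f i) x *: (vbasis (fullv : {vspace A}))`_i.
Proof.
set B := vbasis _; pose G : 'M[R]_N := \matrix_(i, j) jip B`_i B`_j.
have GU : G \in unitmx.
  rewrite -row_free_unit -kermx_eq0; apply/rowV0P => v /sub_kermxP vG.
  pose w := \sum_i v 0 i *: B`_i.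
  have w0 (j : 'I_N) : jip w B`_j = 0.
    rewrite jip_suml; move/rowP: vG => /(_ j); rewrite !mxE => e; rewrite -[RHS]e.
    by apply: eq_bigr => i _; rewrite jipZl mxE.
  have : w = 0.
    by apply: jip_eq0; rewrite {2}/w jip_sumr big1 // => i _; rewrite jipZr w0 mulr0.
  move=> w00; apply/rowP => i; rewrite !mxE.
  have := congr1 (coord B i) w00; rewrite linear0 linear_sum /= (bigD1 i) //= linearZ /=.
  rewrite coord_free ?(basis_free (vbasisP _)) // eqxx mulr1 big1 ?addr0 // => j ji.
  by rewrite linearZ /= coord_free ?(basis_free (vbasisP _)) // (negPf ji) mulr0.
exists (fun i => \sum_j (invmx G) i j *: B`_j) => x; rewrite [LHS]basis_sum.
apply: eq_bigr => i _; congr (_ *: _); rewrite {2}(basis_sum x) jip_sumr.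
rewrite (bigD1 i) //= jipZr jip_suml.
have e (k : 'I_N) : \sum_j jip (invmx G i j *: B`_j) B`_k = (i == k)%:R.
  have := congr1 (fun M : 'M[R]_N => M i k) (mulVmx GU); rewrite !mxE => <-.
  by apply: eq_bigr => j _; rewrite jipZl !mxE.
rewrite e eqxx mulr1 big1 ?addr0 // => k ki.
by rewrite jipZr jip_suml e eq_sym (negPf ki) mulr0.
Qed.

Lemma jip_bound x y : `|jip x y| <= jip x x + jip y y.
Proof.
have h1 := jip_ge0 (x + y); have h2 := jip_ge0 (x - y).
have h3 := jip_ge0 x; have h4 := jip_ge0 y.
rewrite !(jipDl, jipDr, jipNl, jipNr) (jipC y x) in h1 h2.
by rewrite ler_norml; lra.
Qed.

(** * Convergence in the algebra along filters *)

Section Filter.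
Context {T : Type} (F : set_system T) {FF : ProperFilter F}.

(** Weak convergence against the trace form, which in finite dimension is ordinary convergence. *)
Definition Acvg (g : T -> A) (l : A) := forall x, (fun y => jip x (g y)) @ F --> jip x l.

Lemma Acvg_cst l : Acvg (fun=> l) l.
Proof. by move=> x; apply: cvg_cst. Qed.

Lemma AcvgD f g k l : Acvg f k -> Acvg g l -> Acvg (fun y => f y + g y) (k + l).
Proof.
move=> fk gl x; under eq_fun do rewrite jipDr; rewrite jipDr.
exact: cvgD (fk x) (gl x).
Qed.

Lemma AcvgZ (c : T -> R) f (k : R) l : c @ F --> k -> Acvg f l -> Acvg (fun y => c y *: f y) (k *: l).
Proof.
move=> ck fl x; under eq_fun do rewrite jipZr; rewrite jipZr.
exact: cvgM ck (fl x).
Qed.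

Lemma AcvgN f l : Acvg f l -> Acvg (fun y => - f y) (- l).
Proof.
move=> fl; rewrite -scaleN1r (_ : (fun y => _) = fun y => (-1) *: f y).
  by apply: AcvgZ fl; apply: cvg_cst.
by apply/funext => y; rewrite scaleN1r.
Qed.

Lemma AcvgB f g k l : Acvg f k -> Acvg g l -> Acvg (fun y => f y - g y) (k - l).
Proof. by move=> fk /AcvgN gl; apply: AcvgD. Qed.

Lemma Acvg_sum n (f : 'I_n -> T -> A) (l : 'I_n -> A) (P : pred 'I_n) :
  (forall i, P i -> Acvg (f i) (l i)) ->
  Acvg (fun y => \sum_(i | P i) f i y) (\sum_(i | P i) l i).
Proof.
move=> h x; under eq_fun do rewrite jip_sumr; rewrite jip_sumr.
by apply: cvg_sumr => i Pi; apply: h.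
Qed.

Lemma Acvg_mul f g k l : Acvg f k -> Acvg g l -> Acvg (fun y => f y ** g y) (k ** l).
Proof.
move=> fk gl x; have [b hb] := dual_basis.
have e v w : jip x (v ** w) = \sum_i jip (b i) w * jip (x ** (vbasis fullv)`_i) v.
  rewrite {1}(hb w) jmul_sumr jip_sumr; apply: eq_bigr => i _.
  by rewrite jmulZr jipZr (jmulC v) jip_assoc.
under eq_fun do rewrite e; rewrite e; apply: cvg_sumr => i _.
exact: cvgM (gl _) (fk _).
Qed.

Lemma Acvg_ip f g k l : Acvg f k -> Acvg g l -> (fun y => jip (f y) (g y)) @ F --> jip k l.
Proof.
move=> fk gl; have e v w : jip v w = jip u (v ** w) by rewrite -jip_assoc jmul1.
by under eq_fun do rewrite e; rewrite e; apply: (Acvg_mul fk gl).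
Qed.

Lemma Acvg_unique f k l : Acvg f k -> Acvg f l -> k = l.
Proof.
move=> fk fl; apply/eqP; rewrite -subr_eq0; apply/eqP/jip_eq0.
rewrite jipBr; apply/eqP; rewrite subr_eq0; apply/eqP.
exact: (cvg_unique _ (fk (k - l)) (fl (k - l))).
Qed.

Lemma Acvg_pos f l : Acvg f l -> (\forall y \near F, pos (f y)) -> pos l.
Proof.
move=> fl fp; apply: pos_dual => e ee.
have e0 : \forall y \near F, 0 <= jip e (f y).
  by apply: filterS fp => y fy; apply: pos_ip_idem.
exact: cvg_ler (cvg_cst 0) (fl e) e0.
Qed.

Lemma Acvg_eq f g l : f =1 g -> Acvg f l -> Acvg g l.
Proof. by move=> /funext ->. Qed.

End Filter.

Section Ultra.
Context {T : Type} (F : set_system T) {FU : UltraFilter F}.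

Lemma ultra_bounded (f : T -> R) (a b : R) :
  (\forall y \near F, a <= f y <= b) -> exists2 l, a <= l <= b & f @ F --> l.
Proof.
move=> h; have := @segment_compact R a b; rewrite compact_ultra => /(_ (f @ F)).
have ultra : UltraFilter (f @ F).
  split=> [|G PG sG]; first exact: fmap_proper_filter.
  apply/seteqP; split=> // U GU.
  have [//|nU] := in_ultra_setVsetC (f @^-1` U) FU.
  have : G (~` U) by apply: sG.
  by move=> /(filterI GU); rewrite setICr => /(@filter_not_empty _ _ PG).
case/(_ ultra); first by apply: filterS h => y; rewrite /= in_itv.
by move=> l []; rewrite /= in_itv /= => al fl; exists l.
Qed.

Lemma Acvg_bounded (g : T -> A) C : (forall y, jip (g y) (g y) <= C) ->
  exists l, Acvg F g l.
Proof.
move=> gC; have [b hb] := dual_basis.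
have /choice[l hl] : forall i : 'I_N, exists l : R, (fun y => jip (b i) (g y)) @ F --> l.
  move=> i; have [|l _ hl] := @ultra_bounded (fun y => jip (b i) (g y))
     (- (jip (b i) (b i) + C)) (jip (b i) (b i) + C); last by exists l.
  apply: nearW => y; rewrite -ler_norml (le_trans (jip_bound _ _)) //.
  by rewrite lerD2l.
exists (\sum_i l i *: (vbasis fullv)`_i) => x.
under eq_fun do rewrite [g _]hb jip_sumr; rewrite jip_sumr.
apply: cvg_sumr => i _; under eq_fun do rewrite jipZr; rewrite jipZr.
by apply: cvgM (hl i) _; apply: cvg_cst.
Qed.

(** This uniform bound is what makes systems of idempotents converge along an ultrafilter. *)
Lemma idem_bound e : e ** e = e -> jip e e <= jip u u.
Proof.
move=> ee; have := jip_idem2_ge0 ee (idemC ee); have := jip_ge0 (u - e).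
by rewrite !(jipBl, jipBr) (jipC u e); lra.
Qed.

End Ultra.

(** A common index type lets the decompositions of varying elements be followed along a filter. The
    padded zero idempotents receive the eigenvalue [lam ord0], so spectral bounds hold for every
    coefficient. *)
Lemma padded_spec x : u != 0 -> exists (p : 'I_N -> A) (lam : 'I_N -> R),
  [/\ osys p, x = \sum_i lam i *: p i & forall i, spectrum mul u x (lam i)].
Proof.
move=> u0; have [r [p [lam [op p0 xE]]]] := spectral_neq0 x.
have rN := osys_le_dim op p0; rewrite (osys_spectrum op p0 xE).
case: r p lam op p0 xE rN => [|r] p lam op p0 xE rN.
  by case: op => _ _; rewrite big_ord0 => e; rewrite -e eqxx in u0.
pose q (i : 'I_N) := if (i < r.+1)%N then p (inord i) else 0.
pose mu (i : 'I_N) := if (i < r.+1)%N then lam (inord i) else lam ord0.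
have sumE (f : 'I_r.+1 -> A) : \sum_(i < N) (if (i < r.+1)%N then f (inord i) else 0) = \sum_i f i.
  rewrite -big_mkcond /= (big_ord_narrow rN).
  by apply: eq_bigr => i _; rewrite inord_val.
case: op => pp po ps; exists q, mu; split.
- split; rewrite /q.
  + by move=> i; case: ifP; rewrite ?jmul0.
  + move=> i j ij; case: ifP => // ir; last by rewrite jmul0.
    case: ifP => // jr; last by rewrite jmul0r.
    by apply: po; apply: contraNneq ij => /(congr1 val) /=; rewrite !inordK // => /val_inj ->.
  + by rewrite sumE.
- rewrite xE -(sumE (fun i => lam i *: p i)); apply: eq_bigr => i _; rewrite /q /mu.
  by case: ifP => //; rewrite scaler0.
- by move=> i; rewrite /mu; case: ifP => _; [exists (inord i)|exists ord0].
Qed.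

Definition supp (x : A) : A := fc (fun t : R => (t != 0)%:R) x.

(** The unnormalized states of the face belonging to P: for an idempotent P, orthogonality to u - P
    forces P w = w, see [face_mul]. *)
Definition face (P w : A) := [/\ pos w, w != 0 & jip w (u - P) = 0].

Lemma supp_osys r (p : 'I_r -> A) lam : osys p ->
  supp (\sum_i lam i *: p i) = \sum_(i | lam i != 0) p i.
Proof.
move=> op; rewrite /supp fcE // [RHS]big_mkcond; apply: eq_bigr => i _.
by case: ifP; rewrite ?scale1r ?scale0r.
Qed.

Lemma supp_idem x : supp x ** supp x = supp x.
Proof. by rewrite /supp fcM; congr (fc _ x); apply/funext => t; case: eqP; rewrite ?mulr0 ?mulr1. Qed.

Lemma face_mul P w : P ** P = P -> face P w -> P ** w = w.
Proof.
move=> PP [pw _ h]; have := pos_ip0 pw (idemC PP) h.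
by rewrite jmulBl jmul1 => /eqP; rewrite subr_eq0 => /eqP <-.
Qed.

Lemma face_osys r (p : 'I_r -> A) lam w : osys p ->
  face (supp (\sum_i lam i *: p i)) w <->
  [/\ pos w, w != 0 & forall i, lam i = 0 -> jip w (p i) = 0].
Proof.
move=> op; have [pp _ sp] := op; rewrite /face supp_osys //.
have -> : u - \sum_(i | lam i != 0) p i = \sum_(i | lam i == 0) p i.
  by rewrite -sp (bigID (fun i => lam i == 0)) /= addrK.
split=> -[pw w0 h]; split=> //.
  move=> i /eqP li; move/eqP: h; rewrite jip_sumr psumr_eq0 => [/allP/(_ i (mem_index_enum i))|j _].
    by rewrite li => /eqP.
  by rewrite jipC pos_ip_idem.
by rewrite jip_sumr big1 // => i /eqP /h.
Qed.

(** * Positivity of functions of a convergent family *)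

Section LimitOfPositivity.
Context {T : Type} (F : set_system T) {FU : UltraFilter F}.
Context (u0 : u != 0) (a : T -> A) (l : A).
Hypothesis a_int : forall y, cone_int mul u (a y).
Hypothesis a_le1 : forall y, pos (u - a y).
Hypothesis al : Acvg F a l.

(** Idempotents and eigenvalues are bounded, so they converge along the ultrafilter, and the
    relations of a system are closed. Some limits [q i] may be 0 and some [be i] may be 0. *)
Lemma frame_limit : exists (p : T -> 'I_N -> A) (al : T -> 'I_N -> R) (q : 'I_N -> A) (be : 'I_N -> R),
  [/\ forall y, osys (p y) /\ a y = \sum_i al y i *: p y i,
      forall y i, 0 < al y i <= 1,
      osys q /\ l = \sum_i be i *: q i,
      forall i, Acvg F (p^~ i) (q i) &
      forall i, al^~ i @ F --> be i /\ 0 <= be i <= 1].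
Proof.
have /choice[pa hpa] : forall y, exists pl : ('I_N -> A) * ('I_N -> R),
    [/\ osys pl.1, a y = \sum_i pl.2 i *: pl.1 i & forall i, 0 < pl.2 i <= 1].
  move=> y; have [p [lam [op ay sl]]] := padded_spec (a y) u0.
  exists (p, lam); split=> // i /=; have [r [q [mu [oq q0 ay']]]] := spectral_neq0 (a y).
  move: (sl i); rewrite (osys_spectrum oq q0 ay') => -[j _ <-].
  have /(cone_intP _ u0)[e e0] := a_int y.
  rewrite -(opprK (_ - _)) opprB ay' osysB // -sumrN.
  rewrite (eq_bigr (fun i => (mu i - e) *: q i)) => [|k _]; last by rewrite -scaleNr opprB.
  rewrite pos_osys // => /(_ j (q0 j)); rewrite subr_ge0 => ej.
  have := a_le1 y; rewrite ay' -[u]scale1r osysB // pos_osys // => /(_ j (q0 j)).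
  by rewrite subr_ge0 => ->; rewrite (lt_le_trans e0 ej).
have cp i : exists q, Acvg F (fun y => (pa y).1 i) q.
  by apply: (@Acvg_bounded T F FU _ (jip u u)) => y; have [[pp _ _] _ _] := hpa y; apply: idem_bound.
have /choice[q hq] := cp.
have cb i : exists b, (fun y => (pa y).2 i) @ F --> b /\ 0 <= b <= 1.
  have [|b b01 hb] := @ultra_bounded T F FU (fun y => (pa y).2 i) 0 1; last by exists b.
  by apply: nearW => y; have [_ _ /(_ i) /andP[/ltW -> ->]] := hpa y.
have /choice[be hbe] := cb.
exists (fun y => (pa y).1), (fun y => (pa y).2), q, be.
have FP : ProperFilter F := @ultra_proper _ _ FU.
split=> //; try by [move=> y; have [? ? ?] := hpa y|move=> y i; have [_ _] := hpa y].
split; first split.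
- move=> i; apply: (Acvg_unique _ (hq i)); apply: Acvg_eq (Acvg_mul (hq i) (hq i)) => y.
  by have [[pp _ _] _ _] := hpa y.
- move=> i j ij; apply: (Acvg_unique (Acvg_mul (hq i) (hq j))).
  by apply: Acvg_eq (Acvg_cst (l := 0)) => y; have [[_ po _] _ _] := hpa y; rewrite po.
- apply: (Acvg_unique (Acvg_sum (fun i _ => hq i))).
  by apply: Acvg_eq (Acvg_cst (l := u)) => y; have [[_ _ ps] _ _] := hpa y; rewrite ps.
- apply: (Acvg_unique al); apply: Acvg_eq (Acvg_sum (fun i _ => AcvgZ (hbe i).1 (hq i))) => y.
  by have [_ -> _] := hpa y.
Qed.

(** The two instances are t |-> ln s - ln t, for the normed space, and t |-> s / t, for the cone. *)
Context (gam : R -> R) (m : R).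
Hypothesis gam_ge : forall t, 0 < t <= 1 -> m <= gam t.
Hypothesis gam_cont : forall t, 0 < t -> {for t, continuous gam}.
Hypothesis gam_pinfty : forall K, exists2 d, 0 < d & forall t, 0 < t < d -> K <= gam t.

(** Stating negativity as an implication gives a unit vector for every c, so that [choice] applies
    to the whole family. *)
Lemma unit_states (c : A) : exists w, [/\ pos w, jip w w = 1 & ~ pos c -> jip w c < 0].
Proof.
have norm e : e ** e = e -> e != 0 ->
    exists s : R, [/\ 0 < s, pos (s *: e) & jip (s *: e) (s *: e) = 1].
  move=> ee e0; have h := jip_idem_gt0 ee e0; exists (Num.sqrt (jip e e))^-1; split.
  - by rewrite invr_gt0 sqrtr_gt0.
  - by apply: posZ (pos_idem ee); rewrite invr_ge0 sqrtr_ge0.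
  - by rewrite jipZl jipZr mulrA -expr2 exprVn sqr_sqrtr ?ltW // mulVf // gt_eqF.
have [pc|npc] := pselect (pos c).
  by have [||s [s0 ps s1]] := norm u; rewrite ?jmul1 //; exists (s *: u); split.
have [e [ee ec]] : exists e, e ** e = e /\ jip e c < 0.
  apply: contrapT => no; apply: npc; apply: pos_dual => e ee.
  by rewrite leNgt; apply/negP => ec; apply: no; exists e.
have [||s [s0 ps s1]] := norm e; rewrite ?ee //.
  by apply: contraTneq ec => ->; rewrite jip0l ltxx.
by exists (s *: e); split=> // _; rewrite jipZl pmulr_rlt0.
Qed.

(* Otherwise unit vectors w_y of the cone with <w_y, c_y - z> < 0 accumulate at
   some w, and w lies in the face of supp l because gam blows up at 0. *)
Lemma limit_pos z : (forall w, face (supp l) w -> 0 < jip w (fc gam l - z)) ->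
  \forall y \near F, pos (fc gam (a y) - z).
Proof.
move=> h; have [p [al' [q [be [pa a01 [oq lE] cp cb]]]]] := frame_limit.
have FP : ProperFilter F := @ultra_proper _ _ FU.
have [//|FS] := in_ultra_setVsetC [set y | pos (fc gam (a y) - z)] FU; exfalso.
have /choice[w hw] := fun y => unit_states (fc gam (a y) - z).
have [v wv] : exists v, Acvg F w v.
  by apply: (@Acvg_bounded T F FU _ 1) => y; have [_ ->] := hw y.
have pv : pos v by apply: (Acvg_pos wv); apply: nearW => y; case: (hw y).
have v1 : jip v v = 1.
  apply: (cvg_unique _ (Acvg_ip wv wv)) => //.
  rewrite (_ : (fun y => jip (w y) (w y)) = fun=> 1); first exact: cvg_cst.
  by apply/funext => y; have [_ ->] := hw y.
have v0 : v != 0 by apply: contra_eq_neq v1 => ->; rewrite jip0l eq_sym oner_eq0.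
have cq i : (fun y => jip (w y) (p y i)) @ F --> jip v (q i) by apply: Acvg_ip.
have q_ge0 y i : 0 <= jip (w y) (p y i).
  by have [[[pp _ _] _] [pw _ _]] := (pa y, hw y); rewrite jipC pos_ip_idem.
have ineq : \forall y \near F, \sum_i jip (w y) (p y i) * gam (al' y i) < jip (w y) z.
  apply: filterS FS => y /= ny; have [_ _ /(_ ny)] := hw y.
  have [op ay] := pa y; rewrite jipBr subr_lt0; apply: le_lt_trans.
  rewrite ay fcE // jip_sumr le_eqVlt; apply/orP; left; apply/eqP.
  by apply: eq_bigr => i _; rewrite jipZr mulrC.
have g_ge y i : - `|m| <= gam (al' y i).
  by apply: le_trans (gam_ge (a01 y i)); rewrite lerNl ler_normr lexx orbT.
(* If <v, q i> were positive with [be i] = 0, the i-th term of [ineq] would tend to infinity. The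
   other terms are together at least -|m| <w y, u> and the right side converges, a contradiction. *)
have van i : be i = 0 -> jip v (q i) = 0.
  move=> bi; apply/eqP/negPn/negP => n0.
  have qi : 0 < jip v (q i) by rewrite lt_neqAle eq_sym n0 jipC pos_ip_idem //; case: oq.
  have [C hC] : exists C, \forall y \near F, jip (w y) (p y i) * gam (al' y i) <= C.
    have c1 : (fun y => jip (w y) z + `|m| * jip (w y) u) @ F --> jip v z + `|m| * jip v u.
      apply: cvgD; first exact: Acvg_ip wv (Acvg_cst (l := z)).
      by apply: cvgM; [apply: cvg_cst|apply: Acvg_ip wv (Acvg_cst (l := u))].
    exists (jip v z + `|m| * jip v u + 1).
    have c2 : \forall y \near F, jip (w y) z + `|m| * jip (w y) u < jip v z + `|m| * jip v u + 1.
      by apply: (cvgr_lt _ c1); rewrite ltrDl.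
    apply: filterS2 ineq c2 => y iy cy; apply/ltW/(le_lt_trans _ cy).
    move: iy; rewrite (bigD1 i) //= -ltrBrDr => /ltW /le_trans; apply; rewrite lerD2l.
    have -> : jip (w y) u = \sum_j jip (w y) (p y j).
      by case: (pa y).1 => _ _ <-; rewrite jip_sumr.
    rewrite mulr_sumr [X in _ <= X](bigD1 i) //=.
    rewrite -sumrN -[X in X <= _]add0r lerD ?mulr_ge0 // ler_sum // => j _.
    by have g1 := g_ge y j; have q1 := q_ge0 y j; nra.
  have [d d0 hd] := gam_pinfty ((`|C| + 1) / (jip v (q i) / 2)).
  have [ci _] := cb i; rewrite bi in ci.
  have c3 : \forall y \near F, jip v (q i) / 2 < jip (w y) (p y i).
    by apply: (cvgr_gt _ (cq i)); rewrite ltr_pdivrMr // ltr_pMr // ltr1n.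
  have [y [y1 y2 y3]] : exists y, [/\ jip (w y) (p y i) * gam (al' y i) <= C,
      jip v (q i) / 2 < jip (w y) (p y i) & al' y i < d].
    have c4 : \forall y \near F, al' y i < d by apply: (cvgr_lt _ ci).
    apply: (@filter_ex _ F); apply: filterS3 hC c3 c4 => y *; split=> //.
  have ga : (`|C| + 1) / (jip v (q i) / 2) <= gam (al' y i).
    by apply: hd; rewrite y3 andbT; case/andP: (a01 y i).
  have g0 : 0 < (`|C| + 1) / (jip v (q i) / 2) by rewrite !divr_gt0 // ltr_wpDl.
  have : `|C| + 1 < C.
    apply: lt_le_trans y1; have k0 : 0 < jip v (q i) / 2 by rewrite divr_gt0.
    apply: (@le_lt_trans _ _ (jip v (q i) / 2 * gam (al' y i))).
      by rewrite mulrC -ler_pdivrMr.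
    by rewrite ltr_pM2r // (lt_le_trans g0 ga).
  by have := ler_norm C; lra.
have fv : face (supp l) v by rewrite lE; apply/face_osys.
have := h v fv; rewrite jipBr subr_gt0 ltNge => /negP; apply.
rewrite lE fcE // jip_sumr (bigID (fun i => be i == 0)) /= big1 ?add0r => [|i /eqP bi]; last first.
  by rewrite jipZr van // mulr0.
(* The terms with [be i] = 0 need not converge, but they are at least -|m| <w y, p y i>, and this
   bound tends to 0 by [van]. *)
have c1 : (fun y => \sum_(i | be i != 0) jip (w y) (p y i) * gam (al' y i)
     - `|m| * \sum_(i | be i == 0) jip (w y) (p y i)) @ F -->
   \sum_(i | be i != 0) jip v (q i) * gam (be i) - `|m| * \sum_(i | be i == 0) jip v (q i).
  apply: cvgB; last by apply: cvgM; [apply: cvg_cst|apply: cvg_sumr].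
  apply: cvg_sumr => i bi; apply: cvgM => //; have [ci /andP[b0 _]] := cb i.
  by apply: (cvg_comp _ _ ci); apply: gam_cont; rewrite lt_neqAle eq_sym bi.
rewrite (eq_bigr (fun i => jip v (q i) * gam (be i))) => [|i _]; last by rewrite jipZr mulrC.
have -> : \sum_(i | be i != 0) jip v (q i) * gam (be i) =
   \sum_(i | be i != 0) jip v (q i) * gam (be i) - `|m| * \sum_(i | be i == 0) jip v (q i).
  by rewrite [X in _ * X]big1 ?mulr0 ?subr0 // => i /eqP /van.
apply: (cvg_ler c1 (Acvg_ip wv (Acvg_cst (l := z)))).
apply: filterS ineq => y iy; apply/ltW/(le_lt_trans _ iy).
rewrite [X in _ <= X](bigID (fun i => be i == 0)) /= [X in _ <= X]addrC lerD2l mulr_sumr -sumrN ler_sum // => i _.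
by have g1 := g_ge y i; have q1 := q_ge0 y i; nra.
Qed.

Lemma jU_osys_proj r (p : 'I_r -> A) (S : pred 'I_r) (lam : 'I_r -> R) : osys p ->
  jU (\sum_(i | S i) p i) (\sum_i lam i *: p i) = \sum_(i | S i) lam i *: p i.
Proof.
move=> op; have e mu : (\sum_(i | S i) p i) ** (\sum_i mu i *: p i) = \sum_(i | S i) mu i *: p i.
  by rewrite jmul_suml; apply: eq_bigr => i _; rewrite osys_mul.
have e2 : \sum_(i | S i) lam i *: p i = \sum_i (if S i then lam i else 0) *: p i.
  by rewrite [LHS]big_mkcond; apply: eq_bigr => i _; case: ifP; rewrite ?scale0r.
rewrite /jU e e2 e.
have -> : \sum_(i | S i) (if S i then lam i else 0) *: p i = \sum_(i | S i) lam i *: p i.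
  by apply: eq_bigr => i ->.
by rewrite -e2; vring.
Qed.

(* Compressing w by U_(P_y), with P_y -> supp l, gives elements of the cone
   on which the diverging coefficients of fc gam (a y) vanish. *)
Lemma limit_not_pos z w : face (supp l) w -> jip w (fc gam l - z) < 0 ->
  \forall y \near F, ~ pos (fc gam (a y) - z).
Proof.
move=> fw h; have [p [al' [q [be [pa a01 [oq lE] cp cb]]]]] := frame_limit.
have FP : ProperFilter F := @ultra_proper _ _ FU.
pose P y := \sum_(i | be i != 0) p y i.
have PP y : P y ** P y = P y.
  have [op _] := pa y; rewrite /P jmul_suml; apply: eq_bigr => i bi.
  rewrite jmul_sumr (bigD1 i) //= big1 => [|j /andP[_ ji]]; first by case: op => -> _ _; rewrite addr0.
  by case: op => _ -> //; rewrite eq_sym.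
have cP : Acvg F P (supp l) by rewrite lE supp_osys //; apply: Acvg_sum.
have cU : Acvg F (fun y => jU (P y) w) w.
  rewrite -[X in Acvg _ _ X](jU_fix (face_mul (supp_idem l) fw)).
  apply: AcvgB; last exact: Acvg_mul cP (Acvg_cst (l := w)).
  by apply: AcvgZ; [apply: cvg_cst|apply: Acvg_mul cP (Acvg_mul cP (Acvg_cst (l := w)))].
have [pw w0 hw] := fw.
have e y : jip (jU (P y) w) (fc gam (a y)) = \sum_(i | be i != 0) gam (al' y i) * jip w (p y i).
  have [op ->] := pa y; rewrite jU_sym fcE // jU_osys_proj // jip_sumr.
  by apply: eq_bigr => i _; rewrite jipZr.
have cv : (fun y => jip (jU (P y) w) (fc gam (a y) - z)) @ F --> jip w (fc gam l - z).
  under eq_fun do rewrite jipBr e; rewrite jipBr; apply: cvgB; last exact: Acvg_ip cU (Acvg_cst (l := z)).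
  have -> : jip w (fc gam l) = \sum_(i | be i != 0) gam (be i) * jip w (q i).
    rewrite lE fcE // jip_sumr (bigID (fun i => be i == 0)) /= big1 ?add0r => [|i /eqP bi].
      by apply: eq_bigr => i _; rewrite jipZr.
    by move: fw; rewrite lE => /face_osys[] // _ _ /(_ i bi) e0; rewrite jipZr e0 mulr0.
  apply: cvg_sumr => i bi; apply: cvgM; last exact: cp.
  have [ci /andP[b0 _]] := cb i.
  by apply: (cvg_comp _ _ ci); apply: gam_cont; rewrite lt_neqAle eq_sym bi.
apply: filterS (cvgr_lt _ cv _ h) => y hy py.
by have := pos_ip (jU_pos (PP y) pw) py; rewrite leNgt hy.
Qed.

End LimitOfPositivity.

(** * The limit functions [EN], [KN] and M(a/z) *)

Section LimitFunctions.
Context (u0 : u != 0).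

Lemma pos_ip_gt0 w : pos w -> w != 0 -> 0 < jip w u.
Proof.
move=> pw w0; rewrite lt_neqAle eq_sym (pos_ip pw pos1) andbT.
apply: contra w0 => /eqP h; have := pos_ip_eq0 pw pos1 h.
by rewrite jmul1 => ->.
Qed.

Lemma int_ip_gt0 w x : cone_int mul u x -> pos w -> w != 0 -> 0 < jip w x.
Proof.
move=> /(cone_intP _ u0)[e e0 px] pw w0; have := pos_ip pw px.
rewrite jipBr jipZr subr_ge0; apply: lt_le_trans.
by rewrite mulr_gt0 // pos_ip_gt0.
Qed.

Lemma int_pos x : cone_int mul u x -> pos x.
Proof.
move=> /(cone_intP _ u0)[e e0 px].
by have := posD px (posZ (ltW e0) pos1); rewrite subrK.
Qed.

Lemma jip_jmax w x : pos w -> jip w x <= jmax x * jip w u.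
Proof.
move=> pw; have h : pos (jmax x *: u - x) by apply/jmax_le.
by have := pos_ip pw h; rewrite jipBr jipZr subr_ge0.
Qed.

Lemma int_dominates x y : cone_int mul u y -> exists2 c, 0 < c & pos (c *: y - x).
Proof.
move=> /(cone_intP _ u0)[e e0 py].
have h : pos ((`|jmax x| + 1) *: u - x).
  by apply/jmax_le => //; rewrite (le_trans (ler_norm _)) // lerDl.
have c0 : 0 < (`|jmax x| + 1) / e by rewrite divr_gt0 // ltr_wpDl.
exists ((`|jmax x| + 1) / e) => //.
have := posD (posZ (ltW c0) py) h; congr pos; apply: coord_eqP => i; rewrite !coordE.
by field; rewrite gt_eqF.
Qed.

(** The infimum is attained because the cone is given by the closed conditions of [pos_dual]. The
    [+ 1] in the tolerance keeps its denominator positive for every idempotent e, including 0. *)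
Lemma Mfun_le x y s : cone_int mul u y -> Mfun mul x y <= s <-> pos (s *: y - x).
Proof.
move=> iy; have py := int_pos iy; pose B := [set b | jle mul x (b *: y)].
have B0 : B !=set0 by have [c _ h] := int_dominates x iy; exists c.
have yu : 0 < jip u y by apply: int_ip_gt0 => //; apply: pos1.
have lB : has_lbound B.
  exists (jip u x / jip u y) => b hb; have := pos_ip pos1 hb.
  by rewrite jipBr jipZr subr_ge0 ler_pdivrMr.
have up b c : B b -> b <= c -> B c.
  move=> hb bc; have := posD hb (posZ (_ : 0 <= c - b) py).
  by rewrite subr_ge0 => /(_ bc); congr pos; vring.
have hM : B (Mfun mul x y).
  apply: pos_dual => e ee; rewrite leNgt; apply/negP => neg.
  have pe := pos_ip_idem py ee; pose d := - jip e (Mfun mul x y *: y - x).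
  have d0 : 0 < d by rewrite oppr_gt0.
  have [|b hb bd] := @inf_adherent R B (d / (jip e y + 1)) _ (conj B0 lB).
    by rewrite divr_gt0 // ltr_wpDl.
  have := pos_ip_idem hb ee; rewrite leNgt => /negP; apply.
  have : b * jip e y <= (Mfun mul x y + d / (jip e y + 1)) * jip e y.
    by rewrite ler_wpM2r // ltW.
  have : d / (jip e y + 1) * jip e y < d.
    by rewrite mulrAC -mulrA gtr_pMr // ltr_pdivrMr ?ltr_wpDl // mul1r ltrDl.
  rewrite /d !(jipBr, jipZr) mulrDl; lra.
by split=> [h|h]; [apply: up hM h|apply: ge_inf].
Qed.

Lemma Mfun_ge0 x y : pos x -> cone_int mul u y -> 0 <= Mfun mul x y.
Proof.
move=> px iy; have /(Mfun_le x _ iy) h := lexx (Mfun mul x y).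
have := pos_ip pos1 h; rewrite jipBr jipZr subr_ge0 => h1.
have := le_trans (pos_ip pos1 px) h1.
by rewrite pmulr_lge0 // int_ip_gt0 //; apply: pos1.
Qed.

Lemma Mfun_gt0 x y : pos x -> x != 0 -> cone_int mul u y -> 0 < Mfun mul x y.
Proof.
move=> px x0 iy; rewrite lt_neqAle eq_sym Mfun_ge0 // andbT; apply: contra x0 => /eqP e.
have /(Mfun_le x _ iy) := lexx (Mfun mul x y); rewrite e scale0r sub0r => h.
by apply/eqP; apply: pos_anti.
Qed.

Lemma jmax_Mfun x : jmax x = Mfun mul x u.
Proof.
have iu : cone_int mul u u.
  by apply/cone_intP => //; exists 1 => //; rewrite scale1r subrr; apply: pos0.
apply/eqP; rewrite eq_le; apply/andP; split.
  by apply/jmax_le => //; apply/Mfun_le.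
by apply/Mfun_le => //; apply/jmax_le.
Qed.

(* The limits, as the invertible element a_n <= u tends to a, of
   exp (jmax (ln a_n - z)) and of Mfun z (a_n^-1): only states on the face of a
   see a finite value of ln a_n. *)
Definition EN (a z : A) : R :=
  sup [set expR (jip w (fc (@ln R) a - z) / jip w u) | w in face (supp a)].

Definition KN (b z : A) : R :=
  sup [set jip w z / jip w (fc (@GRing.inv R) b) | w in face (supp b)].

Lemma face_pos P w : face P w -> pos w. Proof. by case. Qed.
Lemma face_gt0 P w : face P w -> 0 < jip w u.
Proof. by case=> pw w0 _; apply: pos_ip_gt0. Qed.

Lemma EN_has_ubound a z :
  has_ubound [set expR (jip w (fc (@ln R) a - z) / jip w u) | w in face (supp a)].
Proof.
exists (expR (jmax (fc (@ln R) a - z))) => _ [w fw <-].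
by rewrite ler_expR ler_pdivrMr ?(face_gt0 fw) // jip_jmax //; case: fw.
Qed.

Lemma EN_ge a z w : face (supp a) w -> expR (jip w (fc (@ln R) a - z) / jip w u) <= EN a z.
Proof. by move=> fw; apply: ub_le_sup; [apply: EN_has_ubound|exists w]. Qed.

(** The supremum of the empty set is 0, which is the right value for a = 0: the logarithms then tend
    to minus infinity. *)
Lemma EN_noface a z : ~ (exists w, face (supp a) w) -> EN a z = 0.
Proof.
move=> no; rewrite /EN (_ : image _ _ = set0) ?sup0 //.
by apply/seteqP; split=> // t [w fw _]; case: no; exists w.
Qed.

Lemma KN_noface b z : ~ (exists w, face (supp b) w) -> KN b z = 0.
Proof.
move=> no; rewrite /KN (_ : image _ _ = set0) ?sup0 //.
by apply/seteqP; split=> // t [w fw _]; case: no; exists w.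
Qed.

Lemma EN_ge0 a z : 0 <= EN a z.
Proof.
have [[w fw]|no] := pselect (exists w, face (supp a) w).
  exact: le_trans (expR_ge0 _) (EN_ge z fw).
by rewrite EN_noface.
Qed.

Lemma EN_le a z s : (forall w, face (supp a) w -> jip w (fc (@ln R) a - z) <= s * jip w u) ->
  EN a z <= expR s.
Proof.
move=> h; have [[w fw]|no] := pselect (exists w, face (supp a) w).
  apply: ge_sup; first by eexists; exists w.
  by move=> _ [v fv <-]; rewrite ler_expR ler_pdivrMr ?(face_gt0 fv) // h.
by rewrite EN_noface ?expR_ge0.
Qed.

(** All eigenvalues of b are at most C, so on the support those of the inverse are at least 1 / C;
    the summand 1 covers b = 0. The denominators in [KN] stay away from 0. *)
Lemma inv_face_gt0 b : pos b -> exists2 c, 0 < c & forall w, face (supp b) w ->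
  c * jip w u <= jip w (fc (@GRing.inv R) b).
Proof.
case/pos_spec=> r [p [lam [op -> l0]]]; pose C := 1 + \sum_i lam i.
have S0 : 0 <= \sum_i lam i by apply: sumr_ge0.
have C0 : 0 < C by rewrite ltr_pwDl.
exists C^-1; rewrite ?invr_gt0 // => w /face_osys[] // pw w0 hw; rewrite fcE //.
case: (op) => pp _ <-; rewrite !jip_sumr mulr_sumr ler_sum // => i _; rewrite jipZr.
have [li|li] := eqVneq (lam i) 0; first by rewrite hw // !mulr0.
rewrite ler_wpM2r // ?(jipC w) ?pos_ip_idem // lef_pV2 ?posrE // ?lt_neqAle 1?eq_sym ?li ?l0 //.
by rewrite /C (bigD1 i) //= addrCA lerDl addr_ge0 // sumr_ge0.
Qed.

Lemma inv_face_pos b w : pos b -> face (supp b) w -> 0 < jip w (fc (@GRing.inv R) b).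
Proof.
move=> pb fw; have [c c0 h] := inv_face_gt0 pb; apply: lt_le_trans (h w fw).
by rewrite mulr_gt0 // (face_gt0 fw).
Qed.

Lemma KN_has_ubound b z : pos b ->
  has_ubound [set jip w z / jip w (fc (@GRing.inv R) b) | w in face (supp b)].
Proof.
move=> pb; have [c c0 h] := inv_face_gt0 pb; exists (`|jmax z| / c) => _ [w fw <-].
rewrite ler_pdivrMr ?inv_face_pos // mulrAC ler_pdivlMr //.
apply: (@le_trans _ _ (`|jmax z| * jip w u * c)).
  rewrite (ler_wpM2r (ltW c0)) // (le_trans (jip_jmax _ (face_pos fw))) //.
  by rewrite ler_wpM2r ?ler_norm // (ltW (face_gt0 fw)).
by rewrite -mulrA ler_wpM2l // mulrC h.
Qed.

Lemma KN_ge b z w : pos b -> face (supp b) w -> jip w z / jip w (fc (@GRing.inv R) b) <= KN b z.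
Proof. by move=> pb fw; apply: ub_le_sup; [apply: KN_has_ubound|exists w]. Qed.

Lemma KN_le b z s : pos b -> 0 <= s ->
  (forall w, face (supp b) w -> jip w z <= s * jip w (fc (@GRing.inv R) b)) -> KN b z <= s.
Proof.
move=> pb s0 h; have [[w fw]|no] := pselect (exists w, face (supp b) w).
  apply: ge_sup; first by eexists; exists w.
  by move=> _ [v fv <-]; rewrite ler_pdivrMr ?inv_face_pos // h.
by rewrite KN_noface.
Qed.

Lemma KN_ge0 b z : pos b -> pos z -> 0 <= KN b z.
Proof.
move=> pb pz; have [[w fw]|no] := pselect (exists w, face (supp b) w).
  apply: le_trans (KN_ge z pb fw); rewrite divr_ge0 ?(ltW (inv_face_pos pb fw)) //.
  by apply: pos_ip => //; case: fw.
by rewrite KN_noface.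
Qed.

Section MonotoneLimits.
Context {T : Type} (F : set_system T) {FU : UltraFilter F}.
Context (a : T -> A) (l : A).
Hypothesis a_int : forall y, cone_int mul u (a y).
Hypothesis a_le1 : forall y, pos (u - a y).
Hypothesis al : Acvg F a l.
Let FP : ProperFilter F := @ultra_proper _ _ FU.

Lemma limit_is_pos : pos l.
Proof. by apply: (Acvg_pos al); apply: nearW => y; apply: int_pos. Qed.

Lemma fc_affine_ln s x : fc (fun t => s - ln t) x = s *: u - fc (@ln R) x.
Proof.
have [r [p [lam [op ->]]]] := spectral x; rewrite !fcE //.
have -> : s *: u = \sum_i s *: p i by rewrite -scaler_sumr; case: op => _ _ ->.
by rewrite -sumrB; apply: eq_bigr => i _; rewrite scalerBl.
Qed.

Lemma fc_scale c f x : fc (fun t => c * f t) x = c *: fc f x.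
Proof.
have [r [p [lam [op ->]]]] := spectral x; rewrite !fcE // scaler_sumr.
by apply: eq_bigr => i _; rewrite scalerA.
Qed.

(** For s > 0 the quantity is at most s iff ln s - ln (a y) + z lies in the cone. Levels above and
    below [EN l z] are decided by [limit_pos] and [limit_not_pos]. *)
Lemma cvg_EN z : (fun y => expR (jmax (fc (@ln R) (a y) - z))) @ F --> EN l z.
Proof.
have lt0 (s : R) : 0 < s -> s = expR (ln s) by move=> s0; rewrite lnK.
have ge (s t : R) : 0 < t <= 1 -> s <= s - ln t.
  by move=> /andP[t0 t1]; rewrite lerDl oppr_ge0 ln_le0.
have ct (s t : R) : 0 < t -> {for t, continuous (fun t => s - ln t : R)}.
  by move=> t0; apply: cvgB; [apply: cvg_cst|apply: continuous_ln].
have infty (s K : R) : exists2 d, 0 < d & forall t, 0 < t < d -> K <= s - @ln R t.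
  exists (expR (s - K)); first exact: expR_gt0.
  by move=> t /andP[t0 td]; rewrite lerBrDr addrC -lerBrDr ltW // -ltr_expR lnK.
apply: cvg_between => s sl.
  have s0 : 0 < s := le_lt_trans (EN_ge0 l z) sl.
  have sl' : EN l z < expR (ln s) by rewrite -lt0.
  have h : \forall y \near F, pos (fc (fun t => ln s - ln t) (a y) - - z).
    apply: (limit_pos u0 a_int a_le1 al (ge (ln s)) (ct (ln s)) (infty (ln s))) => w fw.
    have := le_lt_trans (EN_ge z fw) sl'; rewrite ltr_expR ltr_pdivrMr ?(face_gt0 fw) //.
    by rewrite fc_affine_ln !(jipBr, jipNr, jipZr); lra.
  apply: filterS h => y; rewrite [leRHS]lt0 // ler_expR fc_affine_ln => h.
  by apply/jmax_le => //; move: h; congr pos; vring.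
have [s0|s0] := leP s 0.
  by apply: nearW => y; apply: le_trans s0 (expR_ge0 _).
have [w fw ws] : exists2 w, face (supp l) w & s < expR (jip w (fc (@ln R) l - z) / jip w u).
  apply: contrapT => no; move: sl; rewrite ltNge => /negP; apply.
  rewrite [leRHS]lt0 //; apply: EN_le => w fw.
  rewrite -ler_pdivrMr ?(face_gt0 fw) // -ler_expR -lt0 // leNgt; apply/negP => h.
  by apply: no; exists w.
have h : \forall y \near F, ~ pos (fc (fun t => ln s - ln t) (a y) - - z).
  apply: (limit_not_pos u0 a_int a_le1 al (ct (ln s)) fw).
  move: ws; rewrite {1}(lt0 s s0) ltr_expR ltr_pdivlMr ?(face_gt0 fw) //.
  by rewrite fc_affine_ln !(jipBr, jipNr, jipZr); lra.
apply: filterS h => y; rewrite fc_affine_ln => np.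
rewrite [leLHS]lt0 // ler_expR leNgt; apply/negP => h; apply: np.
have /jmax_le := ltW h; move=> /(_ u0); congr pos; vring.
Qed.

Lemma inv_int x : cone_int mul u x -> cone_int mul u (fc (@GRing.inv R) x).
Proof.
move=> /(cone_int_exp _ u0) ->.
have -> : fc (@GRing.inv R) (fc expR (fc (@ln R) x)) = fc expR (fc (fun t => - ln t) x).
  by rewrite !fc_comp; congr (fc _ x); apply/funext => t /=; rewrite expRN.
exact: cone_int_fc_exp.
Qed.

(** As for [cvg_EN], with the cone condition s (a y)^-1 - z >= 0. *)
Lemma cvg_KN z : pos z -> (fun y => Mfun mul z (fc (@GRing.inv R) (a y))) @ F --> KN l z.
Proof.
move=> pz; have pl := limit_is_pos.
have ge (s t : R) : 0 < s -> 0 < t <= 1 -> 0 <= s * t^-1.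
  by move=> s0 /andP[t0 t1]; rewrite mulr_ge0 ?invr_ge0 // ltW.
have ct (s t : R) : 0 < t -> {for t, continuous (fun x : R => s * x^-1 : R)}.
  by move=> t0; apply: cvgM; [apply: cvg_cst|apply: inv_continuous; rewrite gt_eqF].
have infty (s K : R) : 0 < s -> exists2 d, 0 < d & forall t, 0 < t < d -> K <= s * t^-1.
  move=> s0; exists (s / (`|K| + 1)); first by rewrite divr_gt0 // ltr_wpDl.
  move=> t /andP[t0 td]; rewrite ler_pdivlMr //.
  apply: (@le_trans _ _ ((`|K| + 1) * t)).
    by rewrite (ler_wpM2r (ltW t0)) // (le_trans (ler_norm _)) // lerDl.
  by move: td; rewrite ltr_pdivlMr ?ltr_wpDl // mulrC => /ltW.
apply: cvg_between => s sl.
  have s0 : 0 < s := le_lt_trans (KN_ge0 pl pz) sl.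
  have h : \forall y \near F, pos (fc (fun t : R => s * t^-1) (a y) - z).
    apply: (limit_pos u0 a_int a_le1 al (fun t => ge s t s0) (ct s) (fun K => infty s K s0)) => w fw.
    have := le_lt_trans (KN_ge z pl fw) sl; rewrite ltr_pdivrMr ?inv_face_pos //.
    by rewrite fc_scale jipBr jipZr subr_gt0.
  by apply: filterS h => y; rewrite fc_scale => h; apply/Mfun_le => //; apply: inv_int.
have [s0|s0] := leP s 0.
  by apply: nearW => y; apply: le_trans s0 (Mfun_ge0 pz (inv_int (a_int y))).
have [w fw ws] : exists2 w, face (supp l) w & s < jip w z / jip w (fc (@GRing.inv R) l).
  apply: contrapT => no; move: sl; rewrite ltNge => /negP; apply.
  apply: KN_le => // [|w fw]; first exact: ltW.
  rewrite -ler_pdivrMr ?inv_face_pos // leNgt; apply/negP => h.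
  by apply: no; exists w.
have h : \forall y \near F, ~ pos (fc (fun t : R => s * t^-1) (a y) - z).
  apply: (limit_not_pos u0 a_int a_le1 al (ct s) fw).
  by move: ws; rewrite ltr_pdivlMr ?inv_face_pos // fc_scale jipBr jipZr subr_lt0.
apply: filterS h => y; rewrite fc_scale => np.
rewrite leNgt; apply/negP => h; apply: np.
by apply/Mfun_le; [apply: inv_int|apply: ltW].
Qed.

(** Nothing diverges here. The lower bound holds because the cone is closed; for the upper one, unit
    states violating positivity would accumulate at a state v with <v, s z - l> <= 0, although
    M(l/z) < s and z is interior. *)
Lemma cvg_Mfun z : cone_int mul u z -> (fun y => Mfun mul (a y) z) @ F --> Mfun mul l z.
Proof.
move=> iz; apply: cvg_between => s sl.
  have [h|FS] := in_ultra_setVsetC [set y | pos (s *: z - a y)] FU.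
    by apply: filterS h => y /= h; apply/Mfun_le.
  exfalso; have /choice[w hw] := fun y => unit_states u0 (s *: z - a y).
  have [v wv] : exists v, Acvg F w v.
    by apply: (@Acvg_bounded T F FU _ 1) => y; have [_ ->] := hw y.
  have pv : pos v by apply: (Acvg_pos wv); apply: nearW => y; case: (hw y).
  have v1 : jip v v = 1.
    apply: (cvg_unique _ (Acvg_ip wv wv)) => //.
    rewrite (_ : (fun y => jip (w y) (w y)) = fun=> 1); first exact: cvg_cst.
    by apply/funext => y; have [_ ->] := hw y.
  have v0 : v != 0 by apply: contra_eq_neq v1 => ->; rewrite jip0l eq_sym oner_eq0.
  have c1 : (fun y => jip (w y) (s *: z - a y)) @ F --> jip v (s *: z - l).
    by apply: (Acvg_ip wv); apply: AcvgB => //; apply: Acvg_cst.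
  have h : jip v (s *: z - l) <= 0.
    apply: (cvg_ler c1 (cvg_cst 0)); apply: filterS FS => y /= ny.
    by have [_ _ /(_ ny) /ltW] := hw y.
  have /(Mfun_le l _ iz) hM := lexx (Mfun mul l z).
  have := pos_ip pv hM; move: h; have := int_ip_gt0 iz pv v0.
  rewrite !(jipBr, jipZr) => vz h1 h2.
  by have : Mfun mul l z * jip v z < s * jip v z; [rewrite ltr_pM2r|lra].
have [h|h] := in_ultra_setVsetC [set y | pos (s *: z - a y)] FU; last first.
  by apply: filterS h => y /= np; rewrite leNgt; apply/negP => /ltW /(Mfun_le _ _ iz).
exfalso; move: sl; rewrite ltNge => /negP; apply; apply/Mfun_le => //.
apply: (Acvg_pos _ h); apply: AcvgB => //; exact: Acvg_cst.
Qed.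

End MonotoneLimits.

Lemma fc_exp_pair y r s (p : 'I_N -> A) lam : osys p -> y = \sum_i lam i *: p i ->
  fc (fun t => expR (t - r)) y = \sum_i expR (lam i - r) *: p i /\
  fc (fun t => expR (- t - s)) y = \sum_i expR (- lam i - s) *: p i.
Proof. by move=> op ->; rewrite !fcE. Qed.

(** Both exponentials share the frame of y, and their i-th eigenvalues multiply to exp (- (r y + s
    y)) for every i. Hence all limit products [al i * be i] equal one number k. *)
Lemma pair_limit (F : set_system A) (FU : UltraFilter F) (r s : A -> R) :
  (forall y, jmax y <= r y) -> (forall y, jmax (- y) <= s y) ->
  exists (q : 'I_N -> A) (al be : 'I_N -> R) (k : R),
  [/\ osys q, forall i, (0 <= al i <= 1) /\ (0 <= be i <= 1) /\ al i * be i = k,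
      Acvg F (fun y => fc (fun t => expR (t - r y)) y) (\sum_i al i *: q i),
      Acvg F (fun y => fc (fun t => expR (- t - s y)) y) (\sum_i be i *: q i) &
      (fun y => expR (- (r y + s y))) @ F --> k].
Proof.
move=> hr hs; have FP : ProperFilter F := @ultra_proper _ _ FU.
have /choice[pl hpl] : forall y, exists pl : ('I_N -> A) * ('I_N -> R),
    [/\ osys pl.1, y = \sum_i pl.2 i *: pl.1 i & forall i, pl.2 i <= r y /\ - pl.2 i <= s y].
  move=> y; have [p [lam [op ey sl]]] := padded_spec y u0.
  exists (p, lam); split=> //= i; split.
    by apply: le_trans (hr y); apply: ub_le_sup; [case: (spectrum_sup y u0)|].
  apply: le_trans (hs y); apply: ub_le_sup; first by case: (spectrum_sup (- y) u0).
  by rewrite spectrumN; exists (lam i).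
have /choice[q hq] : forall i, exists q, Acvg F (fun y => (pl y).1 i) q.
  move=> i; apply: (@Acvg_bounded A F FU _ (jip u u)) => y.
  by have [[pp _ _] _ _] := hpl y; apply: idem_bound.
have /choice[al hal] : forall i : 'I_N, exists b : R,
    (fun y => expR ((pl y).2 i - r y)) @ F --> b /\ 0 <= b <= 1.
  move=> i; have [|b b01 hb] := @ultra_bounded A F FU (fun y => expR ((pl y).2 i - r y)) 0 1; last by exists b.
  apply: nearW => y; have [_ _ /(_ i)[h _]] := hpl y.
  by rewrite expR_ge0 /= -expR0 ler_expR subr_le0.
have /choice[be hbe] : forall i : 'I_N, exists b : R,
    (fun y => expR (- (pl y).2 i - s y)) @ F --> b /\ 0 <= b <= 1.
  move=> i; have [|b b01 hb] := @ultra_bounded A F FU (fun y => expR (- (pl y).2 i - s y)) 0 1; last by exists b.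
  apply: nearW => y; have [_ _ /(_ i)[_ h]] := hpl y.
  by rewrite expR_ge0 /= -expR0 ler_expR subr_le0.
have ck : exists2 k : R, 0 <= k <= 1 & (fun y => expR (- (r y + s y))) @ F --> k.
  apply: ultra_bounded; apply: nearW => y; rewrite expR_ge0 /= -expR0 ler_expR oppr_le0.
  have h : pos ((r y + s y) *: u).
    have h1 : pos (r y *: u - y) by apply/jmax_le.
    have h2 : pos (s y *: u - - y) by apply/jmax_le.
    by have := posD h1 h2; congr pos; vring.
  have := pos_ip pos1 h; rewrite jipZr pmulr_lge0 // pos_ip_gt0 //; exact: pos1.
have [k k01 ck'] := ck.
exists q, al, be, k; split=> //.
- split.
  + move=> i; apply: (Acvg_unique _ (hq i)); apply: Acvg_eq (Acvg_mul (hq i) (hq i)) => y.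
    by have [[pp _ _] _ _] := hpl y.
  + move=> i j ij; apply: (Acvg_unique (Acvg_mul (hq i) (hq j))).
    by apply: Acvg_eq (Acvg_cst (l := 0)) => y; have [[_ po _] _ _] := hpl y; rewrite po.
  + apply: (Acvg_unique (Acvg_sum (fun i _ => hq i))).
    by apply: Acvg_eq (Acvg_cst (l := u)) => y; have [[_ _ ps] _ _] := hpl y; rewrite ps.
- move=> i; split; first by case: (hal i).
  split; first by case: (hbe i).
  apply: (cvg_unique _ (cvgM (hal i).1 (hbe i).1) _) => //.
  rewrite (_ : _ \* _ = fun y => expR (- (r y + s y))) //.
  by apply/funext => y /=; rewrite -expRD; congr expR; ring.
- apply: Acvg_eq (Acvg_sum (fun i _ => AcvgZ (hal i).1 (hq i))) => y.
  by have [op ey _] := hpl y; rewrite (fc_exp_pair (r y) (s y) op ey).1.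
- apply: Acvg_eq (Acvg_sum (fun i _ => AcvgZ (hbe i).1 (hq i))) => y.
  by have [op ey _] := hpl y; rewrite (fc_exp_pair (r y) (s y) op ey).2.
Qed.

End LimitFunctions.

Local Notation lnA := (fc (@ln R)).
Local Notation invA := (fc (@GRing.inv R)).
Local Notation expA := (fc (@expR R)).

(** * Uniqueness and comparison of the limits *)

Section Rigidity.
Context (u0 : u != 0).

(** The positive part of x lies in A_1(P), so it is a state of the face unless it is 0; its pairing
    with x is its own squared norm. *)
Lemma face_pos_opp P x : P ** P = P -> P ** x = x ->
  (forall w, face P w -> jip w x <= 0) -> pos (- x).
Proof.
move=> PP Px h; pose f (t : R) := Num.max t 0; pose g (t : R) := Num.max (- t) 0.
have f0 : f 0 = 0 by rewrite /f maxxx.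
have fx : x = fc f x - fc g x.
  rewrite -{1}(fc_id x); have [r [p [lam [op ->]]]] := spectral x.
  rewrite !fcE // -sumrB; apply: eq_bigr => i _; rewrite -scalerBl; congr (_ *: _).
  rewrite /f /g; case: (leP (lam i) 0); case: (leP (- lam i) 0); rewrite /=; lra.
have fw : jip (fc f x) x = jip (fc f x) (fc f x).
  have [r [p [lam [op ->]]]] := spectral x; rewrite !fcE // !jip_osys //.
  apply: eq_bigr => i _; congr (_ * _); rewrite /f.
  by case: (leP (lam i) 0) => // _; rewrite !mul0r.
have f_eq0 : fc f x = 0.
  apply/eqP/negPn/negP => n0.
  have : face P (fc f x).
    split=> //; first by apply: fc_pos => t; rewrite /f le_max lexx orbT.
    have e : P ** fc f x = fc f x by apply: fc_peirce1.
    rewrite -e jip_mul jmulBr PP jmul1r subrr jip0r //.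
  move/h; rewrite fw => le0; have := jip_ge0 (fc f x) => ge0.
  by case/eqP: n0; apply: jip_eq0; apply/eqP; rewrite eq_le le0.
rewrite fx f_eq0 sub0r opprK; apply: fc_pos => t.
by rewrite /g le_max lexx orbT.
Qed.

Lemma face_eq0 P x : P ** P = P -> P ** x = x ->
  (forall w, face P w -> jip w x = 0) -> x = 0.
Proof.
move=> PP Px h; apply: pos_anti.
  rewrite -(opprK x); apply: (face_pos_opp PP); first by rewrite jmulNr Px.
  by move=> w fw; rewrite jipNr h // oppr0.
by apply: (face_pos_opp PP Px) => w fw; rewrite h.
Qed.

(* For an idempotent e: the face of x is contained in the face of e. *)
Definition subf x e := forall w, face (supp x) w -> jip w (u - e) = 0.

Lemma face_self P : P ** P = P -> P != 0 -> face P P.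
Proof.
by move=> PP P0; split=> //; [apply: pos_idem|rewrite jipBr -{1}PP jip_mul jmul1r subrr].
Qed.

Lemma subf_mul x e : e ** e = e -> subf x e -> e ** supp x = supp x.
Proof.
move=> ee h; have [->|s0] := eqVneq (supp x) 0; first by rewrite jmul0r.
have fs := face_self (supp_idem x) s0.
have := pos_ip0 (pos_idem (supp_idem x)) (idemC ee) (h _ fs).
by rewrite jmulBl jmul1 => /eqP; rewrite subr_eq0 => /eqP <-.
Qed.

Lemma face_trans x e w : e ** e = e -> e ** supp x = supp x -> face (supp x) w -> e ** w = w.
Proof.
move=> ee es fw; have sw := face_mul (supp_idem x) fw.
have s0 : (u - e) ** supp x = 0 by rewrite jmulBl jmul1 es subrr.
have := peirce10 (supp_idem x) sw (_ : supp x ** (u - e) = 0); rewrite jmulC => /(_ s0).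
by rewrite jmulC jmulBl jmul1 => /eqP; rewrite subr_eq0 => /eqP <-.
Qed.

Lemma subf_antisym x y : subf x (supp y) -> subf y (supp x) -> supp x = supp y.
Proof.
move=> /(subf_mul (supp_idem y)) h1 /(subf_mul (supp_idem x)) h2.
by rewrite -h1 jmulC h2.
Qed.

Lemma supp_lnA x : supp x ** lnA x = lnA x.
Proof. by rewrite /supp fcM; congr (fc _ x); apply/funext => t; case: eqP => [->|]; rewrite ?mul1r // ln0 // mul0r. Qed.
Lemma supp_invA x : supp x ** invA x = invA x.
Proof. by rewrite /supp fcM; congr (fc _ x); apply/funext => t; case: eqP => [->|]; rewrite ?mul1r // invr0 mul0r. Qed.
Lemma supp_self x : supp x ** x = x.
Proof.
rewrite -{2 3}(fc_id x) /supp fcM; congr (fc _ x).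
by apply/funext => t; case: eqP => [->|]; rewrite ?mul1r ?mul0r.
Qed.

(** The logarithm alone cannot tell the eigenvalues 0 and 1 apart; by [rec], logarithm and support
    together determine a positive element. *)
Lemma supp_lnA_inj x s y : pos x -> pos y -> supp x = supp y ->
  lnA y = lnA x + s *: supp x -> y = expR s *: x.
Proof.
have rec z : pos z -> z = fc expR (lnA z) - (u - supp z).
  case/pos_spec=> r [p [lam [op -> l0]]]; rewrite fc_comp /supp !fcE //.
  have -> : u = \sum_i 1 *: p i.
    by case: op => _ _ <-; apply: eq_bigr => i _; rewrite scale1r.
  rewrite -!sumrB; apply: eq_bigr => i _; rewrite -!scalerBl; congr (_ *: _) => /=.
  have [->|li] := eqVneq (lam i) 0; first by rewrite ln0 // expR0 mulr0n subr0 subrr.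
  by rewrite lnK ?posrE ?lt_neqAle 1?eq_sym ?li ?l0 //= subrr subr0.
move=> px py se le; rewrite (rec y py) -se le.
case/pos_spec: px => r [p [lam [op -> l0]]]; rewrite /supp !fcE // scaler_sumr.
have -> : \sum_i ln (lam i) *: p i + s *: \sum_i (lam i != 0)%:R *: p i =
    \sum_i (ln (lam i) + s * (lam i != 0)%:R) *: p i.
  by rewrite scaler_sumr -big_split; apply: eq_bigr => i _; rewrite scalerA scalerDl.
rewrite fcE // -{1}[u]scale1r (_ : 1 *: u = \sum_i 1 *: p i); last first.
  by rewrite -scaler_sumr; case: op => _ _ ->.
rewrite -!sumrB; apply: eq_bigr => i _; rewrite -!scalerBl scalerA; congr (_ *: _).
have [->|li] := eqVneq (lam i) 0; first by rewrite ln0 // mulr0n mulr0 addr0 expR0 subr0 subrr mulr0.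
by rewrite mulr1n mulr1 subrr subr0 addrC expRD lnK // posrE lt_neqAle eq_sym li l0.
Qed.

Lemma face_lnA_inj x s y : pos x -> pos y -> supp x = supp y ->
  (forall w, face (supp x) w -> jip w (lnA y) = jip w (lnA x) + s * jip w u) ->
  y = expR s *: x.
Proof.
move=> px py se h; apply: supp_lnA_inj => //; apply/eqP; rewrite -subr_eq0; apply/eqP.
apply: (face_eq0 (supp_idem x)).
  by rewrite jmulBr jmulDr jmulZr supp_idem supp_lnA se supp_lnA.
move=> w fw; rewrite jipBr jipDr jipZr h //.
by case: (fw) => _ _; rewrite jipBr => /eqP; rewrite subr_eq0 => /eqP ->; rewrite subrr.
Qed.

Lemma face_invA_inj x c y : 0 < c -> supp x = supp y ->
  (forall w, face (supp x) w -> jip w (invA y) = c^-1 * jip w (invA x)) -> y = c *: x.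
Proof.
move=> c0 se h; have e : invA y = c^-1 *: invA x.
  apply/eqP; rewrite -subr_eq0; apply/eqP; apply: (face_eq0 (supp_idem x)).
    by rewrite jmulBr jmulZr supp_invA se supp_invA.
  by move=> w fw; rewrite jipBr jipZr h // subrr.
have ii z : invA (invA z) = z.
  by rewrite fc_comp -[RHS]fc_id; congr (fc _ z); apply/funext => t /=; rewrite invrK.
rewrite -(ii y) e -fc_scale fc_comp -{2}(fc_id x) -fc_scale; congr (fc _ x).
by apply/funext => t /=; rewrite invfM !invrK.
Qed.

Lemma face_inj x y : supp x = supp y ->
  (forall w, face (supp x) w -> jip w y = jip w x) -> y = x.
Proof.
move=> se h; apply/eqP; rewrite -subr_eq0; apply/eqP; apply: (face_eq0 (supp_idem x)).
  by rewrite jmulBr supp_self {1}se supp_self.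
by move=> w fw; rewrite jipBr h // subrr.
Qed.

Lemma supp_scale c x : c != 0 -> supp (c *: x) = supp x.
Proof.
move=> c0; have [r [p [lam [op ->]]]] := spectral x.
rewrite scaler_sumr; under eq_bigr do rewrite scalerA.
by rewrite !supp_osys //; apply: eq_bigl => i; rewrite mulf_eq0 negb_or c0.
Qed.

Lemma bounded_line_eq0 (c K : R) : 0 <= c -> (forall t, 0 < t -> t * c <= K) -> c = 0.
Proof.
move=> c0 h; apply/eqP; rewrite eq_le c0 andbT leNgt; apply/negP => cp.
have := h ((`|K| + 1) / c) (_ : _); rewrite divr_gt0 ?ltr_wpDl // => /(_ isT).
by rewrite mulfVK ?gt_eqF //; have := ler_norm K; lra.
Qed.

Lemma idem_ip_ge0 w e : pos w -> e ** e = e -> 0 <= jip w e.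
Proof. by move=> pw ee; rewrite jipC pos_ip_idem. Qed.

Lemma EN_shift a z s : EN a (z + s *: u) = expR (- s) * EN a z.
Proof.
have le a' z' s' : EN a' (z' + s' *: u) <= expR (- s') * EN a' z'.
  have [[w fw]|no] := pselect (exists w, face (supp a') w); last first.
    by rewrite !EN_noface ?mulr0.
  apply: ge_sup; first by eexists; exists w.
  move=> _ [v fv <-]; rewrite -ler_pdivrMl ?expR_gt0 // -expRN -expRD.
  apply: le_trans (EN_ge u0 z' fv); rewrite ler_expR; have h := face_gt0 fv.
  rewrite -(ler_pM2r h) mulrDl !divfK ?gt_eqF // !(jipNr, jipDr, jipZr); lra.
apply/eqP; rewrite eq_le le /=; have := le a (z + s *: u) (- s).
rewrite scaleNr addrK opprK => h.
by rewrite -(ler_pM2l (expR_gt0 s)) mulrA -expRD subrr expR0 mul1r.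
Qed.

Lemma EN_gt0 a z : a != 0 -> 0 < EN a z.
Proof.
move=> a0; have s0 : supp a != 0.
  by apply: contra_neq a0 => h; rewrite -(supp_self a) h jmul0.
exact: lt_le_trans (expR_gt0 _) (EN_ge u0 z (face_self (supp_idem a) s0)).
Qed.

(** Test points lnA x + t (u - supp x): the states of x do not see the second term, so [EN x] is at
    most 1 there for every t. Letting t tend to minus infinity compares the faces, and t = 0
    compares the logarithms. *)
Lemma EN_inj a a' : pos a -> pos a' -> (forall z, EN a z = EN a' z) -> a = a'.
Proof.
have half x y : (forall z, EN x z = EN y z) ->
    subf y (supp x) /\ (forall w, face (supp y) w -> jip w (lnA y) <= jip w (lnA x)).
  move=> h; have key t w : face (supp y) w ->
      jip w (lnA y) - jip w (lnA x) - t * jip w (u - supp x) <= 0.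
    set d := u - supp x => fw; have le : EN x (lnA x + t *: d) <= expR 0.
      apply: EN_le => // v [_ _ hv].
      have -> : lnA x - (lnA x + t *: d) = (- t) *: d by vring.
      by rewrite jipZr hv mulr0 mul0r.
    have := EN_ge u0 (lnA x + t *: d) fw; rewrite -h => /le_trans /(_ le).
    rewrite ler_expR ler_pdivrMr ?(face_gt0 fw) // mul0r.
    have -> : lnA y - (lnA x + t *: d) = lnA y - lnA x - t *: d by vring.
    by rewrite (jipBr _ (t *: d)) jipBr jipZr.
  split=> w fw; last first.
    by have := key 0 w fw; rewrite mul0r subr0 subr_le0.
  apply: (@bounded_line_eq0 _ (jip w (lnA x) - jip w (lnA y))).
    by apply: idem_ip_ge0 (idemC (supp_idem x)); case: fw.
  by move=> t t0; have := key (- t) w fw; lra.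
move=> pa pa' h; have [s1 l1] := half _ _ h; have [s2 l2] := half _ _ (fun z => esym (h z)).
have se := subf_antisym s2 s1.
rewrite -[LHS]scale1r -(expR0 R); apply/esym/face_lnA_inj => // w fw.
by rewrite mul0r addr0; apply/eqP; rewrite eq_le l2 // andbT l1 // -se.
Qed.

Lemma pos_limit x : (forall e, 0 < e -> pos (x + e *: u)) -> pos x.
Proof.
move=> h; apply: pos_dual => p pp; rewrite leNgt; apply/negP => neg.
have pu := pos_ip pos1 (pos_idem pp); have [e0|e0] := eqVneq (jip u p) 0.
  by have := pos_ip_idem (h 1 ltr01) pp; rewrite jipDr jipZr (jipC p u) e0; lra.
have ep : 0 < jip u p by rewrite lt_neqAle eq_sym e0.
have := pos_ip_idem (h (- jip p x / 2 / jip u p) _) pp.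
rewrite !divr_gt0 ?oppr_gt0 // => /(_ isT).
by rewrite jipDr jipZr (jipC p u) divfK //; lra.
Qed.

Lemma int_add x e : pos x -> 0 < e -> cone_int mul u (x + e *: u).
Proof. by move=> px e0; apply/cone_intP => //; exists e => //; rewrite addrK. Qed.

(** At the test point z = x + e u one has x <= z, hence y <= x + e u for every e > 0. *)
Lemma Mfun_inj a a' : pos a -> pos a' ->
  (forall z, cone_int mul u z -> Mfun mul a z = Mfun mul a' z) -> a = a'.
Proof.
have half x y : pos x -> (forall z, cone_int mul u z -> Mfun mul x z = Mfun mul y z) -> pos (x - y).
  move=> px h; apply: pos_limit => e e0; have iz := int_add px e0.
  have : Mfun mul x (x + e *: u) <= 1.
    apply/Mfun_le => //; rewrite scale1r addrC addKr; exact: posZ (ltW e0) pos1.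
  by rewrite h // => /(Mfun_le u0 _ _ iz); congr pos; vring.
move=> pa pa' h; apply/eqP; rewrite -subr_eq0; apply/eqP; apply: pos_anti.
  exact: half.
by rewrite opprB; apply: half => // z iz; rewrite h.
Qed.

Lemma Mfun_scale a c z : 0 < c -> cone_int mul u z -> Mfun mul a (c *: z) = c^-1 * Mfun mul a z.
Proof.
move=> c0 iz; have icz : cone_int mul u (c *: z).
  have /(cone_intP _ u0)[e e0 h] := iz; apply/cone_intP => //; exists (c * e).
    by rewrite mulr_gt0.
  by rewrite -scalerA -scalerBr; apply: posZ => //; apply: ltW.
apply/eqP; rewrite eq_le; apply/andP; split.
  apply/(Mfun_le u0 _ _ icz); rewrite scalerA mulrAC mulVf ?gt_eqF // mul1r.
  exact/Mfun_le.
rewrite mulrC ler_pdivrMr //; apply/(Mfun_le u0 _ _ iz); rewrite -scalerA; exact/Mfun_le.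
Qed.

Lemma int_scale c z : 0 < c -> cone_int mul u z -> cone_int mul u (c *: z).
Proof.
move=> c0 /(cone_intP _ u0)[e e0 h]; apply/cone_intP => //; exists (c * e).
  by rewrite mulr_gt0.
by rewrite -scalerA -scalerBr; apply: posZ => //; apply: ltW.
Qed.

Lemma KN_scale b c z : 0 < c -> pos b -> pos z -> KN b (c *: z) = c * KN b z.
Proof.
have le c' z' : 0 < c' -> pos b -> pos z' -> KN b (c' *: z') <= c' * KN b z'.
  move=> c0 pb pz; apply: KN_le => // [|w fw].
    by rewrite mulr_ge0 ?KN_ge0 // ltW.
  rewrite jipZr -mulrA ler_pM2l // -ler_pdivrMr ?inv_face_pos //; exact: KN_ge.
move=> c0 pb pz; apply/eqP; rewrite eq_le le //=.
rewrite mulrC -ler_pdivlMr // mulrC -{1}(scale1r z) -(mulVf (_ : c != 0)) ?gt_eqF // -scalerA.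
by apply: le; rewrite ?invr_gt0 //; apply: posZ => //; apply: ltW.
Qed.

(** Test points invA x + t (u - supp x) with t > 0, interior because t fills the kernel. The states
    of x see only invA x, so [KN x] is at most 1; large t compares the faces, t = 1 the inverses. *)
Lemma KN_inj b b' : pos b -> pos b' ->
  (forall z, cone_int mul u z -> KN b z = KN b' z) -> b = b'.
Proof.
have half x y : pos x -> pos y -> (forall z, cone_int mul u z -> KN x z = KN y z) ->
    subf y (supp x) /\ (forall w, face (supp y) w -> jip w (invA x) <= jip w (invA y)).
  move=> px py h; have key t w : 0 < t -> face (supp y) w ->
      jip w (invA x) + t * jip w (u - supp x) <= jip w (invA y).
    move=> t0 fw; set z := invA x + t *: (u - supp x).
    have iz : cone_int mul u z.
      case/pos_spec: (px) => r [p [lam [op xE l0]]].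
      have zE : z = fc (fun s => if s == 0 then t else s^-1) x.
        rewrite /z xE /supp !fcE // -[u]scale1r (_ : 1 *: u = \sum_i 1 *: p i); last first.
          by rewrite -scaler_sumr; case: op => _ _ ->.
        rewrite -sumrB scaler_sumr -big_split; apply: eq_bigr => i _ /=.
        rewrite -scalerBl scalerA -scalerDl; congr (_ *: _).
        by case: eqP => [->|_] /=; rewrite ?invr0 ?subr0 ?mulr1 ?add0r // subrr mulr0 addr0.
      apply/(cone_int_exp _ u0); rewrite zE xE !fcE //; apply: eq_bigr => i _; congr (_ *: _).
      case: eqP => [_|/eqP li]; rewrite lnK ?posrE //.
      by rewrite invr_gt0 lt_neqAle eq_sym li l0.
    have le : KN x z <= 1.
      apply: KN_le => // v [_ _ hv]; rewrite /z jipDr jipZr hv; lra.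
    have := KN_ge u0 z py fw; rewrite -h // => /le_trans /(_ le).
    by rewrite ler_pdivrMr ?inv_face_pos // mul1r /z (jipDr (invA x)) jipZr.
  have ge0 w : face (supp y) w -> 0 <= jip w (u - supp x).
    by move=> [pw _ _]; apply: idem_ip_ge0 (idemC (supp_idem x)).
  split=> w fw; last first.
    by apply: le_trans (key 1 w ltr01 fw); rewrite mul1r lerDl ge0.
  apply: (@bounded_line_eq0 _ (jip w (invA y) - jip w (invA x))); first exact: ge0.
  by move=> t t0; have := key t w t0 fw; lra.
move=> pb pb' h; have [s1 l1] := half _ _ pb pb' h.
have [s2 l2] := half _ _ pb' pb (fun z iz => esym (h z iz)).
have se := subf_antisym s2 s1.
rewrite -[LHS]scale1r; apply/esym/face_invA_inj; rewrite ?invr1 ?ltr01 // => w fw.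
by rewrite mul1r; apply/eqP; rewrite eq_le l2 // l1 // -se.
Qed.

End Rigidity.

(** * Supports from decay rates, comparison for equal supports, rigidity of products *)

Section Comparison.
Context (u0 : u != 0).

Lemma subf_of_mul x e : e ** e = e -> e ** supp x = supp x -> subf x e.
Proof.
move=> ee es w fw; rewrite -(face_trans ee es fw) jip_mul jmulBr ee jmul1r subrr.
exact: jip0r.
Qed.

Lemma pos_supp_mul x e : pos x -> e ** e = e -> e ** supp x = supp x -> e ** x = x.
Proof.
move=> px ee es; have [->|x0] := eqVneq x 0; first by rewrite jmul0r.
apply: (face_trans ee es); split=> //.
by rewrite -{1}(supp_self x) jipC -jip_assoc jmulBl jmul1 supp_idem subrr jip0l.
Qed.

(* This is exp (t (2 e - u)) for an idempotent e. *)
Definition zz e t : A := expR t *: e + expR (- t) *: (u - e).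

Lemma zz_int e t : e ** e = e -> cone_int mul u (zz e t).
Proof.
move=> ee; apply/cone_intP => //; exists (expR (- `|t|)); first exact: expR_gt0.
have -> : zz e t - expR (- `|t|) *: u =
    (expR t - expR (- `|t|)) *: e + (expR (- t) - expR (- `|t|)) *: (u - e).
  by rewrite /zz; vring.
apply: posD; apply: posZ; rewrite ?subr_ge0 ?ler_expR.
- by rewrite lerNl ler_normr lexx orbT.
- exact: pos_idem.
- by rewrite lerN2 ler_norm.
- exact: pos_idem (idemC ee).
Qed.

Lemma EN_le_gen a z s : 0 <= s ->
  (forall w, face (supp a) w -> expR (jip w (lnA a - z) / jip w u) <= s) -> EN a z <= s.
Proof.
move=> s0 h; have [[w fw]|no] := pselect (exists w, face (supp a) w); last by rewrite EN_noface.
apply: ge_sup; first by eexists; exists w.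
by move=> _ [v fv <-]; apply: h.
Qed.

#[local] Opaque EN KN jmax fc jip Mfun.

(** On states supported in e the direction t (2 e - u) takes the value t, whence the decay exp (-
    t). A state with mass on u - e decays more slowly, which gives the converse [EN_small_inv]. [M]
    and [KN] are treated likewise along [zz]. *)
Lemma EN_small x e : e ** e = e -> subf x e ->
  exists2 C, 0 < C & forall t, EN x (t *: (2 *: e - u)) <= C * expR (- t).
Proof.
move=> ee xe; exists (expR (jmax (lnA x))); first exact: expR_gt0.
move=> t; rewrite -expRD; apply: EN_le => // w fw.
have h := xe w fw; rewrite jipBr in h.
have e1 : jip w e = jip w u by lra.
have := jip_jmax u0 (lnA x) (face_pos fw).
rewrite jipBr jipZr jipBr jipZr e1; lra.
Qed.

Lemma EN_small_inv x e C : e ** e = e ->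
  (forall t, 0 < t -> EN x (t *: (2 *: e - u)) <= C * expR (- t)) -> subf x e.
Proof.
move=> ee h w fw; have wu := face_gt0 fw; have pw := face_pos fw.
have C0 : 0 < C.
  have := lt_le_trans (expR_gt0 _) (le_trans (EN_ge u0 _ fw) (h 1 ltr01)).
  by rewrite pmulr_lgt0 // expR_gt0.
apply: (bounded_line_eq0 (K := (`|ln C * jip w u - jip w (lnA x)|))).
  exact: idem_ip_ge0 pw (idemC ee).
move=> t t0; have := le_trans (EN_ge u0 _ fw) (h t t0).
rewrite -{1}(lnK (_ : C \in Num.pos)) ?posrE // -expRD ler_expR ler_pdivrMr //.
have h1 := ler_norm (ln C * jip w u - jip w (lnA x)).
have h2 : 0 <= jip w (u - e) by apply: idem_ip_ge0 pw (idemC ee).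
have h3 : 0 <= t * jip w (u - e) by rewrite mulr_ge0 // ltW.
move: h2 h3; rewrite !(jipBr _ (lnA x) w, jipBr, jipZr) => h2 h3 h4.
by nra.
Qed.

Lemma le_scale_idem a e : pos a -> e ** e = e -> e ** a = a ->
  exists2 C, 0 < C & pos (C *: e - a).
Proof.
move=> pa ee ea; exists (`|jmax a| + 1); first by rewrite ltr_wpDl.
have h : pos ((`|jmax a| + 1) *: u - a).
  by apply/jmax_le => //; rewrite (le_trans (ler_norm _)) // lerDl.
have := jU_pos ee h; congr pos.
rewrite /jU !(jmulBr, jmulZr, jmul1r, ee, ea); vring.
Qed.

Lemma Mfun_small a e : pos a -> e ** e = e -> subf a e ->
  exists2 C, 0 < C & forall t, Mfun mul a (zz e t) <= C * expR (- t).
Proof.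
move=> pa ee ae; have ea := pos_supp_mul pa ee (subf_mul ee ae).
have [C C0 hC] := le_scale_idem pa ee ea; exists C => // t.
apply/(Mfun_le u0 _ _ (zz_int t ee)).
have -> : (C * expR (- t)) *: zz e t - a =
   (C *: e - a) + (C * expR (- t) * expR (- t)) *: (u - e).
  have E : expR (- t) * expR t = 1 by rewrite -expRD addNr expR0.
  have -> : C *: e - a = (C * (expR (- t) * expR t)) *: e - a by rewrite E mulr1.
  by rewrite /zz; vring.
apply: posD => //; apply: posZ (pos_idem (idemC ee)).
by rewrite !mulr_ge0 ?expR_ge0 // ltW.
Qed.

Lemma exp_decay_eq0 (c K : R) : 0 <= c -> (forall t, 0 < t -> c <= K * expR (- t) * expR (- t)) -> c = 0.
Proof.
move=> c0 h; apply: (bounded_line_eq0 (K := `|K|)) => // t t0.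
have h1 := h t t0; have h2 : t <= expR t by have := expR_ge1Dx t; lra.
have h3 : 1 <= expR t by rewrite -expR0 ler_expR ltW.
have E : expR (- t) * expR t = 1 by rewrite -expRD addNr expR0.
have h4 := ler_norm K; have h5 := expR_gt0 (- t).
have h6 : c * (expR t * expR t) <= `|K|.
  apply: (@le_trans _ _ (K * expR (- t) * expR (- t) * (expR t * expR t))).
    by rewrite ler_wpM2r // mulr_ge0 // expR_ge0.
  have -> : K * expR (- t) * expR (- t) * (expR t * expR t) =
     K * (expR (- t) * expR t) * (expR (- t) * expR t) by ring.
  by rewrite E !mulr1.
apply: le_trans h6; rewrite mulrC ler_wpM2l //.
by rewrite (le_trans h2) // ler_peMr // expR_ge0.
Qed.

(** Pairing a <= M z with u - e, on which [zz e t] is exp (- t), gives <a, u - e> = O(exp (- 2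
    t)). *)
Lemma Mfun_small_inv a e C : pos a -> e ** e = e ->
  (forall t, 0 < t -> Mfun mul a (zz e t) <= C * expR (- t)) -> subf a e.
Proof.
move=> pa ee h; apply: (subf_of_mul ee).
have a0 : jip a (u - e) = 0.
  apply: (@exp_decay_eq0 _ (C * jip u (u - e))); first exact: idem_ip_ge0 pa (idemC ee).
  move=> t t0; have /(Mfun_le u0 _ _ (zz_int t ee)) := h t t0.
  move/pos_ip => /(_ _ (pos_idem (idemC ee))); rewrite jipBl subr_ge0 => /le_trans; apply.
  have -> : jip ((C * expR (- t)) *: zz e t) (u - e) = C * expR (- t) * expR (- t) * jip (u - e) (u - e).
    have e0 : jip e (u - e) = 0 by rewrite -{1}ee jip_mul jmulBr ee jmul1r subrr jip0r.
    by rewrite jipZl /zz (jipDl (_ *: e)) !jipZl e0 mulr0 add0r mulrA.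
  have -> : jip u (u - e) = jip (u - e) (u - e).
    by rewrite -[in LHS](idemC ee) -jip_assoc jmul1.
  by rewrite le_eqVlt; apply/orP; left; apply/eqP; ring.
have h0 := pos_ip0 pa (idemC ee) a0.
apply: fc_peirce1 => //; last by rewrite eqxx.
by move: h0; rewrite jmulBl jmul1 => /eqP; rewrite subr_eq0 => /eqP <-.
Qed.

Lemma jip_zzC e t w : jip w (u - e) = 0 -> jip w (zz (u - e) t) = expR (- t) * jip w u.
Proof.
move=> h; rewrite /zz jipDr !jipZr h mulr0 add0r; congr (_ * _).
by rewrite jipBr h subr0.
Qed.

(** [KN] grows with z, so the direction is reversed: [zz (u - e) t] is exp (- t) on states supported
    in e. *)
Lemma KN_small b e : pos b -> e ** e = e -> subf b e ->
  exists2 C, 0 < C & forall t, KN b (zz (u - e) t) <= C * expR (- t).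
Proof.
move=> pb ee be; have [c c0 h] := inv_face_gt0 pb; exists c^-1; first by rewrite invr_gt0.
move=> t; apply: KN_le => //; first by rewrite mulr_ge0 ?expR_ge0 // invr_ge0 ltW.
move=> w fw; rewrite (jip_zzC t (be w fw)) mulrAC mulrC ler_wpM2r ?expR_ge0 //.
by rewrite mulrC ler_pdivlMr // mulrC h.
Qed.

Lemma KN_small_inv b e C : pos b -> e ** e = e ->
  (forall t, 0 < t -> KN b (zz (u - e) t) <= C * expR (- t)) -> subf b e.
Proof.
move=> pb ee h w fw; have pw := face_pos fw; have wi := inv_face_pos pb fw.
apply: (@exp_decay_eq0 _ (C * jip w (invA b))); first exact: idem_ip_ge0 pw (idemC ee).
move=> t t0; have := le_trans (KN_ge u0 _ pb fw) (h t t0); rewrite ler_pdivrMr //.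
have E : expR t * expR (- t) = 1 by rewrite -expRD subrr expR0.
have h1 : expR t * jip w (u - e) <= jip w (zz (u - e) t).
  rewrite /zz (jipDr (expR t *: _)) !jipZr lerDl mulr_ge0 ?expR_ge0 //.
  by apply: idem_ip_ge0 pw _; apply: idemC; apply: idemC.
move/(le_trans h1) => h2; rewrite -[leLHS]mul1r -E mulrAC.
have := ler_wpM2r (expR_ge0 (- t)) h2; rewrite mulrAC => /le_trans; apply.
by rewrite le_eqVlt; apply/orP; left; apply/eqP; ring.
Qed.

Lemma supp_neq0 a : a != 0 -> supp a != 0.
Proof. by apply: contra_neq => h; rewrite -(supp_self a) h jmul0. Qed.

(** These lower bounds serve the product in part (b): knowing that one factor is not smaller than
    exp (- t) up to a constant, a bound on the product bounds the other factor. *)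
Lemma EN_lower a : a != 0 -> exists2 c, 0 < c &
  forall t z, pos (t *: u - z) -> c * expR (- t) <= EN a z.
Proof.
move=> a0; have fs := face_self (supp_idem a) (supp_neq0 a0); have su := face_gt0 fs.
exists (expR (jip (supp a) (lnA a) / jip (supp a) u)); first exact: expR_gt0.
move=> t z h; apply: le_trans (EN_ge u0 z fs); rewrite -expRD ler_expR.
rewrite -(ler_pM2r su) mulrDl !divfK ?gt_eqF //.
by have := pos_ip (face_pos fs) h; rewrite !(jipBr, jipZr); lra.
Qed.

Lemma Mfun_lower a : pos a -> a != 0 -> exists2 c, 0 < c &
  forall t z, cone_int mul u z -> pos (expR t *: u - z) -> c * expR (- t) <= Mfun mul a z.
Proof.
move=> pa a0; have au := pos_ip_gt0 pa a0; have uu := pos_ip_gt0 pos1 u0.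
exists (jip a u / jip u u); first by rewrite divr_gt0.
move=> t z iz h; have /(Mfun_le u0 _ _ iz) hM := lexx (Mfun mul a z).
have m0 := Mfun_ge0 u0 pa iz; have h1 := pos_ip pos1 hM; have h2 := pos_ip pos1 h.
rewrite expRN ler_pdivrMr ?expR_gt0 // ler_pdivrMr //.
move: h1 h2; rewrite !(jipBr, jipZr) !subr_ge0 (jipC a u) => h1 h2.
by apply: (le_trans h1); rewrite -mulrA ler_wpM2l.
Qed.

Lemma KN_lower b : pos b -> b != 0 -> exists2 c, 0 < c &
  forall t z, pos (z - expR (- t) *: u) -> c * expR (- t) <= KN b z.
Proof.
move=> pb b0; have fs := face_self (supp_idem b) (supp_neq0 b0); have su := face_gt0 fs.
have iu := inv_face_pos pb fs.
exists (jip (supp b) u / jip (supp b) (invA b)); first by rewrite divr_gt0.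
move=> t z h; apply: le_trans (KN_ge u0 z pb fs); rewrite mulrAC ler_pM2r ?invr_gt0 //.
by have := pos_ip (face_pos fs) h; rewrite !(jipBr, jipZr) subr_ge0 mulrC.
Qed.

Lemma EN_comp a a' : supp a = supp a' ->
  exists2 C, 0 < C & forall z, EN a z <= C * EN a' z.
Proof.
move=> se; exists (expR (jmax (lnA a - lnA a'))); first exact: expR_gt0.
move=> z; apply: EN_le_gen; first by rewrite mulr_ge0 ?expR_ge0 ?EN_ge0.
move=> w fw; have fw' := fw; rewrite se in fw'; have wu := face_gt0 fw.
apply: le_trans (_ : _ <= expR (jmax (lnA a - lnA a')) * expR (jip w (lnA a' - z) / jip w u)) _.
  rewrite -expRD ler_expR -(ler_pM2r wu) mulrDl !divfK ?gt_eqF //.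
  by have := jip_jmax u0 (lnA a - lnA a') (face_pos fw); rewrite !(jipBr _ _ w); lra.
by rewrite ler_wpM2l ?expR_ge0 // EN_ge.
Qed.

Lemma supp_le a : pos a -> exists2 C, 0 < C & pos (C *: a - supp a).
Proof.
case/pos_spec=> r [p [lam [op -> l0]]]; pose C := 1 + \sum_i (lam i)^-1.
have S0 : 0 <= \sum_i (lam i)^-1 by apply: sumr_ge0 => i _; rewrite invr_ge0.
exists C; first by rewrite ltr_pwDl.
rewrite /supp fcE // scaler_sumr -sumrB.
under eq_bigr do rewrite scalerA -scalerBl; apply: pos_sum => // i.
have [->|li] := eqVneq (lam i) 0; first by rewrite mulr0 subrr.
have lp : 0 < lam i by rewrite lt_neqAle eq_sym li l0.
rewrite subr_ge0 -ler_pdivrMr // div1r /C (bigD1 i) //= addrCA lerDl addr_ge0 //.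
by apply: sumr_ge0 => j _; rewrite invr_ge0.
Qed.

Lemma Mfun_comp a a' : pos a -> pos a' -> supp a = supp a' ->
  exists2 C, 0 < C & forall z, cone_int mul u z -> Mfun mul a z <= C * Mfun mul a' z.
Proof.
move=> pa pa' se; have [C C0 hC] := le_scale_idem pa (supp_idem a) (supp_self a).
have [D D0 hD] := supp_le pa'; exists (C * D); first by rewrite mulr_gt0.
move=> z iz; apply/(Mfun_le u0 _ _ iz).
have /(Mfun_le u0 _ _ iz) hM := lexx (Mfun mul a' z).
have := posD hC (posD (posZ (ltW C0) hD) (posZ (ltW (mulr_gt0 C0 D0)) hM)).
by congr pos; rewrite se; vring.
Qed.

Lemma KN_comp b b' : pos b -> pos b' -> supp b = supp b' ->
  exists2 C, 0 < C & forall z, pos z -> KN b z <= C * KN b' z.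
Proof.
move=> pb pb' se; have [c c0 hc] := inv_face_gt0 pb.
have D0 : 0 < `|jmax (invA b')| + 1 by rewrite ltr_wpDl.
exists ((`|jmax (invA b')| + 1) / c); first by rewrite divr_gt0.
move=> z pz; have K0 := KN_ge0 u0 pb' pz.
apply: KN_le => // [|w fw]; first by rewrite !mulr_ge0 ?invr_ge0 // ltW.
have fw' := fw; rewrite se in fw'; have wu := face_gt0 fw.
have := KN_ge u0 z pb' fw'; rewrite ler_pdivrMr ?inv_face_pos // => /le_trans; apply.
rewrite mulrAC (mulrC _ (KN b' z)) -mulrA ler_wpM2l //.
apply: (le_trans (jip_jmax u0 (invA b') (face_pos fw))).
apply: (@le_trans _ _ ((`|jmax (invA b')| + 1) * jip w u)).
  by rewrite ler_wpM2r ?(ltW wu) // (le_trans (ler_norm _)) // lerDl.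
by rewrite ler_wpM2l ?(ltW D0) // mulrC ler_pdivlMr // mulrC hc.
Qed.

Lemma jmax_scale c x : 0 < c -> jmax (c *: x) = c * jmax x.
Proof.
have le d y : 0 < d -> jmax (d *: y) <= d * jmax y.
  move=> d0; apply/jmax_le => //; rewrite -scalerA -scalerBr; apply: posZ; first exact: ltW.
  exact/jmax_le.
move=> c0; apply/eqP; rewrite eq_le le //=.
rewrite mulrC -ler_pdivlMr // mulrC -{1}(scale1r x) -(mulVf (_ : c != 0)) ?gt_eqF // -scalerA.
by apply: le; rewrite invr_gt0.
Qed.

Lemma scale_normalized c x y : 0 < c -> y = c *: x -> jmax x = 1 -> jmax y = 1 -> y = x.
Proof.
move=> c0 yE x1; rewrite yE jmax_scale // x1 mulr1 => ->.
by rewrite scale1r.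
Qed.

Lemma normalized_neq0 x : jmax x = 1 -> x != 0.
Proof.
apply: contra_eq_neq => ->; have : jmax (0 : A) <= 0.
  by apply/jmax_le => //; rewrite scale0r subrr; apply: pos0.
by move=> h; rewrite lt_eqF // (le_lt_trans h).
Qed.

(** At z0 every state of a gives the value 1 and every state of b the value exp c0, hence the upper
    bound. The lower bound evaluates the other pair at the same point, using a single state of each
    face. *)
Lemma EN_product_half a b a' b' z0 c0 z1 c1 :
  supp a = supp a' -> supp b = supp b' ->
  (forall w, face (supp a) w -> jip w (lnA a) = jip w z0) ->
  (forall w, face (supp a) w -> jip w (lnA a') = jip w z1) ->
  (forall w, face (supp b) w -> jip w (lnA b) + jip w z0 = c0 * jip w u) ->
  (forall w, face (supp b) w -> jip w (lnA b') + jip w z1 = c1 * jip w u) ->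
  EN a z0 * EN b (- z0) <= expR c0 /\
  forall w v, face (supp a) w -> face (supp b) v ->
    expR (jip w (z1 - z0) / jip w u - jip v (z1 - z0) / jip v u + c1) <=
    EN a' z0 * EN b' (- z0).
Proof.
move=> sa sb ha ha' hb hb'; split.
  have l1 : EN a z0 <= expR 0.
    by apply: EN_le => // w' fw'; rewrite jipBr ha // subrr mul0r.
  have l2 : EN b (- z0) <= expR c0.
    by apply: EN_le => // w' fw'; rewrite opprK jipDr hb.
  rewrite -[expR c0]mul1r -[X in _ <= X * _](expR0 R).
  by apply: ler_pM; rewrite ?EN_ge0.
move=> w v fw fv; have wu := face_gt0 fw; have vu := face_gt0 fv.
rewrite -addrA (addrC (- _)) expRD; apply: ler_pM; rewrite ?expR_ge0 //.
  have e : jip w (lnA a' - z0) = jip w (z1 - z0) by rewrite !(jipBr _ z0) ha'.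
  by rewrite -e; apply: EN_ge => //; rewrite -sa.
have e : jip v (lnA b' - - z0) / jip v u = c1 - jip v (z1 - z0) / jip v u.
  apply: (mulIf (_ : jip v u != 0)); rewrite ?gt_eqF // mulrBl !divfK ?gt_eqF //.
  by have := hb' v fv; rewrite opprK jipDr jipBr; lra.
by rewrite -e; apply: EN_ge => //; rewrite -sb.
Qed.

(* Adding the two equations, the values of <w, z1 - z0>/<w, u> on the faces of
   a and of b are constant, so a' and b' are multiples of a and b. *)
Lemma EN_product_rigid a b a' b' z0 c0 z1 c1 :
  pos a -> pos b -> pos a' -> pos b' ->
  jmax a = 1 -> jmax b = 1 -> jmax a' = 1 -> jmax b' = 1 ->
  supp a = supp a' -> supp b = supp b' ->
  (forall w, face (supp a) w -> jip w (lnA a) = jip w z0) ->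
  (forall w, face (supp a) w -> jip w (lnA a') = jip w z1) ->
  (forall w, face (supp b) w -> jip w (lnA b) + jip w z0 = c0 * jip w u) ->
  (forall w, face (supp b) w -> jip w (lnA b') + jip w z1 = c1 * jip w u) ->
  EN a z0 * EN b (- z0) = EN a' z0 * EN b' (- z0) ->
  EN a z1 * EN b (- z1) = EN a' z1 * EN b' (- z1) -> a = a' /\ b = b'.
Proof.
move=> pa pb pa' pb' na nb na' nb' sa sb ha ha' hb hb'.
have [le0 ge0] := EN_product_half sa sb ha ha' hb hb'.
have [le1 ge1] := EN_product_half (esym sa) (esym sb)
  (fun w fw => ha' w (eq_ind_r (fun P => face P w) fw sa))
  (fun w fw => ha w (eq_ind_r (fun P => face P w) fw sa))
  (fun w fw => hb' w (eq_ind_r (fun P => face P w) fw sb))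
  (fun w fw => hb w (eq_ind_r (fun P => face P w) fw sb)).
rewrite -sa -sb in ge1.
have [del delD] : exists del : A -> R, forall w, del w = jip w (z1 - z0) / jip w u.
  by exists (fun w => jip w (z1 - z0) / jip w u).
move=> e0; have {e0 le0 ge0} key0 : forall w v, face (supp a) w -> face (supp b) v ->
    del w - del v + c1 <= c0.
  move=> w v fw fv; rewrite -ler_expR !delD; apply: le_trans (ge0 w v fw fv) _.
  rewrite -e0; exact: le0.
move=> e1; have {e1 le1 ge1} key1 : forall w v, face (supp a) w -> face (supp b) v ->
    - del w + del v + c0 <= c1.
  move=> w v fw fv; rewrite -ler_expR; apply: le_trans le1; rewrite -e1.
  apply: le_trans (ge1 w v fw fv); rewrite !delD -(opprB z0 z1) !(jipNr (z0 - z1)) !mulNr !opprK.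
  exact: lexx.
have delE w : face (supp a) w \/ face (supp b) w -> jip w z1 = jip w z0 + del w * jip w u.
  move=> h; have wu : 0 < jip w u by case: h => /face_gt0.
  by rewrite delD divfK ?gt_eqF // jipBr addrC subrK.
have fa := face_self (supp_idem a) (supp_neq0 (normalized_neq0 na)).
have fb := face_self (supp_idem b) (supp_neq0 (normalized_neq0 nb)).
have ca w : face (supp a) w -> del w = del (supp a).
  move=> fw; apply/eqP; rewrite eq_le.
  have := key0 w _ fw fb; have := key1 w _ fw fb; have := key0 _ _ fa fb; have := key1 _ _ fa fb.
  by move=> *; apply/andP; split; lra.
have cb w : face (supp b) w -> del w = del (supp b).
  move=> fw; apply/eqP; rewrite eq_le.
  have := key0 _ w fa fw; have := key1 _ w fa fw; have := key0 _ _ fa fb; have := key1 _ _ fa fb.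
  by move=> *; apply/andP; split; lra.
split; apply/esym.
  apply: (@scale_normalized (expR (del (supp a)))) => //; first exact: expR_gt0.
  apply: face_lnA_inj => // w fw; rewrite ha // ha' // delE ?ca //; by left.
apply: (@scale_normalized (expR (c1 - c0 - del (supp b)))) => //; first exact: expR_gt0.
apply: face_lnA_inj => // w fw; have := hb w fw; have := hb' w fw.
by rewrite delE ?cb //; [lra|right].
Qed.

(** Compare each pair at the other's point: m m' >= 1 and k k' >= c0 c1, while the two equalities
    give m k <= c0 and m' k' <= c1. So equality holds throughout, a' and b' are multiples of a and
    b, and the normalization removes the scalars. *)
Lemma KN_product_rigid a b a' b' z0 c0 z1 c1 :
  pos a -> pos b -> pos a' -> pos b' ->
  jmax a = 1 -> jmax b = 1 -> jmax a' = 1 -> jmax b' = 1 ->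
  supp a = supp a' -> supp b = supp b' ->
  cone_int mul u z0 -> cone_int mul u z1 -> 0 < c0 -> 0 < c1 ->
  pos (z0 - a) -> pos (z1 - a') ->
  (forall w, face (supp a) w -> jip w z0 = jip w a) ->
  (forall w, face (supp a) w -> jip w z1 = jip w a') ->
  (forall w, face (supp b) w -> jip w z0 = c0 * jip w (invA b)) ->
  (forall w, face (supp b) w -> jip w z1 = c1 * jip w (invA b')) ->
  Mfun mul a z0 * KN b z0 = Mfun mul a' z0 * KN b' z0 ->
  Mfun mul a z1 * KN b z1 = Mfun mul a' z1 * KN b' z1 -> a = a' /\ b = b'.
Proof.
move=> pa pb pa' pb' na nb na' nb' sa sb i0 i1 c0p c1p la la' ha ha' hb hb'.
have le0 : Mfun mul a z0 * KN b z0 <= c0.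
  rewrite -[c0]mul1r; apply: ler_pM; rewrite ?Mfun_ge0 ?KN_ge0 //; first exact: int_pos.
    by apply/Mfun_le => //; rewrite scale1r.
  by apply: KN_le => //; [apply: ltW|move=> w fw; rewrite hb].
have le1 : Mfun mul a' z1 * KN b' z1 <= c1.
  rewrite -[c1]mul1r; apply: ler_pM; rewrite ?Mfun_ge0 ?KN_ge0 //; first exact: int_pos.
    by apply/Mfun_le => //; rewrite scale1r.
  by apply: KN_le => //; [apply: ltW|move=> w; rewrite -sb => fw; rewrite hb'].
set m := Mfun mul a' z0; set k := KN b' z0; set m' := Mfun mul a z1; set k' := KN b z1.
move=> e0; rewrite e0 in le0; move=> e1; rewrite -e1 in le1; move: le0 le1 => {e0 e1} mk mk'.
have mge w : face (supp a) w -> jip w a' <= m * jip w a.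
  move=> fw; have /(Mfun_le u0 _ _ i0) h := lexx m.
  by have := pos_ip (face_pos fw) h; rewrite jipBr jipZr subr_ge0 ha.
have mge' w : face (supp a) w -> jip w a <= m' * jip w a'.
  move=> fw; have /(Mfun_le u0 _ _ i1) h := lexx m'.
  by have := pos_ip (face_pos fw) h; rewrite jipBr jipZr subr_ge0 ha'.
have kge w : face (supp b) w -> c0 * jip w (invA b) <= k * jip w (invA b').
  move=> fw; rewrite -hb // -ler_pdivrMr; last by apply: inv_face_pos; rewrite -?sb.
  by apply: KN_ge; rewrite -?sb.
have kge' w : face (supp b) w -> c1 * jip w (invA b') <= k' * jip w (invA b).
  by move=> fw; rewrite -hb' // -ler_pdivrMr ?inv_face_pos //; apply: KN_ge.
have fa := face_self (supp_idem a) (supp_neq0 (normalized_neq0 na)).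
have fb := face_self (supp_idem b) (supp_neq0 (normalized_neq0 nb)).
have m0 : 0 < m by apply: Mfun_gt0 => //; apply: normalized_neq0.
have m0' : 0 < m' by apply: Mfun_gt0 => //; apply: normalized_neq0.
have wa_gt0 : 0 < jip (supp a) a.
  rewrite -ha //; apply: int_ip_gt0 => //; first exact: face_pos fa.
  exact: supp_neq0 (normalized_neq0 na).
have mm : 1 <= m * m'.
  have h1 := mge _ fa; have h2 := mge' _ fa.
  by rewrite -(ler_pM2r wa_gt0) mul1r (le_trans h2) // -mulrA mulrCA ler_pM2l.
have iB : 0 < jip (supp b) (invA b) by apply: inv_face_pos.
have iB' : 0 < jip (supp b) (invA b') by apply: inv_face_pos; rewrite -?sb.
have k0 : 0 < k by have := lt_le_trans (mulr_gt0 c0p iB) (kge _ fb); rewrite pmulr_lgt0.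
have k0' : 0 < k' by have := lt_le_trans (mulr_gt0 c1p iB') (kge' _ fb); rewrite pmulr_lgt0.
have kk : c0 * c1 <= k * k'.
  have h1 := kge _ fb; have h2 := kge' _ fb.
  rewrite -(ler_pM2r iB); apply: (@le_trans _ _ (c1 * (k * jip (supp b) (invA b')))).
    by rewrite -mulrA mulrCA ler_pM2l.
  by rewrite mulrCA -mulrA ler_pM2l.
have mmkk : (m * m') * (k * k') <= c0 * c1.
  by rewrite mulrACA; apply: ler_pM; rewrite ?mulr_ge0 // ltW.
have cc := mulr_gt0 c0p c1p; have kk0 := mulr_gt0 k0 k0'.
have mm1 : m * m' = 1.
  apply/eqP; rewrite eq_le mm andbT -(ler_pM2r kk0) mul1r.
  exact: le_trans mmkk kk.
have kk1 : k * k' = c0 * c1.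
  by apply/eqP; rewrite eq_le kk andbT; move: mmkk; rewrite mm1 mul1r.
split; apply/esym.
  apply: (@scale_normalized m) => //; apply: face_inj; rewrite supp_scale ?gt_eqF // => w fw.
  rewrite jipZr; apply/eqP; rewrite eq_le mge //=.
  by have := mge' w fw; rewrite -(ler_pM2l m0) mulrA mm1 mul1r.
apply: (@scale_normalized (k / c0)) => //; first by rewrite divr_gt0.
apply: face_invA_inj => //; first by rewrite divr_gt0.
move=> w fw; rewrite invf_div; apply/eqP; rewrite eq_le; apply/andP; split.
  have -> : c0 / k = c1^-1 * k'.
    have -> : c0 = k * k' / c1 by rewrite kk1 mulfK // gt_eqF.
    by field; rewrite !gt_eqF.
  by rewrite -mulrA ler_pdivlMl // kge'.
by have := kge w fw; rewrite -ler_pdivrMl // mulrA (mulrC k^-1).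
Qed.

End Comparison.

(** * The two compactifications *)

Section Model.
Context (u0 : u != 0) (k : bool).

#[local] Opaque EN KN jmax fc jip Mfun.

(* Part (a) is the case k = true, part (b) the case k = false.  The suffix N
   refers to the normed space, the suffix T to the cone. *)
Definition op (x y : R) : R := if k then Num.max x y else x * y.

Definition nu (y : A) : R := if k then Num.max (jmax y) (jmax (- y)) else jmax y + jmax (- y).
(** The basepoint term exp (- nu y) must factor out of [op]. A maximum requires the same factor on
    both arguments; a product allows each argument its own. *)
Definition rr (y : A) : R := if k then nu y else jmax y.
Definition ss (y : A) : R := if k then nu y else jmax (- y).
Definition ea (y : A) : A := fc (fun t => expR (t - rr y)) y.
Definition eb (y : A) : A := fc (fun t => expR (- t - ss y)) y.

Definition dN (x y : A) : R := nu (x - y).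
Definition dT (x y : A) : R := if k then thompson mul x y else hilbert mul x y.
Definition MN : set A := if k then [set: A] else Tu mul u.
Definition MT : set A := if k then cone_int mul u else PA mul u.

Lemma op_gt0 x y : 0 < x -> 0 < y -> 0 < op x y.
Proof. by move=> x0 y0; rewrite /op; case: k; [rewrite lt_max x0|exact: mulr_gt0]. Qed.

Lemma op_le x y x' y' : 0 <= x -> 0 <= y -> x <= x' -> y <= y' -> op x y <= op x' y'.
Proof.
move=> x0 y0 xx yy; rewrite /op; case: k; last exact: ler_pM.
by rewrite ge_max !le_max xx yy orbT.
Qed.

Lemma op_scale C x y : 1 <= C -> 0 <= x -> 0 <= y -> op (C * x) (C * y) <= C * C * op x y.
Proof.
move=> C1 x0 y0; have C0 : 0 <= C by apply: le_trans C1.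
rewrite /op; case: k; last by rewrite mulrACA.
rewrite -maxr_pMr // -[leLHS]mul1r -mulrA; apply: ler_wpM2r => //.
by rewrite mulr_ge0 // le_max x0.
Qed.

Lemma op_cvg (T : Type) (F : set_system T) {FF : Filter F} (f g : T -> R) (x y : R) :
  f @ F --> x -> g @ F --> y -> (fun t => op (f t) (g t)) @ F --> op x y.
Proof.
move=> fx gy; rewrite /op; case: k; last exact: cvgM.
have e a b : Num.max a b = (a + b + `|a - b|) / 2 :> R by rewrite maxr_absE.
rewrite e; under eq_fun do rewrite e.
apply: cvgM; last exact: cvg_cst.
by apply: cvgD; [exact: cvgD|apply: cvg_norm; exact: cvgB].
Qed.

Lemma ln_max (x y : R) : 0 < x -> 0 < y -> ln (Num.max x y) = Num.max (ln x) (ln y).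
Proof.
move=> x0 y0; case: (leP x y) => h; [rewrite max_r|rewrite max_l] => //.
  by rewrite ler_ln ?posrE.
by rewrite ler_ln ?posrE // ltW.
Qed.

Lemma expR_maxE (x y : R) : expR (Num.max x y) = Num.max (expR x) (expR y).
Proof.
case: (leP x y) => h; [rewrite max_r|rewrite max_l] => //; first by rewrite ler_expR.
by rewrite ler_expR ltW.
Qed.

Lemma jmax_shift x c : jmax (x - c *: u) = jmax x - c.
Proof.
have le y d : jmax (y - d *: u) <= jmax y - d.
  apply/jmax_le => //; have h : pos (jmax y *: u - y) by apply/jmax_le.
  by move: h; congr pos; vring.
apply/eqP; rewrite eq_le le lerBlDr /=.
have := le (x - c *: u) (- c).
by rewrite scaleNr opprK subrK opprK.
Qed.

Lemma fcN y : - y = fc (fun t => - t) y.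
Proof. by rewrite -scaleN1r -{1}(fc_id y) -fc_scale; congr (fc _ y); apply/funext => t; rewrite mulN1r. Qed.

Lemma jmax_osys r (p : 'I_r -> A) lam : osys p ->
  (exists2 i, p i != 0 & jmax (\sum_i lam i *: p i) = lam i) /\
  (forall i, p i != 0 -> lam i <= jmax (\sum_i lam i *: p i)).
Proof.
move=> op; have le s : jmax (\sum_i lam i *: p i) <= s <-> forall i, p i != 0 -> lam i <= s.
  rewrite (jmax_le _ _ u0) osysB // pos_osys //.
  by split=> h i pi0; have := h i pi0; rewrite subr_ge0.
have ub := (le _).1 (lexx _); split=> //.
have [i0 pi0] : exists i, p i != 0.
  apply: contrapT => no; case: op => _ _ pu; case/eqP: u0; rewrite -pu big1 // => i _.
  by apply/eqP/negPn/negP => h; apply: no; exists i.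
pose m := [arg max_(i > i0 | p i != 0) lam i]%O.
have [pm hm] : p m != 0 /\ forall i, p i != 0 -> lam i <= lam m.
  by rewrite /m; case: arg_maxP.
by exists m => //; apply/eqP; rewrite eq_le ub // andbT; apply/le.
Qed.

Lemma jmax_exp y : jmax (expA y) = expR (jmax y).
Proof.
have [r [p [lam [op p0 ->]]]] := spectral_neq0 y; rewrite fcE //.
have [[i _ e] ub] := jmax_osys lam op.
have [[j _ e'] ub'] := jmax_osys (fun i => expR (lam i)) op.
apply/eqP; rewrite eq_le {1}e' ler_expR ub //=.
by rewrite e ub'.
Qed.

Lemma eaE y : ea y = expR (- rr y) *: expA y.
Proof.
by rewrite /ea -fc_scale; congr (fc _ y); apply/funext => t; rewrite -expRD addrC.
Qed.

Lemma ebE y : eb y = expR (- ss y) *: expA (- y).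
Proof.
rewrite /eb fcN fc_comp -fc_scale; congr (fc _ y); apply/funext => t /=.
by rewrite -expRD addrC.
Qed.

Lemma lnA_ea y : lnA (ea y) = y - rr y *: u.
Proof.
rewrite /ea fc_comp; have [r [p [lam [op yE]]]] := spectral y.
move: (rr y) => c; rewrite yE fcE //.
have -> : c *: u = \sum_i c *: p i by rewrite -scaler_sumr; case: op => _ _ ->.
by rewrite -sumrB; apply: eq_bigr => i _; rewrite -scalerBl /= expRK.
Qed.

Lemma lnA_eb y : lnA (eb y) = - y - ss y *: u.
Proof.
rewrite /eb fc_comp; have [r [p [lam [op yE]]]] := spectral y.
move: (ss y) => c; rewrite yE fcE //.
have -> : c *: u = \sum_i c *: p i by rewrite -scaler_sumr; case: op => _ _ ->.
by rewrite -sumrN -sumrB; apply: eq_bigr => i _; rewrite -scaleNr -scalerBl /= expRK.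
Qed.

Lemma invA_eb y : invA (eb y) = expR (ss y) *: expA y.
Proof.
rewrite /eb fc_comp -fc_scale; congr (fc _ y); apply/funext => t /=.
by rewrite -expRN -expRD; congr expR; ring.
Qed.

Lemma ea_int y : cone_int mul u (ea y).
Proof. by rewrite eaE; apply: int_scale; rewrite ?expR_gt0 //; apply: cone_int_fc_exp. Qed.

Lemma eb_int y : cone_int mul u (eb y).
Proof. by rewrite ebE; apply: int_scale; rewrite ?expR_gt0 //; apply: cone_int_fc_exp. Qed.

Lemma jmax_ea y : jmax (ea y) = expR (jmax y - rr y).
Proof. by rewrite eaE jmax_scale ?expR_gt0 // jmax_exp -expRD addrC. Qed.

Lemma jmax_eb y : jmax (eb y) = expR (jmax (- y) - ss y).
Proof. by rewrite ebE jmax_scale ?expR_gt0 // jmax_exp -expRD addrC. Qed.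

Lemma rr_ge y : jmax y <= rr y.
Proof. by rewrite /rr /nu; case: k => //; rewrite le_max lexx. Qed.

Lemma ss_ge y : jmax (- y) <= ss y.
Proof. by rewrite /ss /nu; case: k => //; rewrite le_max lexx orbT. Qed.

Lemma ea_le1 y : pos (u - ea y).
Proof.
have : jmax (ea y) <= 1 by rewrite jmax_ea -expR0 ler_expR subr_le0 rr_ge.
by move/jmax_le => /(_ u0); rewrite scale1r.
Qed.

Lemma eb_le1 y : pos (u - eb y).
Proof.
have : jmax (eb y) <= 1 by rewrite jmax_eb -expR0 ler_expR subr_le0 ss_ge.
by move/jmax_le => /(_ u0); rewrite scale1r.
Qed.

Lemma op_normal y : op (jmax (ea y)) (jmax (eb y)) = 1.
Proof.
rewrite jmax_ea jmax_eb /op /rr /ss /nu; case: k; last by rewrite !subrr expR0 mulr1.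
rewrite -expR_maxE -[RHS]expR0; congr expR; apply/eqP.
by rewrite -[X in Num.max _ X]addrC -[X in Num.max X _]addrC -addr_maxr addrC subrr.
Qed.

Lemma ln_op_shift x y z : ln (op (expR (x - rr z)) (expR (y - ss z))) =
  (if k then Num.max x y else x + y) - nu z.
Proof.
rewrite /op /rr /ss /nu; case: k; last by rewrite -expRD expRK; ring.
rewrite -expR_maxE expRK -[X in Num.max _ X]addrC -[X in Num.max X _]addrC.
by rewrite -addr_maxr addrC.
Qed.

Lemma ln_op_mul x y z : 0 < x -> 0 < y -> ln (op (expR (- rr z) * x) (expR (- ss z) * y)) =
  (if k then Num.max (ln x) (ln y) else ln x + ln y) - nu z.
Proof.
move=> x0 y0; rewrite -ln_op_shift !expRD !(lnK (_ : _ \in Num.pos)) ?posrE //.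
by rewrite (mulrC x) (mulrC y).
Qed.

Lemma nuN y : nu (- y) = nu y.
Proof. by rewrite /nu opprK; case: k; rewrite ?(maxC (jmax (- y))) // addrC. Qed.

Lemma horoN_E y (z : {x | MN x}) : horo MN dN 0 y z =
  ln (op (expR (jmax (lnA (ea y) - proj1_sig z))) (expR (jmax (lnA (eb y) - - proj1_sig z)))).
Proof.
rewrite lnA_ea lnA_eb opprK /horo /dN sub0r nuN.
have -> : y - rr y *: u - sval z = (y - sval z) - rr y *: u by vring.
have -> : - y - ss y *: u + sval z = (sval z - y) - ss y *: u by vring.
rewrite !jmax_shift ln_op_shift; congr (_ - _).
rewrite -nuN opprB /nu opprB; by case: k.
Qed.

Lemma jmax_exp_inv y : Mfun mul u (expA y) = expR (jmax (- y)).
Proof.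
rewrite -jmax_exp; have ie := cone_int_fc_exp y u0.
have conv s : pos (s *: expA y - u) <-> pos (s *: u - expA (- y)).
  have [r [p [lam [op p0 yE]]]] := spectral_neq0 y.
  have uE : u = \sum_i 1 *: p i by case: op => _ _ <-; apply: eq_bigr => i _; rewrite scale1r.
  have -> : s *: expA y - u = \sum_i (s * expR (lam i) - 1) *: p i.
    rewrite yE fcE // {1}uE scaler_sumr -sumrB; apply: eq_bigr => i _.
    by rewrite scalerA scalerBl.
  have -> : s *: u - expA (- y) = \sum_i (s - expR (- lam i)) *: p i.
    by rewrite (fcN y) fc_comp yE fcE // osysB.
  rewrite !pos_osys //; split=> h i pi0; have := h i pi0; rewrite !subr_ge0 expRN.
    by rewrite -ler_pdivrMr ?expR_gt0 // div1r.
  by move=> h1; rewrite -ler_pdivrMr ?expR_gt0 // div1r.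
apply/eqP; rewrite eq_le; apply/andP; split.
  by apply/(Mfun_le u0 _ _ ie)/conv/jmax_le.
by apply/jmax_le => //; apply/conv/(Mfun_le u0 _ _ ie).
Qed.

Lemma MT_int x : MT x -> cone_int mul u x.
Proof. by rewrite /MT; case: k => // -[]. Qed.

Lemma Mfun_int_gt0 x y : cone_int mul u x -> cone_int mul u y -> 0 < Mfun mul x y.
Proof.
move=> ix iy; apply: Mfun_gt0 => //; first exact: int_pos.
apply: contra_neq u0 => x0; rewrite x0 in ix.
by have := int_ip_gt0 u0 ix pos1 u0; rewrite jip0r ltxx.
Qed.

Lemma dT_E x y : cone_int mul u x -> cone_int mul u y ->
  dT x y = ln (op (Mfun mul x y) (Mfun mul y x)).
Proof.
move=> ix iy; rewrite /dT /op /thompson /hilbert.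
have h1 := Mfun_int_gt0 ix iy; have h2 := Mfun_int_gt0 iy ix.
by case: k; rewrite ?ln_max // lnM ?posrE.
Qed.

Lemma dT_u y : dT u (expA y) = nu y.
Proof.
have iu : cone_int mul u u.
  by apply/cone_intP => //; exists 1 => //; rewrite scale1r subrr; apply: pos0.
rewrite dT_E ?jmax_exp_inv -?jmax_Mfun ?jmax_exp //; last exact: cone_int_fc_exp.
rewrite /op /nu; case: k; first by rewrite -expR_maxE expRK maxC.
by rewrite -expRD expRK addrC.
Qed.

Lemma Mfun_ea y z : cone_int mul u z -> Mfun mul (ea y) z = expR (- rr y) * Mfun mul (expA y) z.
Proof.
move=> iz; rewrite eaE; move: (rr y) => c; have ec := expR_gt0 (- c).
have le d x : 0 < d -> Mfun mul (d *: x) z <= d * Mfun mul x z.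
  move=> d0; apply/(Mfun_le u0 _ _ iz); rewrite -scalerA -scalerBr.
  by apply: posZ; [apply: ltW|apply/Mfun_le].
apply/eqP; rewrite eq_le le //= -ler_pdivlMl // mulrC.
have := le (expR (- c))^-1 (expR (- c) *: expA y).
rewrite scalerA mulVf ?gt_eqF // scale1r invr_gt0 mulrC; exact.
Qed.

Lemma horoT_E y (z : {x | MT x}) : horo MT dT u (expA y) z =
  ln (op (Mfun mul (ea y) (proj1_sig z)) (Mfun mul (proj1_sig z) (invA (eb y)))).
Proof.
have iz := MT_int (proj2_sig z); have ie := cone_int_fc_exp y u0.
rewrite /horo dT_u dT_E // invA_eb Mfun_ea // Mfun_scale ?expR_gt0 // -expRN.
have h1 := Mfun_int_gt0 iz ie; have h2 := Mfun_int_gt0 ie iz.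
rewrite ln_op_mul //; congr (_ - _); rewrite /op; case: k.
  by rewrite ln_max // maxC.
by rewrite lnM ?posrE // addrC.
Qed.

Lemma dN_tri x y z : dN x z <= dN x y + dN y z.
Proof.
have sub v w : jmax (v + w) <= jmax v + jmax w.
  apply/jmax_le => //; have h1 : pos (jmax v *: u - v) by apply/jmax_le.
  have h2 : pos (jmax w *: u - w) by apply/jmax_le.
  by have := posD h1 h2; congr pos; vring.
have h1 := sub (x - y) (y - z); have h2 := sub (- (x - y)) (- (y - z)).
have e1 : x - y + (y - z) = x - z by vring.
have e2 : - (x - y) - (y - z) = - (x - z) by vring.
rewrite e1 in h1; rewrite e2 in h2; rewrite /dN /nu; case: k; last by lra.
rewrite ge_max; apply/andP; split; [apply: (le_trans h1)|apply: (le_trans h2)];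
  by apply: lerD; rewrite le_max lexx ?orbT.
Qed.

Lemma Mfun_tri x y z : cone_int mul u x -> cone_int mul u y -> cone_int mul u z ->
  Mfun mul x z <= Mfun mul x y * Mfun mul y z.
Proof.
move=> ix iy iz; apply/(Mfun_le u0 _ _ iz).
have /(Mfun_le u0 _ _ iy) h1 := lexx (Mfun mul x y).
have /(Mfun_le u0 _ _ iz) h2 := lexx (Mfun mul y z).
have := posD h1 (posZ (ltW (Mfun_int_gt0 ix iy)) h2).
by congr pos; vring.
Qed.

Lemma dT_tri x y z : MT x -> MT y -> MT z -> dT x z <= dT x y + dT y z.
Proof.
move=> /MT_int ix /MT_int iy /MT_int iz.
have key v w t : cone_int mul u v -> cone_int mul u w -> cone_int mul u t ->
    ln (Mfun mul v t) <= ln (Mfun mul v w) + ln (Mfun mul w t).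
  move=> iv iw it; rewrite -lnM ?posrE ?Mfun_int_gt0 // ler_ln ?posrE ?mulr_gt0 ?Mfun_int_gt0 //.
  exact: Mfun_tri.
have h1 := key x y z ix iy iz; have h2 := key z y x iz iy ix.
rewrite /dT /thompson /hilbert; case: k; last by lra.
rewrite ge_max; apply/andP; split; [apply: (le_trans h1)|apply: (le_trans h2)].
  by apply: lerD; rewrite le_max lexx.
by rewrite addrC; apply: lerD; rewrite le_max lexx orbT.
Qed.

Definition LN (a b z : A) : R := op (EN a z) (EN b (- z)).
Definition LT (a b z : A) : R := op (Mfun mul a z) (KN b z).

Definition normal a b := [/\ pos a, pos b, jmax a <= 1, jmax b <= 1 & op (jmax a) (jmax b) = 1].

Lemma jmax0 : jmax (0 : A) = 0.
Proof. by have := jmax_scale u0 (0 : A) (ltr0Sn R 1); rewrite scaler0; lra. Qed.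

Lemma normal_neq0 a b : normal a b -> if k then a != 0 \/ b != 0 else jmax a = 1 /\ jmax b = 1.
Proof.
move=> [pa pb a1 b1]; rewrite /op; case: k => h.
  have [a0|] := eqVneq a 0; last by left.
  right; apply/eqP => b0; move: h; rewrite a0 b0 jmax0 maxxx => /esym/eqP.
  by rewrite oner_eq0.
have ge0 x : pos x -> 0 <= jmax x by move=> px; rewrite jmax_Mfun // Mfun_ge0 //;
  apply/cone_intP => //; exists 1 => //; rewrite scale1r subrr; apply: pos0.
have ga := ge0 a pa; have gb := ge0 b pb.
by split; apply/eqP; rewrite eq_le ?a1 ?b1 /= -h; [apply: ler_piMr|apply: ler_piMl].
Qed.

Lemma LN_gt0 a b z : normal a b -> 0 < LN a b z.
Proof.
move=> nab; have := normal_neq0 nab; rewrite /LN /op; case: k.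
  by rewrite lt_max => -[h|h]; apply/orP; [left|right]; apply: EN_gt0.
by move=> [/normalized_neq0 a0 /normalized_neq0 b0]; rewrite mulr_gt0 // EN_gt0 // ?a0 ?b0.
Qed.

Lemma KN_gt0 b z : pos b -> b != 0 -> cone_int mul u z -> 0 < KN b z.
Proof.
move=> pb b0 iz; have fs := face_self (supp_idem b) (supp_neq0 b0).
apply: lt_le_trans (KN_ge u0 z pb fs); rewrite divr_gt0 ?inv_face_pos //.
by apply: int_ip_gt0 => //; [case: fs|apply: supp_neq0].
Qed.

Lemma LT_gt0 a b z : normal a b -> cone_int mul u z -> 0 < LT a b z.
Proof.
move=> nab iz; have := normal_neq0 nab; have [pa pb _ _ _] := nab; rewrite /LT /op; case: k.
  by rewrite lt_max => -[h|h]; apply/orP; [left; apply: Mfun_gt0|right; apply: KN_gt0].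
move=> [/normalized_neq0 a0 /normalized_neq0 b0].
by apply: mulr_gt0; [apply: Mfun_gt0|apply: KN_gt0] => //; [apply: a0|apply: b0].
Qed.

(** * Horofunctions along convergent pairs *)

Section Limits.
Context {T : Type} (F : set_system T) {FU : UltraFilter F} (y : T -> A) (a b : A).
Hypothesis ya : Acvg F (fun t => ea (y t)) a.
Hypothesis yb : Acvg F (fun t => eb (y t)) b.
Let FP : ProperFilter F := @ultra_proper _ _ FU.

Lemma limit_normal : normal a b.
Proof.
have iu : cone_int mul u u.
  by apply/cone_intP => //; exists 1 => //; rewrite scale1r subrr; apply: pos0.
have pa : pos a by apply: (limit_is_pos u0 _ ya) => t; apply: ea_int.
have pb : pos b by apply: (limit_is_pos u0 _ yb) => t; apply: eb_int.
have ca : (fun t => Mfun mul (ea (y t)) u) @ F --> Mfun mul a u.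
  by apply: (cvg_Mfun u0 ya iu).
have cb : (fun t => Mfun mul (eb (y t)) u) @ F --> Mfun mul b u.
  by apply: (cvg_Mfun u0 yb iu).
have pa1 : pos (u - a).
  have h : Acvg F (fun t => u - ea (y t)) (u - a) by apply: AcvgB => //; apply: Acvg_cst.
  by apply: (Acvg_pos h); apply: nearW => t; apply: ea_le1.
have pb1 : pos (u - b).
  have h : Acvg F (fun t => u - eb (y t)) (u - b) by apply: AcvgB => //; apply: Acvg_cst.
  by apply: (Acvg_pos h); apply: nearW => t; apply: eb_le1.
have a1 : jmax a <= 1 by apply/jmax_le => //; rewrite scale1r.
have b1 : jmax b <= 1 by apply/jmax_le => //; rewrite scale1r.
split=> //.
have c1 : (fun t => op (Mfun mul (ea (y t)) u) (Mfun mul (eb (y t)) u)) @ F -->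
  op (Mfun mul a u) (Mfun mul b u) by apply: op_cvg.
have c2 : (fun t => op (Mfun mul (ea (y t)) u) (Mfun mul (eb (y t)) u)) @ F --> (1 : R).
  rewrite (_ : (fun t => _) = fun=> 1); first exact: cvg_cst.
  by apply/funext => t; rewrite -!jmax_Mfun // op_normal.
rewrite !jmax_Mfun //; exact: (cvg_unique (@Rhausdorff R) c1 c2).
Qed.

Lemma cvg_horoN (z : {x | MN x}) : (fun t => horo MN dN 0 (y t) z) @ F --> ln (LN a b (proj1_sig z)).
Proof.
have e : (fun t => horo MN dN 0 (y t) z) =
    @ln R \o (fun t => op (expR (jmax (lnA (ea (y t)) - proj1_sig z)))
                      (expR (jmax (lnA (eb (y t)) - - proj1_sig z)))).
  by apply/funext => t; rewrite horoN_E.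
have c1 : (fun t => expR (jmax (lnA (ea (y t)) - sval z))) @ F --> EN a (sval z).
  by apply: (cvg_EN u0 _ _ ya) => t; [apply: ea_int|apply: ea_le1].
have c2 : (fun t => expR (jmax (lnA (eb (y t)) - - sval z))) @ F --> EN b (- sval z).
  by apply: (cvg_EN u0 _ _ yb) => t; [apply: eb_int|apply: eb_le1].
rewrite e; apply: (cvg_comp _ _ (op_cvg c1 c2)).
by apply: continuous_ln; apply: LN_gt0 limit_normal.
Qed.

Lemma cvg_horoT (z : {x | MT x}) :
  (fun t => horo MT dT u (expA (y t)) z) @ F --> ln (LT a b (proj1_sig z)).
Proof.
have iz := MT_int (proj2_sig z).
have e : (fun t => horo MT dT u (expA (y t)) z) =
    @ln R \o (fun t => op (Mfun mul (ea (y t)) (proj1_sig z))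
                      (Mfun mul (proj1_sig z) (invA (eb (y t))))).
  by apply/funext => t; rewrite horoT_E.
have c1 : (fun t => Mfun mul (ea (y t)) (sval z)) @ F --> Mfun mul a (sval z).
  by apply: (cvg_Mfun u0 ya iz).
have c2 : (fun t => Mfun mul (sval z) (invA (eb (y t)))) @ F --> KN b (sval z).
  by apply: (cvg_KN u0 _ _ yb (int_pos u0 iz)) => t; [apply: eb_int|apply: eb_le1].
rewrite e; apply: (cvg_comp _ _ (op_cvg c1 c2)).
by apply: continuous_ln; apply: LT_gt0 limit_normal iz.
Qed.

End Limits.

(* The limit pairs of horofunctions: commuting a and b with orthogonal supports. *)
Definition boundary_pair a b := normal a b /\ exists (q : 'I_N -> A) (al be : 'I_N -> R),
  [/\ osys q, forall i, 0 <= al i <= 1 /\ 0 <= be i <= 1 /\ al i * be i = 0,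
      a = \sum_i al i *: q i & b = \sum_i be i *: q i].

(** In part (b) the functions [LN] do not change under shifts by u, so identities on the trace-zero
    subspace extend to the whole algebra; [pr] picks the trace-zero representative. In part (a)
    there is nothing to adjust. *)
Definition pr (y : A) : A := if k then y else y - (jtr mul u y / jtr mul u u) *: u.

Lemma pr_MN y : MN (pr y).
Proof.
rewrite /MN /pr; case: k => //=; rewrite /Tu /= -scaleNr jtr_shift mulNr divfK ?jtr1_neq0 //.
exact: subrr.
Qed.

Lemma pr_shift y : exists2 c, pr y = y - c *: u & (k -> c = 0).
Proof.
rewrite /pr; case: k; first by exists 0; rewrite ?scale0r ?subr0.
by exists (jtr mul u y / jtr mul u u).
Qed.

Lemma exp_shift y c : expA (y - c *: u) = expR (- c) *: expA y.
Proof.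
have [r [p [lam [oq ->]]]] := spectral y.
have -> : c *: u = \sum_i c *: p i by rewrite -scaler_sumr; case: oq => _ _ ->.
rewrite -sumrB; under eq_bigr do rewrite -scalerBl.
rewrite !fcE // scaler_sumr; apply: eq_bigr => i _.
by rewrite scalerA -expRD addrC.
Qed.

Lemma jmaxN_shift y c : jmax (- (y - c *: u)) = jmax (- y) + c.
Proof.
have -> : - (y - c *: u) = - y - (- c) *: u by vring.
by rewrite jmax_shift // opprK.
Qed.

Lemma nu_pr y : nu (pr y) = nu y.
Proof.
have [c -> kc] := pr_shift y; rewrite /nu; case: k kc => [/(_ isT) ->|_].
  by rewrite scale0r subr0.
by rewrite jmax_shift // jmaxN_shift; lra.
Qed.

Lemma ea_pr y : ea (pr y) = ea y.
Proof.
rewrite !eaE /rr nu_pr; have [c -> kc] := pr_shift y; case: k kc => [/(_ isT) ->|_].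
  by rewrite scale0r subr0.
by rewrite exp_shift jmax_shift // scalerA -expRD; congr (expR _ *: _); ring.
Qed.

Lemma eb_pr y : eb (pr y) = eb y.
Proof.
rewrite !ebE /ss nu_pr; have [c -> kc] := pr_shift y; case: k kc => [/(_ isT) ->|_].
  by rewrite scale0r subr0.
have -> : - (y - c *: u) = - y - (- c) *: u by vring.
by rewrite exp_shift jmax_shift // scalerA -expRD; congr (expR _ *: _); ring.
Qed.

Lemma LN_pr a b z : LN a b (pr z) = LN a b z.
Proof.
rewrite /LN; have [c -> kc] := pr_shift z; rewrite /op; case: k kc => [/(_ isT) ->|_].
  by rewrite scale0r subr0.
have -> : z - c *: u = z + (- c) *: u by vring.
have -> : - (z + (- c) *: u) = - z + c *: u by vring.
rewrite !EN_shift // mulrACA opprK -expRD subrr expR0 mul1r //.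
Qed.

Definition prT (z : A) : A := expA (pr (lnA z)).

Lemma exp_MT y : MN y -> MT (expA y).
Proof.
rewrite /MN /MT; case: k => [_|h]; first exact: cone_int_fc_exp.
by split; [exact: cone_int_fc_exp|rewrite jdet_exp h expR0].
Qed.

Lemma MT_exp : MT = expA @` MN.
Proof.
apply/seteqP; split=> [x hx|_ [y hy <-]]; last exact: exp_MT.
have xE := (cone_int_exp x u0).1 (MT_int hx).
exists (lnA x) => //; move: hx; rewrite /MT /MN; case: k => // -[ix].
rewrite {1}xE jdet_exp => h; apply: (@expR_inj R).
by rewrite expR0.
Qed.

Lemma prT_scale z : cone_int mul u z -> exists2 c, prT z = expR c *: z & (k -> c = 0).
Proof.
move=> iz; rewrite /prT; have [c -> kc] := pr_shift (lnA z).
exists (- c); last by move/kc ->; rewrite oppr0.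
by rewrite exp_shift -((cone_int_exp z u0).1 iz).
Qed.

Lemma prT_MT z : MT (prT z).
Proof. by apply: exp_MT; apply: pr_MN. Qed.

Lemma LT_pr a b z : pos b -> cone_int mul u z -> LT a b (prT z) = LT a b z.
Proof.
move=> pb iz; rewrite /LT; have [c -> kc] := prT_scale iz; rewrite /op.
case: k kc => [/(_ isT) ->|_]; first by rewrite expR0 scale1r.
rewrite Mfun_scale ?expR_gt0 // KN_scale ?expR_gt0 //; last exact: int_pos.
by rewrite mulrACA mulVf ?mul1r // gt_eqF // expR_gt0.
Qed.

(* If al_i be_i = kk <> 0, then b = kk a^-1 and the limit is attained. *)
Lemma pair_dichotomy (F : set_system A) (FU : UltraFilter F) : exists a b,
  [/\ Acvg F ea a, Acvg F eb b &
      boundary_pair a b \/ exists2 y, MN y & a = ea y /\ b = eb y].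
Proof.
have [q [al [be [kk [oq hab ca cb ck]]]]] :=
  pair_limit u0 FU rr_ge ss_ge.
set a := \sum_i al i *: q i in ca; set b := \sum_i be i *: q i in cb.
exists a, b; split=> //; have nab : normal a b by apply: (limit_normal (y := id) ca cb).
have [k0|k0] := eqVneq kk 0.
  by left; split=> //; exists q, al, be; split=> // i; have [? [? h]] := hab i; rewrite h.
right.
have kp : 0 < kk.
  rewrite lt_neqAle eq_sym k0 /=; apply: (cvg_ler (cvg_cst 0) ck).
  by apply: nearW => y; apply: expR_ge0.
have al0 i : 0 < al i.
  have [/andP[h _] [_ h2]] := hab i; rewrite lt_neqAle eq_sym h andbT.
  by apply: contra_neq k0 => e; rewrite -h2 e mul0r.
have be0 i : be i = kk * (al i)^-1.
  by have [_ [_ <-]] := hab i; rewrite mulrAC divff ?mul1r // gt_eqF.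
have [pa pb a1 b1 ab1] := nab.
pose y0 := lnA a.
have aE : a = expA y0.
  by rewrite /y0 fc_comp /a fcE //; apply: eq_bigr => i _ /=; rewrite lnK ?posrE.
have bE : b = kk *: expA (- y0).
  rewrite fcN /y0 !fc_comp /a fcE // scaler_sumr /b; apply: eq_bigr => i _ /=.
  by rewrite scalerA expRN lnK ?posrE // be0.
(* In part (a) this shift balances the two normalizations: [nu y1] becomes - ln kk / 2, which makes
   [ea y1] = a and [eb y1] = b. In part (b) a shift would have no effect. *)
pose y1 := if k then y0 - (ln kk / 2) *: u else y0.
exists (pr y1); first exact: pr_MN.
rewrite ea_pr eb_pr eaE ebE /y1.
move: ab1 (normal_neq0 nab); rewrite /op /rr /ss /nu.
have ja : jmax a = expR (jmax y0) by rewrite aE jmax_exp.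
have jb : jmax b = kk * expR (jmax (- y0)) by rewrite bE jmax_scale // jmax_exp.
rewrite ja jb; case: k => h hn.
  set c := ln kk / 2.
  have r : Num.max (jmax (y0 - c *: u)) (jmax (- (y0 - c *: u))) = - c.
    rewrite jmax_shift // jmaxN_shift; apply: (@expR_inj R).
    have kE : kk = expR (c + c) by rewrite -splitr lnK ?posrE.
    move: h; rewrite kE -expRD -expR_maxE => /(congr1 (fun t => expR (- c) * t)).
    rewrite -expRD mulr1 => <-; congr expR.
    by rewrite addr_maxr; congr (Num.max _ _); ring.
  rewrite r exp_shift.
  have -> : - (y0 - c *: u) = - y0 - (- c) *: u by vring.
  rewrite exp_shift !scalerA -!expRD !opprK subrr expR0 scale1r -aE; split=> //.
  by rewrite bE; congr (_ *: _); rewrite -splitr lnK ?posrE.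
case: hn => h1 h2.
have -> : jmax y0 = 0 by apply: (@expR_inj R); rewrite expR0.
rewrite oppr0 expR0 scale1r -aE; split=> //; rewrite bE; congr (_ *: _).
rewrite expRN; apply: (mulIf (_ : expR (jmax (- y0)) != 0)); first by rewrite gt_eqF ?expR_gt0.
by rewrite mulVf ?h2 // gt_eqF ?expR_gt0.
Qed.

Lemma horoN_LN y (z : {x | MN x}) : horo MN dN 0 y z = ln (LN (ea y) (eb y) (proj1_sig z)).
Proof.
have FU := principal_filter_ultra tt; have FP := @ultra_proper _ _ FU.
have ca : Acvg (principal_filter tt) (fun=> ea y) (ea y) by apply: Acvg_cst.
have cb : Acvg (principal_filter tt) (fun=> eb y) (eb y) by apply: Acvg_cst.
have c1 : (fun=> horo MN dN 0 y z) @ principal_filter tt --> ln (LN (ea y) (eb y) (sval z)).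
  by apply: (cvg_horoN (y := fun=> y) ca cb).
by apply: (cvg_unique (@Rhausdorff R) _ c1); apply: cvg_cst.
Qed.

Lemma opC x y : op x y = op y x.
Proof. by rewrite /op; case: k; [exact: maxC|exact: mulrC]. Qed.

(** Here e stands for exp (- t). A maximum bounds x directly; for a product both sides have order
    e^2, and the lower bound c e on y cancels one factor. *)
Lemma op_small c e x y x0 y0 C C1 C2 : 0 < c -> 0 < e -> 0 <= x -> (~~ k -> c * e <= y) ->
  0 <= x0 <= C1 * e -> 0 <= y0 <= C2 * e -> 0 <= C ->
  op x y <= C * op x0 y0 -> x <= (if k then C * Num.max C1 C2 else C * (C1 * C2) / c) * e.
Proof.
move=> c0 e0 x_ge0 hy /andP[x00 x01] /andP[y00 y01] C0; rewrite /op; case: k hy => [_|/(_ isT) hy] h.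
  rewrite -mulrA; apply: (@le_trans _ _ (C * Num.max x0 y0)).
    by apply: le_trans h; rewrite le_max lexx.
  apply: ler_wpM2l => //; rewrite ge_max; apply/andP; split.
    by apply: (le_trans x01); apply: ler_wpM2r; [exact: ltW|rewrite le_max lexx].
  by apply: (le_trans y01); apply: ler_wpM2r; [exact: ltW|rewrite le_max lexx orbT].
have h1 : x * (c * e) <= C * (C1 * C2) * e * e.
  apply: (@le_trans _ _ (x * y)); first exact: ler_wpM2l.
  apply: (le_trans h); rewrite -!mulrA; apply: ler_wpM2l => //.
  have -> : C1 * (C2 * (e * e)) = C1 * e * (C2 * e) by ring.
  exact: ler_pM.
rewrite -(ler_pM2r (mulr_gt0 c0 e0)); apply: (le_trans h1).
by rewrite [leRHS]mulrACA divfK ?gt_eqF // !mulrA.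
Qed.

Lemma normal_lower a b : normal a b -> ~~ k -> a != 0 /\ b != 0.
Proof.
by move=> nab; have := normal_neq0 nab; case: k => // -[ha hb] _; split; apply: normalized_neq0.
Qed.

Lemma normalC a b : normal a b -> normal b a.
Proof. by case=> *; split=> //; rewrite opC. Qed.

Lemma subf_orth a b : supp a ** supp b = 0 -> subf b (u - supp a).
Proof.
move=> ab; apply: subf_of_mul; first exact: idemC (supp_idem a).
by rewrite jmulBl jmul1 ab subr0.
Qed.

Lemma subf_supp a : subf a (supp a).
Proof. by apply: subf_of_mul; apply: supp_idem. Qed.

(** With P the support of a, both factors of [LN a b] decay like exp (- t) along t (2 P - u), the
    second because b is supported in u - P. The bound passes this decay on to [EN a'], which detects
    the support. *)
Lemma LN_subf a b a' b' C : normal a b -> normal a' b' -> supp a ** supp b = 0 -> 0 <= C ->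
  (forall z, LN a' b' z <= C * LN a b z) -> subf a' (supp a).
Proof.
move=> nab nab' ab C0 h; have eP := supp_idem a; set P := supp a in ab eP *.
have [C1 _ h1] := EN_small u0 eP (@subf_supp a).
have [C2 _ h2] := EN_small u0 (idemC eP) (subf_orth ab).
have [c c0 hc] : exists2 c, 0 < c & forall t, 0 < t -> ~~ k ->
    c * expR (- t) <= EN b' (- (t *: (2 *: P - u))).
  have [kt|nk] := boolP k; first by exists 1.
  have [_ b0] := normal_lower nab' nk; have [c c0 hc] := EN_lower u0 b0.
  exists c => // t t0 _; apply: hc.
  have -> : t *: u - - (t *: (2 *: P - u)) = (t * 2) *: P by vring.
  by apply: posZ; [rewrite mulr_ge0 ?ltW|apply: pos_idem].
apply: (EN_small_inv (C := if k then C * Num.max C1 C2 else C * (C1 * C2) / c) u0 eP) => t t0.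
have ht := h (t *: (2 *: P - u)); rewrite /LN in ht.
have X1 : 0 <= EN a (t *: (2 *: P - u)) <= C1 * expR (- t).
  by apply/andP; split; [apply: EN_ge0|apply: h1].
have X2 : 0 <= EN b (- (t *: (2 *: P - u))) <= C2 * expR (- t).
  have -> : - (t *: (2 *: P - u)) = t *: (2 *: (u - P) - u) by vring.
  by apply/andP; split; [apply: EN_ge0|apply: h2].
exact: op_small c0 (expR_gt0 (- t)) (EN_ge0 u0 _ _) (hc t t0) X1 X2 C0 ht.
Qed.

Lemma LT_subf a b a' b' C : normal a b -> normal a' b' -> supp a ** supp b = 0 -> 0 <= C ->
  (forall z, cone_int mul u z -> LT a' b' z <= C * LT a b z) ->
  subf a' (supp a) /\ subf b' (supp b).
Proof.
move=> nab nab' ab C0 h; have eP := supp_idem a; have eQ := supp_idem b.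
have [pa pb _ _ _] := nab; have [pa' pb' _ _ _] := nab'.
have ba : supp b ** supp a = 0 by rewrite jmulC.
have e_gt t : 0 < t -> expR (- t) <= expR t :> R by move=> t0; rewrite ler_expR; lra.
split; [set P := supp a in ab ba eP *|set P := supp b in ab ba eQ *].
  have [C1 _ h1] := Mfun_small u0 pa eP (@subf_supp a).
  have [C2 _ h2] := KN_small pb (idemC eP) (subf_orth ab).
  have [c c0 hc] : exists2 c, 0 < c & forall t, 0 < t -> ~~ k ->
      c * expR (- t) <= KN b' (zz P t).
    have [kt|nk] := boolP k; first by exists 1.
    have [_ b0] := normal_lower nab' nk; have [c c0 hc] := KN_lower u0 pb' b0.
    exists c => // t t0 _; apply: hc.
    have -> : zz P t - expR (- t) *: u = (expR t - expR (- t)) *: P by rewrite /zz; vring.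
    by apply: posZ; [rewrite subr_ge0 e_gt|apply: pos_idem].
  apply: (Mfun_small_inv (C := if k then C * Num.max C1 C2 else C * (C1 * C2) / c) u0 pa' eP) => t t0.
  have iz := zz_int u0 t eP; have pz := int_pos u0 iz.
  have ht := h _ iz; rewrite /LT in ht.
  apply: (op_small c0 (expR_gt0 (- t)) (Mfun_ge0 u0 pa' iz) (hc t t0) _ _ C0 ht).
    by rewrite Mfun_ge0 ?h1.
  rewrite KN_ge0 //=; have := h2 t; congr (KN b _ <= _); rewrite /zz; vring.
have [C1 _ h1] := KN_small pb eQ (@subf_supp b).
have [C2 _ h2] := Mfun_small u0 pa (idemC eQ) (subf_orth ba).
have [c c0 hc] : exists2 c, 0 < c & forall t, 0 < t -> ~~ k ->
    c * expR (- t) <= Mfun mul a' (zz (u - P) t).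
  have [kt|nk] := boolP k; first by exists 1.
  have [a0 _] := normal_lower nab' nk; have [c c0 hc] := Mfun_lower u0 pa' a0.
  exists c => // t t0 _; apply: hc; first exact: zz_int (idemC eQ).
  have -> : expR t *: u - zz (u - P) t = (expR t - expR (- t)) *: P by rewrite /zz; vring.
  by apply: posZ; [rewrite subr_ge0 e_gt|apply: pos_idem].
apply: (KN_small_inv (C := if k then C * Num.max C1 C2 else C * (C1 * C2) / c) u0 pb' eQ) => t t0.
have iz := zz_int u0 t (idemC eQ); have pz := int_pos u0 iz.
have ht := h _ iz; rewrite /LT (opC (Mfun mul a' _)) (opC (Mfun mul a _)) in ht.
have X1 : 0 <= KN b (zz (u - P) t) <= C1 * expR (- t) by rewrite KN_ge0 ?h1.
have X2 : 0 <= Mfun mul a (zz (u - P) t) <= C2 * expR (- t) by rewrite Mfun_ge0 ?h2.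
exact: op_small c0 (expR_gt0 (- t)) (KN_ge0 u0 pb' pz) (hc t t0) X1 X2 C0 ht.
Qed.

Lemma LNC a b z : LN a b z = LN b a (- z).
Proof. by rewrite /LN opC opprK. Qed.

Lemma LN_subf2 a b a' b' C : normal a b -> normal a' b' -> supp a ** supp b = 0 -> 0 <= C ->
  (forall z, LN a' b' z <= C * LN a b z) -> subf a' (supp a) /\ subf b' (supp b).
Proof.
move=> nab nab' ab C0 h; split; first exact: (LN_subf nab nab' ab C0 h).
have ba : supp b ** supp a = 0 by rewrite jmulC.
apply: (LN_subf (normalC nab) (normalC nab') ba C0) => z.
by rewrite (LNC b' a') (LNC b a); apply: h.
Qed.

Lemma LN_comp a b a' b' : supp a = supp a' -> supp b = supp b' ->
  exists2 C, 0 < C & forall z, LN a b z <= C * LN a' b' z.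
Proof.
move=> /(EN_comp u0)[C1 C1_gt h1] /(EN_comp u0)[C2 C2_gt h2].
pose C := 1 + C1 + C2; exists (C * C) => [|z]; first by apply: mulr_gt0; rewrite /C; lra.
have le C' e : 0 < C' -> C' <= C -> 0 <= e -> C' * e <= C * e by move=> *; apply: ler_wpM2r.
have C_ge1 : 1 <= C by rewrite /C; lra.
rewrite /LN; have := op_scale C_ge1 (EN_ge0 u0 a' z) (EN_ge0 u0 b' (- z)).
apply: le_trans.
by apply: op_le; rewrite ?EN_ge0 //; [apply: (le_trans (h1 _))|apply: (le_trans (h2 _))];
  apply: le => //; rewrite ?EN_ge0 // /C; lra.
Qed.

Lemma LT_comp a b a' b' : pos a -> pos a' -> pos b -> pos b' ->
  supp a = supp a' -> supp b = supp b' ->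
  exists2 C, 0 < C & forall z, cone_int mul u z -> LT a b z <= C * LT a' b' z.
Proof.
move=> pa pa' pb pb' /(Mfun_comp u0 pa pa')[C1 C1_gt h1] /(KN_comp u0 pb pb')[C2 C2_gt h2].
pose C := 1 + C1 + C2; exists (C * C) => [|z iz]; first by apply: mulr_gt0; rewrite /C; lra.
have pz := int_pos u0 iz.
have le C' e : 0 < C' -> C' <= C -> 0 <= e -> C' * e <= C * e by move=> *; apply: ler_wpM2r.
have C_ge1 : 1 <= C by rewrite /C; lra.
rewrite /LT; have := op_scale C_ge1 (Mfun_ge0 u0 pa' iz) (KN_ge0 u0 pb' pz).
apply: le_trans.
apply: op_le; rewrite ?Mfun_ge0 ?KN_ge0 //.
  by apply: (le_trans (h1 _ iz)); apply: le => //; rewrite ?Mfun_ge0 // /C; lra.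
by apply: (le_trans (h2 _ pz)); apply: le => //; rewrite ?KN_ge0 // /C; lra.
Qed.

(** As c tends to 0 the first argument dominates. The chosen c is so small that c y' cannot reach x
    / c. *)
Lemma max_scale_le (x y x' y' : R) : 0 <= x -> 0 <= x' -> 0 <= y' ->
  (forall c, 0 < c -> Num.max (c^-1 * x) (c * y) = Num.max (c^-1 * x') (c * y')) -> x <= x'.
Proof.
move=> x0 x0' y0' h; rewrite leNgt; apply/negP => lt.
have xp : 0 < x by apply: le_lt_trans lt.
pose c := Num.min 1 (x / (2 * (y' + 1))).
have d0 : 0 < x / (2 * (y' + 1)) by rewrite divr_gt0 // mulr_gt0 //; lra.
have c0 : 0 < c by rewrite lt_min ltr01.
have c1 : c <= 1 by rewrite ge_min lexx.
have cd : c * (2 * (y' + 1)) <= x.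
  by rewrite -ler_pdivlMr; [rewrite ge_min lexx orbT|apply: mulr_gt0; lra].
have : c^-1 * x <= Num.max (c^-1 * x') (c * y') by rewrite -h // le_max lexx.
rewrite le_max => /orP[|]; first by rewrite ler_pM2l ?invr_gt0 // leNgt lt.
rewrite ler_pdivrMl // leNgt => /negP; apply.
have : c * y' <= y' by rewrite ler_piMl.
have : c * (c * y') <= c * y' by rewrite ler_piMl // mulr_ge0 // ltW.
lra.
Qed.

Lemma max_scale_inj (x y x' y' : R) : 0 <= x -> 0 <= y -> 0 <= x' -> 0 <= y' ->
  (forall c, 0 < c -> Num.max (c^-1 * x) (c * y) = Num.max (c^-1 * x') (c * y')) ->
  x = x' /\ y = y'.
Proof.
move=> x0 y0 x0' y0' h.
have h2 c : 0 < c -> Num.max (c^-1 * y) (c * x) = Num.max (c^-1 * y') (c * x').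
  by move=> c0; have := h c^-1; rewrite invrK invr_gt0 maxC => ->; rewrite // maxC.
have hs c : 0 < c -> Num.max (c^-1 * x') (c * y') = Num.max (c^-1 * x) (c * y) by move/h ->.
have h2s c : 0 < c -> Num.max (c^-1 * y') (c * x') = Num.max (c^-1 * y) (c * x) by move/h2 ->.
by split; apply/eqP; rewrite eq_le;
  rewrite ?(max_scale_le _ _ _ h) ?(max_scale_le _ _ _ hs) //
    ?(max_scale_le _ _ _ h2) ?(max_scale_le _ _ _ h2s).
Qed.

(* A point z at which the value of LN, resp. LT, is attained on both faces. *)
Definition anchN a b := exists z c, (forall w, face (supp a) w -> jip w (lnA a) = jip w z) /\
  (forall w, face (supp b) w -> jip w (lnA b) + jip w z = c * jip w u).

Definition anchT a b := exists z c, [/\ cone_int mul u z, 0 < c, pos (z - a),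
  forall w, face (supp a) w -> jip w z = jip w a &
  forall w, face (supp b) w -> jip w z = c * jip w (invA b)].

(** In part (a), replacing z by z + (ln s) u scales the two factors by 1 / s and s, so the maxima
    for all s determine both. In part (b) the scalings cancel in the product, and [EN_product_rigid]
    is applied at the anchors. *)
Lemma LN_inj a b a' b' : normal a b -> normal a' b' -> anchN a b -> anchN a' b' ->
  supp a = supp a' -> supp b = supp b' -> (forall z, LN a b z = LN a' b' z) -> a = a' /\ b = b'.
Proof.
move=> nab nab' [z [c [h1 h2]]] [z' [c' [h1' h2']]] sa sb h.
have [pa pb _ _ _] := nab; have [pa' pb' _ _ _] := nab'.
have := h z; have := h z'; have := h; rewrite /LN /op.
move: (normal_neq0 nab) (normal_neq0 nab'); case: k => [_ _ {}h _ _|].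
  have key x : EN a x = EN a' x /\ EN b (- x) = EN b' (- x).
    apply: max_scale_inj; [exact: EN_ge0|exact: EN_ge0|exact: EN_ge0|exact: EN_ge0|move=> s s0].
    have := h (x + ln s *: u).
    have -> : - (x + ln s *: u) = - x + (- ln s) *: u by vring.
    by rewrite !(EN_shift u0) opprK expRN (lnK (_ : s \in Num.pos)) ?posrE.
  split; [apply: (EN_inj u0 pa pa')|apply: (EN_inj u0 pb pb')] => x; first by case: (key x).
  by case: (key (- x)) => _; rewrite opprK.
move=> [a1 b1] [a1' b1'] _ hz' hz.
by rewrite -sa in h1'; rewrite -sb in h2';
  apply: (EN_product_rigid u0 pa pb pa' pb' a1 b1 a1' b1' sa sb h1 h1' h2 h2').
Qed.

Lemma LT_inj a b a' b' : normal a b -> normal a' b' -> anchT a b -> anchT a' b' ->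
  supp a = supp a' -> supp b = supp b' ->
  (forall z, cone_int mul u z -> LT a b z = LT a' b' z) -> a = a' /\ b = b'.
Proof.
move=> nab nab' [z [c [iz c0 za h1 h2]]] [z' [c' [iz' c0' za' h1' h2']]] sa sb h.
have [pa pb _ _ _] := nab; have [pa' pb' _ _ _] := nab'.
have := h z iz; have := h z' iz'; have := h; rewrite /LT /op.
move: (normal_neq0 nab) (normal_neq0 nab'); case: k => [_ _ {}h _ _|].
  have key x : cone_int mul u x -> Mfun mul a x = Mfun mul a' x /\ KN b x = KN b' x.
    move=> ix; have px := int_pos u0 ix.
    have ge1 e : pos e -> 0 <= Mfun mul e x by move=> pe; apply: Mfun_ge0.
    have ge2 e : pos e -> 0 <= KN e x by move=> pe; apply: KN_ge0.
    apply: max_scale_inj; [exact: ge1|exact: ge2|exact: ge1|exact: ge2|move=> s s0].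
    have := h (s *: x) (int_scale u0 s0 ix).
    by rewrite (Mfun_scale u0 a s0 ix) (Mfun_scale u0 a' s0 ix)
      (KN_scale u0 s0 pb px) (KN_scale u0 s0 pb' px).
  split; [apply: (Mfun_inj u0 pa pa')|apply: (KN_inj u0 pb pb')] => x ix.
    by case: (key x ix).
  by case: (key x ix).
move=> [a1 b1] [a1' b1'] _ hz' hz.
by rewrite -sa in h1'; rewrite -sb in h2';
  apply: (KN_product_rigid u0 pa pb pa' pb' a1 b1 a1' b1' sa sb iz iz' c0 c0' za za'
    h1 h1' h2 h2').
Qed.

Lemma supp_int x : cone_int mul u x -> supp x = u.
Proof.
move=> /(cone_int_exp _ u0) ->; have [r [p [lam [op p0 ->]]]] := spectral_neq0 (lnA x).
rewrite fcE // supp_osys //; case: (op) => _ _ <-; apply: eq_bigl => i.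
by rewrite gt_eqF ?expR_gt0.
Qed.

Lemma anch_int y : anchN (ea y) (eb y) /\ anchT (ea y) (eb y).
Proof.
split.
  exists (lnA (ea y)), (- (rr y + ss y)); split=> // w _.
  by rewrite lnA_ea lnA_eb -jipDr -jipZr; congr (jip w _); vring.
exists (ea y), (expR (- (rr y + ss y))); split=> //.
- exact: ea_int.
- exact: expR_gt0.
- by rewrite subrr; apply: pos0.
- move=> w _; rewrite -jipZr invA_eb eaE scalerA -expRD; congr (jip w (expR _ *: _)); ring.
Qed.

Lemma boundary_orth a b : boundary_pair a b -> supp a ** supp b = 0.
Proof.
move=> [_ [q [al [be [oq hab -> ->]]]]]; rewrite !supp_osys // jmul_sumr.
apply: big1 => j bj; rewrite jmul_suml; apply: big1 => i ai; case: oq => _ orth _; apply: orth.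
apply: contra_neq bj => ij; have [_ [_ /eqP]] := hab i.
by rewrite mulf_eq0 (negPf ai) ij => /eqP.
Qed.

Lemma jip_face_eq r (q : 'I_r -> A) (al x y : 'I_r -> R) w : osys q ->
  face (supp (\sum_i al i *: q i)) w -> (forall i, al i != 0 -> x i = y i) ->
  jip w (\sum_i x i *: q i) = jip w (\sum_i y i *: q i).
Proof.
move=> oq /(face_osys _ _ oq)[_ _ h] xy; rewrite !jip_sumr; apply: eq_bigr => i _.
rewrite !jipZr; have [/h ->|/xy -> //] := eqVneq (al i) 0.
by rewrite !mulr0.
Qed.

Lemma anch_boundary a b : boundary_pair a b -> anchN a b /\ anchT a b.
Proof.
move=> [_ [q [al [be [oq hab -> ->]]]]].
have al0 i : be i != 0 -> al i = 0.
  by move=> bi; have [_ [_ /eqP]] := hab i; rewrite mulf_eq0 (negPf bi) orbF => /eqP.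
have be0 i : al i != 0 -> be i = 0.
  by move=> ai; have [_ [_ /eqP]] := hab i; rewrite mulf_eq0 (negPf ai) => /eqP.
split.
  (* At most one of [al i], [be i] is nonzero and [ln 0] is 0, so this point agrees with lnA a on
     the face of a and with - lnA b on that of b. *)
  exists (\sum_i (ln (al i) - ln (be i)) *: q i), 0; rewrite !fcE //; split=> w fw.
    by apply: (jip_face_eq oq fw) => i /be0 ->; rewrite (ln0 (lexx 0)) subr0.
  rewrite mul0r -jipDr -big_split /=; under eq_bigr do rewrite -scalerDl.
  rewrite (jip_face_eq (y := fun=> 0) oq fw).
    by under eq_bigr do rewrite scale0r; rewrite big1 // jip0r.
  by move=> i /al0 ->; rewrite (ln0 (lexx 0)) sub0r addrN.
(* The eigenvalues of a on its support and the inverse ones of b on its own; the value 1 elsewhere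
   keeps the point interior. *)
pose f i := if al i != 0 then al i else if be i != 0 then (be i)^-1 else 1.
have f0 i : 0 < f i.
  have [/andP[h1 _] [/andP[h2 _] _]] := hab i; rewrite /f; case: eqP => /= [_|/eqP a0].
    by case: eqP => //= /eqP b0; rewrite invr_gt0 lt_neqAle eq_sym b0.
  by rewrite lt_neqAle eq_sym a0.
exists (\sum_i f i *: q i), 1; split=> //.
- have -> : \sum_i f i *: q i = expA (\sum_i ln (f i) *: q i).
    by rewrite fcE //; apply: eq_bigr => i _; rewrite lnK ?posrE.
  exact: cone_int_fc_exp.
- rewrite -sumrB; under eq_bigr do rewrite -scalerBl.
  apply: pos_sum => // i; have := f0 i; rewrite /f.
  by case: eqP => /= [->|]; rewrite ?subr0 ?subrr // => /ltW.
- by move=> w fw; apply: (jip_face_eq oq fw) => i ai; rewrite /f ai.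
- move=> w fw; rewrite mul1r fcE //; apply: (jip_face_eq oq fw) => i bi.
  by rewrite /f (al0 _ bi) eqxx bi.
Qed.

(** * Paths converging to a boundary pair *)

Section Path.
Context (q : 'I_N -> A) (al be : 'I_N -> R).
Hypothesis oq : osys q.
Hypothesis hab : forall i, 0 <= al i <= 1 /\ 0 <= be i <= 1 /\ al i * be i = 0.
Let a := \sum_i al i *: q i.
Let b := \sum_i be i *: q i.
Hypothesis nab : normal a b.

(** Slope 1 on the support of a, -1 on that of b and 0 elsewhere. The constants are those for which
    the normalized exponentials of the path and of its negative tend to a and b. *)
Definition path_coef (t : R) i : R :=
  if al i != 0 then ln (al i) + t else if be i != 0 then - ln (be i) - t else 0.
Definition geodesic (t : R) : A := \sum_i path_coef t i *: q i.
(** From this time on all coefficients lie in [-t, t], so that [rr] and [ss] equal t on the path. *)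
Definition path_start : R := \sum_i (`|ln (al i)| + `|ln (be i)|).

Lemma path_start_ge i : `|ln (al i)| + `|ln (be i)| <= path_start.
Proof.
rewrite /path_start (bigD1 i) //= lerDl; apply: sumr_ge0 => j _.
by rewrite addr_ge0.
Qed.

Lemma ln_weights i : ln (al i) <= 0 /\ ln (be i) <= 0.
Proof. by have [/andP[_ ?] [/andP[_ ?] _]] := hab i; split; apply: ln_le0. Qed.

Lemma path_coef_bound t i : path_start <= t -> - t <= path_coef t i <= t.
Proof.
move=> ht; have h := path_start_ge i; have [h1 h2] := ln_weights i.
rewrite !ler0_norm // in h; rewrite /path_coef; do 2?case: ifP => _; apply/andP; split; lra.
Qed.

Lemma path_coef_al t i : al i != 0 -> path_coef t i = ln (al i) + t.
Proof. by rewrite /path_coef => ->. Qed.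

Lemma path_coef_be t i : be i != 0 -> path_coef t i = - ln (be i) - t.
Proof.
move=> bi; have [_ [_ /eqP]] := hab i; rewrite mulf_eq0 (negPf bi) orbF => /eqP ai.
by rewrite /path_coef ai eqxx bi.
Qed.

Lemma pathN t : - geodesic t = \sum_i - path_coef t i *: q i.
Proof. by rewrite /geodesic -sumrN; apply: eq_bigr => i _; rewrite scaleNr. Qed.

Lemma jmax_path t : path_start <= t ->
  [/\ jmax (geodesic t) <= t, jmax (- geodesic t) <= t, jmax a = 1 -> t <= jmax (geodesic t) &
      jmax b = 1 -> t <= jmax (- geodesic t)].
Proof.
move=> ht; have bd i := path_coef_bound i ht.
have [[i _ ei] ub] := jmax_osys (path_coef t) oq.
have [[j _ ej] ub'] := jmax_osys (fun i => - path_coef t i) oq.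
have [[m qm em] _] := jmax_osys al oq; have [[l ql el] _] := jmax_osys be oq.
(* An eigenvalue 1 of a has logarithm 0, so the path has coefficient exactly t there; for b the
   coefficient is - t. *)
split; first by rewrite ei; have /andP[] := bd i.
- by rewrite pathN ej; have /andP[? _] := bd j; rewrite lerNl.
- rewrite em => am; apply: le_trans (ub m qm).
  by rewrite path_coef_al am ?ln1 ?add0r // oner_neq0.
rewrite el pathN => bl; apply: le_trans (ub' l ql).
by rewrite path_coef_be bl ?ln1 ?oner_neq0 // oppr0 sub0r opprK.
Qed.

Lemma rr_ss_path t : path_start <= t -> rr (geodesic t) = t /\ ss (geodesic t) = t.
Proof.
move=> ht; have [h1 h2 h3 h4] := jmax_path ht.
have [_ _ a1 b1 ab1] := nab; have := normal_neq0 nab; move: ab1; rewrite /rr /ss /nu /op.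
case: k => [ab1 _|_ [/h3 h5 /h4 h6]]; last by split; apply/eqP; rewrite eq_le ?h1 ?h2.
suff -> : Num.max (jmax (geodesic t)) (jmax (- geodesic t)) = t by [].
apply/eqP; rewrite eq_le ge_max h1 h2 /= le_max.
have [/h3 ->//|na] := eqVneq (jmax a) 1; have [/h4 ->|nb] := eqVneq (jmax b) 1; rewrite ?orbT //.
have : Num.max (jmax a) (jmax b) < 1 by rewrite gt_max !lt_neqAle na nb a1 b1.
by rewrite ab1 ltxx.
Qed.

Lemma ea_path t : path_start <= t -> ea (geodesic t) = \sum_i expR (path_coef t i - t) *: q i.
Proof. by move=> /rr_ss_path[h _]; rewrite /ea h fcE. Qed.

Lemma eb_path t : path_start <= t -> eb (geodesic t) = \sum_i expR (- path_coef t i - t) *: q i.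
Proof. by move=> /rr_ss_path[_ h]; rewrite /eb h fcE. Qed.

Lemma cvg_weight (x y : R) (g : R -> R) : 0 <= x <= 1 -> 0 <= y <= 1 -> x * y = 0 ->
  (forall t, g t = if x != 0 then ln x + t else if y != 0 then - ln y - t else 0) ->
  (fun n : nat => expR (g (path_start + n%:R) - (path_start + n%:R))) @ \oo --> x.
Proof.
move=> /andP[x0 _] /andP[y0 _] xy gE; under eq_fun do rewrite gE.
have E0 : (fun n : nat => expR (- (path_start + n%:R))) @ \oo --> (0 : R).
  rewrite -(mulr0 (expR (- path_start))); under eq_fun do rewrite opprD expRD.
  by apply: cvgM; [exact: cvg_cst|exact: cvgn_expR].
have [->|xn] /= := eqVneq x 0; last first.
  under eq_fun do rewrite addrK lnK ?posrE ?lt_neqAle 1?eq_sym ?xn //.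
  exact: cvg_cst.
have [_|yn] /= := eqVneq y 0; first by under eq_fun do rewrite sub0r.
have -> : (fun n : nat => expR (- ln y - (path_start + n%:R) - (path_start + n%:R))) =
    (fun n : nat => expR (- ln y) * (expR (- (path_start + n%:R)) * expR (- (path_start + n%:R)))).
  by apply/funext => n; rewrite -!expRD; congr expR; ring.
suff : (fun n : nat => expR (- ln y) * (expR (- (path_start + n%:R)) * expR (- (path_start + n%:R))))
    @ \oo --> expR (- ln y) * (0 * 0) by rewrite !mulr0.
by apply: cvgM; [exact: cvg_cst|exact: cvgM].
Qed.

Lemma path_limits (G : set_system nat) {FG : UltraFilter G} : \oo `<=` G ->
  Acvg G (fun n => ea (geodesic (path_start + n%:R))) a /\
  Acvg G (fun n => eb (geodesic (path_start + n%:R))) b.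
Proof.
move=> oG; have FP : ProperFilter G := @ultra_proper _ _ FG.
have ge n : path_start <= path_start + n%:R by rewrite lerDl.
have lim (f : nat -> R) (x : R) : f @ \oo --> x -> f @ G --> x by move=> fx U /fx /oG.
split.
  apply: (Acvg_eq (f := fun n : nat => \sum_i
      expR (path_coef (path_start + n%:R) i - (path_start + n%:R)) *: q i)).
    by move=> n; rewrite ea_path.
  apply: Acvg_sum => i _; apply: AcvgZ; last exact: Acvg_cst.
  have [h1 [h2 h3]] := hab i; apply: lim.
  exact: (cvg_weight (g := fun t => path_coef t i) h1 h2 h3).
apply: (Acvg_eq (f := fun n : nat => \sum_i
    expR (- path_coef (path_start + n%:R) i - (path_start + n%:R)) *: q i)).
  by move=> n; rewrite eb_path.
apply: Acvg_sum => i _; apply: AcvgZ; last exact: Acvg_cst.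
have [h1 [h2 h3]] := hab i; apply: lim.
apply: (cvg_weight (g := fun t => - path_coef t i) h2 h1); first by rewrite mulrC.
move=> t; have [bi|bi] := eqVneq (be i) 0 => /=; last by rewrite path_coef_be //; ring.
rewrite /path_coef bi eqxx /=; case: ifP => _; last by rewrite oppr0.
by ring.
Qed.

Lemma unitE (c : R) : \sum_i c *: q i = c *: u.
Proof. by rewrite -scaler_sumr; case: oq => _ _ ->. Qed.

Lemma LN_path t : path_start <= t -> LN a b (geodesic t) <= op (expR (- t)) (expR (- t)).
Proof.
move=> ht; apply: op_le; rewrite ?EN_ge0 //; apply: EN_le => // w fw.
  rewrite -jipZr -unitE /a fcE // /geodesic -sumrB; under eq_bigr do rewrite -scalerBl.
  rewrite (jip_face_eq (x := fun i => ln (al i) - path_coef t i) (y := fun=> - t) oq fw) ?lexx // => i ai.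
  by rewrite path_coef_al //; ring.
rewrite opprK -jipZr -unitE /b fcE // /geodesic -big_split /=; under eq_bigr do rewrite -scalerDl.
rewrite (jip_face_eq (y := fun=> - t) oq fw) ?lexx // => i bi.
by rewrite path_coef_be //; ring.
Qed.

Lemma LT_path t : path_start <= t -> LT a b (expA (geodesic t)) <= op (expR (- t)) (expR (- t)).
Proof.
have [pa pb _ _ _] := nab; move=> ht; have iz := cone_int_fc_exp (geodesic t) u0.
apply: op_le; rewrite ?Mfun_ge0 ?KN_ge0 //; try exact: int_pos.
  apply/(Mfun_le u0 _ _ iz); rewrite /geodesic fcE // /a scaler_sumr -sumrB.
  under eq_bigr do rewrite scalerA -scalerBl.
  apply: pos_sum => // i; rewrite subr_ge0.
  have [->|ai] := eqVneq (al i) 0; first by rewrite mulr_ge0 ?expR_ge0.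
  rewrite path_coef_al // -expRD addrC addrK lnK // posrE lt_neqAle eq_sym ai.
  by have [/andP[]] := hab i.
apply: KN_le; rewrite ?expR_ge0 // => w fw.
rewrite -jipZr /geodesic /b !fcE // scaler_sumr; under [X in _ <= jip _ X]eq_bigr do rewrite scalerA.
rewrite (jip_face_eq (y := fun i => expR (- t) * (be i)^-1) oq fw) ?lexx // => i bi.
rewrite path_coef_be // addrC expRD (expRN (ln _)) lnK // posrE lt_neqAle eq_sym bi.
by have [_ [/andP[]]] := hab i.
Qed.

(** With x the value of [LN] or [LT] at the path, this says that d(b, .) + h is at most 0 along it,
    the bound of [quasi_busemann] with C = 0. *)
Lemma ln_path t x : path_start <= t -> 0 < x -> x <= op (expR (- t)) (expR (- t)) ->
  nu (geodesic t) + ln x <= 0.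
Proof.
move=> ht x0 xle; have [h1 h2] := rr_ss_path ht.
have := ln_op_shift 0 0 (geodesic t); rewrite h1 h2 !sub0r => e.
have : ln x <= ln (op (expR (- t)) (expR (- t))).
  by rewrite ler_ln ?posrE // op_gt0 ?expR_gt0.
by rewrite e; case: k; rewrite ?maxxx; lra.
Qed.

End Path.

Lemma quasi_busemannN a b (h : {ptws {x | MN x} -> R}) : boundary_pair a b ->
  (forall z, h z = ln (LN a b (proj1_sig z))) -> quasi_busemann MN dN 0 h.
Proof.
move=> [nab [q [al [be [oq hab aE bE]]]]] hE; rewrite aE bE in nab hE; exists 0 => W hW.
have [G [FG oG]] := ultraFilterLemma (eventually_filter).
have FP : ProperFilter G := @ultra_proper _ _ FG.
have [ya yb] := path_limits oq hab nab oG.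
pose t n : R := path_start al be + n%:R; pose y n := pr (geodesic q al be (t n)).
have {}ya : Acvg G (fun n => ea (y n)) (\sum_i al i *: q i).
  by apply: Acvg_eq ya => n; rewrite ea_pr.
have {}yb : Acvg G (fun n => eb (y n)) (\sum_i be i *: q i).
  by apply: Acvg_eq yb => n; rewrite eb_pr.
have c : (fun n => horo MN dN 0 (y n)) @ G --> h.
  by apply/ptws_cvg => z; rewrite hE; apply: cvg_horoN.
have /filter_ex[n Wn] : G ((fun n => horo MN dN 0 (y n)) @^-1` W) by apply: c.
exists (exist _ (y n) (pr_MN _)); split=> //=.
have ht : path_start al be <= t n by rewrite lerDl.
rewrite hE /= LN_pr /dN sub0r nuN nu_pr.
by apply: (ln_path oq hab nab ht); [apply: LN_gt0|apply: LN_path].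
Qed.

Lemma quasi_busemannT a b (h : {ptws {x | MT x} -> R}) : boundary_pair a b ->
  (forall z, h z = ln (LT a b (proj1_sig z))) -> quasi_busemann MT dT u h.
Proof.
move=> [nab [q [al [be [oq hab aE bE]]]]] hE; rewrite aE bE in nab hE; exists 0 => W hW.
have [G [FG oG]] := ultraFilterLemma (eventually_filter).
have FP : ProperFilter G := @ultra_proper _ _ FG.
have [ya yb] := path_limits oq hab nab oG.
pose t n : R := path_start al be + n%:R; pose y n := pr (geodesic q al be (t n)).
have {}ya : Acvg G (fun n => ea (y n)) (\sum_i al i *: q i).
  by apply: Acvg_eq ya => n; rewrite ea_pr.
have {}yb : Acvg G (fun n => eb (y n)) (\sum_i be i *: q i).
  by apply: Acvg_eq yb => n; rewrite eb_pr.
have c : (fun n => horo MT dT u (expA (y n))) @ G --> h.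
  by apply/ptws_cvg => z; rewrite hE; apply: cvg_horoT.
have /filter_ex[n Wn] : G ((fun n => horo MT dT u (expA (y n))) @^-1` W) by apply: c.
exists (exist _ (expA (y n)) (exp_MT (pr_MN _))); split=> //=.
have ht : path_start al be <= t n by rewrite lerDl.
have iz := cone_int_fc_exp (geodesic q al be (t n)) u0.
rewrite hE /= dT_u nu_pr.
have -> : expA (y n) = prT (expA (geodesic q al be (t n))).
  rewrite /prT fc_comp; congr (expA (pr _)); rewrite -[LHS]fc_id; congr (fc _ _).
  by apply/funext => x /=; rewrite expRK.
have [_ pb _ _ _] := nab; rewrite LT_pr //.
by apply: (ln_path oq hab nab ht); [apply: LT_gt0|apply: LT_path].
Qed.

(** * Horofunctions determine their pairs; the homeomorphism *)

Definition limit_pair a b := normal a b /\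
  (boundary_pair a b \/ exists2 y, MN y & a = ea y /\ b = eb y).

Lemma limit_pair_exists (F : set_system A) (FU : UltraFilter F) : exists a b,
  [/\ limit_pair a b, Acvg F ea a & Acvg F eb b].
Proof.
have [a [b [ca cb h]]] := pair_dichotomy FU; exists a, b; split=> //; split=> //.
exact: (limit_normal (y := id) ca cb).
Qed.

Lemma limit_pair_anch a b : limit_pair a b -> anchN a b /\ anchT a b.
Proof.
by move=> [_ [/anch_boundary//|[y _ [-> ->]]]]; apply: anch_int.
Qed.

(** A pair coming from a point has both supports equal to u, and these cannot lie under the
    orthogonal supports of a boundary pair. So two pairs to be compared are of the same kind. *)
Lemma limit_pair_supp a b a' b' : limit_pair a b -> limit_pair a' b' ->
  (boundary_pair a b -> subf a' (supp a) /\ subf b' (supp b)) ->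
  (boundary_pair a' b' -> subf a (supp a') /\ subf b (supp b')) ->
  supp a = supp a' /\ supp b = supp b'.
Proof.
have si y : supp (ea y) = u /\ supp (eb y) = u.
  by split; apply: supp_int; [apply: ea_int|apply: eb_int].
have key x y z : boundary_pair x y -> subf (ea z) (supp x) -> subf (eb z) (supp y) -> False.
  move=> bxy /(subf_mul (supp_idem x)) h1 /(subf_mul (supp_idem y)) h2.
  have [e1 e2] := si z; rewrite e1 jmul1r in h1; rewrite e2 jmul1r in h2.
  by have := boundary_orth bxy; rewrite h1 h2 jmul1 => /eqP; rewrite (negPf u0).
move=> [_ [hb|[y _ [-> ->]]]] [_ [hb'|[y' _ [-> ->]]]] h h'.
- by have [h1 h2] := h hb; have [h3 h4] := h' hb'; split; apply: subf_antisym.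
- by have [h1 h2] := h hb; have := key _ _ _ hb h1 h2.
- by have [h1 h2] := h' hb'; have := key _ _ _ hb' h1 h2.
- have [e1 e2] := si y; have [e3 e4] := si y'.
  by split; [exact: (etrans e1 (esym e3))|exact: (etrans e2 (esym e4))].
Qed.

Lemma limit_pairN_inj a b a' b' : limit_pair a b -> limit_pair a' b' ->
  (forall z, MN z -> ln (LN a b z) = ln (LN a' b' z)) -> a = a' /\ b = b'.
Proof.
move=> lab lab' h; have [nab _] := lab; have [nab' _] := lab'.
have h1 z : LN a b z = LN a' b' z.
  rewrite -(LN_pr a b) -(LN_pr a' b'); apply: ln_inj; rewrite ?posrE; try exact: LN_gt0.
  by apply: h; apply: pr_MN.
have [an _] := limit_pair_anch lab; have [an' _] := limit_pair_anch lab'.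
have [sa sb] : supp a = supp a' /\ supp b = supp b'.
  apply: limit_pair_supp => // /boundary_orth orth.
    apply: (LN_subf2 nab nab' orth ler01) => z.
    by rewrite mul1r h1 lexx.
  apply: (LN_subf2 nab' nab orth ler01) => z.
  by rewrite mul1r h1 lexx.
exact: (LN_inj nab nab' an an' sa sb h1).
Qed.

Lemma limit_pairT_inj a b a' b' : limit_pair a b -> limit_pair a' b' ->
  (forall z, MT z -> ln (LT a b z) = ln (LT a' b' z)) -> a = a' /\ b = b'.
Proof.
move=> lab lab' h; have [nab _] := lab; have [nab' _] := lab'.
have [_ pb _ _ _] := nab; have [_ pb' _ _ _] := nab'.
have h1 z : cone_int mul u z -> LT a b z = LT a' b' z.
  move=> iz; rewrite -(LT_pr a pb iz) -(LT_pr a' pb' iz).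
  have iz' := MT_int (prT_MT z); apply: ln_inj; rewrite ?posrE; try exact: LT_gt0.
  by apply: h; apply: prT_MT.
have [_ an] := limit_pair_anch lab; have [_ an'] := limit_pair_anch lab'.
have [sa sb] : supp a = supp a' /\ supp b = supp b'.
  apply: limit_pair_supp => // /boundary_orth orth.
    apply: (LT_subf nab nab' orth ler01) => z iz.
    by rewrite mul1r h1 ?lexx.
  apply: (LT_subf nab' nab orth ler01) => z iz.
  by rewrite mul1r h1 ?lexx.
exact: (LT_inj nab nab' an an' sa sb h1).
Qed.

Lemma ln_bounded (x y C : R) : 0 < x -> 0 < y -> ln y <= ln x + C <-> y <= expR C * x.
Proof.
move=> x0 y0; rewrite -{2}(lnK (_ : x \in Num.pos)) ?posrE // -expRD addrC.
by rewrite -{2}(lnK (_ : y \in Num.pos)) ?posrE // ler_expR.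
Qed.

Lemma bounded_suppN a b a' b' : boundary_pair a b -> boundary_pair a' b' ->
  (exists C, forall z : {z | MN z}, ln (LN a' b' (sval z)) <= ln (LN a b (sval z)) + C) /\
  (exists C, forall z : {z | MN z}, ln (LN a b (sval z)) <= ln (LN a' b' (sval z)) + C) <->
  supp a = supp a' /\ supp b = supp b'.
Proof.
have half x y x' y' C : boundary_pair x y -> boundary_pair x' y' ->
    (forall z : {z | MN z}, ln (LN x' y' (sval z)) <= ln (LN x y (sval z)) + C) ->
    subf x' (supp x) /\ subf y' (supp y).
  move=> bxy [n' _] h; have orth := boundary_orth bxy; have [n _] := bxy.
  apply: (LN_subf2 n n' orth (expR_ge0 C)) => z; rewrite -(LN_pr x' y') -(LN_pr x y).
  apply/ln_bounded; try exact: LN_gt0.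
  exact: (h (exist _ _ (pr_MN z))).
have half' x y x' y' : boundary_pair x y -> boundary_pair x' y' ->
    supp x = supp x' -> supp y = supp y' ->
    exists C, forall z : {z | MN z}, ln (LN x y (sval z)) <= ln (LN x' y' (sval z)) + C.
  move=> [n _] [n' _] sx sy; have [C C0 hC] := LN_comp sx sy; exists (ln C) => z.
  by apply/ln_bounded; rewrite ?lnK ?posrE //; apply: LN_gt0.
move=> ba ba'; split=> [[[C h] [C' h']]|[sa sb]].
  have [h1 h2] := half _ _ _ _ _ ba ba' h; have [h3 h4] := half _ _ _ _ _ ba' ba h'.
  by split; apply: subf_antisym.
by split; apply: half'.
Qed.

Lemma bounded_suppT a b a' b' : boundary_pair a b -> boundary_pair a' b' ->
  (exists C, forall z : {z | MT z}, ln (LT a' b' (sval z)) <= ln (LT a b (sval z)) + C) /\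
  (exists C, forall z : {z | MT z}, ln (LT a b (sval z)) <= ln (LT a' b' (sval z)) + C) <->
  supp a = supp a' /\ supp b = supp b'.
Proof.
have half x y x' y' C : boundary_pair x y -> boundary_pair x' y' ->
    (forall z : {z | MT z}, ln (LT x' y' (sval z)) <= ln (LT x y (sval z)) + C) ->
    subf x' (supp x) /\ subf y' (supp y).
  move=> bxy [n' _] h; have orth := boundary_orth bxy; have [n _] := bxy.
  have [_ py _ _ _] := n; have [_ py' _ _ _] := n'.
  apply: (LT_subf n n' orth (expR_ge0 C)) => z iz.
  rewrite -(LT_pr x' py' iz) -(LT_pr x py iz); have iz' := MT_int (prT_MT z).
  apply/ln_bounded; try exact: LT_gt0.
  exact: (h (exist _ _ (prT_MT z))).
have half' x y x' y' : boundary_pair x y -> boundary_pair x' y' ->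
    supp x = supp x' -> supp y = supp y' ->
    exists C, forall z : {z | MT z}, ln (LT x y (sval z)) <= ln (LT x' y' (sval z)) + C.
  move=> [n _] [n' _] sx sy; have [px py _ _ _] := n; have [px' py' _ _ _] := n'.
  have [C C0 hC] := LT_comp px px' py py' sx sy; exists (ln C) => z.
  have iz := MT_int (proj2_sig z).
  apply/ln_bounded; rewrite ?lnK ?posrE //; try exact: LT_gt0.
  exact: hC.
move=> ba ba'; split=> [[[C h] [C' h']]|[sa sb]].
  have [h1 h2] := half _ _ _ _ _ ba ba' h; have [h3 h4] := half _ _ _ _ _ ba' ba h'.
  by split; apply: subf_antisym.
by split; apply: half'.
Qed.

Let hN a b : {ptws {x | MN x} -> R} := fun z => ln (LN a b (proj1_sig z)).
Let hT a b : {ptws {x | MT x} -> R} := fun z => ln (LT a b (proj1_sig z)).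

Lemma limit_pair_horoN (F : set_system A) (FU : UltraFilter F) a b :
  Acvg F ea a -> Acvg F eb b -> horo MN dN 0 @ F --> hN a b.
Proof.
move=> ca cb; have FP : ProperFilter F := @ultra_proper _ _ FU.
by apply/ptws_cvg => z; apply: (cvg_horoN (y := id) ca cb).
Qed.

Lemma limit_pair_horoT (F : set_system A) (FU : UltraFilter F) a b :
  Acvg F ea a -> Acvg F eb b -> (horo MT dT u \o expA) @ F --> hT a b.
Proof.
move=> ca cb; have FP : ProperFilter F := @ultra_proper _ _ FU.
by apply/ptws_cvg => z; apply: (cvg_horoT (y := id) ca cb).
Qed.

Lemma limit_pair_uniqueN (F : set_system A) (FU : UltraFilter F) a b (h : {ptws {x | MN x} -> R}) :
  Acvg F ea a -> Acvg F eb b -> horo MN dN 0 @ F --> h -> h = hN a b.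
Proof.
move=> ca cb ch; have FP : ProperFilter F := @ultra_proper _ _ FU.
exact: (cvg_unique (@ptws_hausdorff R _) ch (limit_pair_horoN FU ca cb)).
Qed.

Lemma limit_pair_uniqueT (F : set_system A) (FU : UltraFilter F) a b (h : {ptws {x | MT x} -> R}) :
  Acvg F ea a -> Acvg F eb b -> (horo MT dT u \o expA) @ F --> h -> h = hT a b.
Proof.
move=> ca cb ch; have FP : ProperFilter F := @ultra_proper _ _ FU.
exact: (cvg_unique (@ptws_hausdorff R _) ch (limit_pair_horoT FU ca cb)).
Qed.

Lemma limit_pair_boundary a b : limit_pair a b -> horo_boundary MN dN 0 (hN a b) -> boundary_pair a b.
Proof.
move=> [_ [//|[y My [aE bE]]]] [_ nh]; case: nh; exists y => //.
by apply/funext => z; rewrite horoN_LN -aE -bE.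
Qed.

Lemma jtr0 : jtr mul u 0 = 0.
Proof.
have [r [p [lam [fr _]]]] := spec_decomp_exists (0 : A).
rewrite (jtrE (p := p) (lam := fun=> 0)) ?big1 //; split=> //.
by rewrite big1 // => i _; rewrite scale0r.
Qed.

Lemma exp_compactification : exists Phi,
  [/\ homeo_onto (horo_compact MN dN 0) (horo_compact MT dT u) Phi,
      forall x, MN x -> Phi (horo MN dN 0 x) = horo MT dT u (expA x) &
      forall h, horo_boundary MN dN 0 h -> exists2 h2, horo_boundary MT dT u h2 &
        Phi @` horo_part MN dN 0 h = horo_part MT dT u h2].
Proof.
have MN0 : MN 0 by rewrite /MN; case: k => //; apply: jtr0.
have MTu : MT u.
  have e0 : expA 0 = u.
    have [r [p [_ [op _]]]] := spectral (0 : A).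
    have -> : 0 = \sum_i 0 *: p i by rewrite big1 // => i _; rewrite scale0r.
    rewrite fcE //; case: op => _ _ <-; apply: eq_bigr => i _.
    by rewrite expR0 scale1r.
  by have := exp_MT MN0; rewrite e0.
apply: (horo_transfer MN0 MTu MT_exp); last 1 first.
- move=> F G h h2 g g2 FU GU _ _ bh bh2 ch cg ch2 cg2.
  have [a [b [lab ca cb]]] := limit_pair_exists FU.
  have [a' [b' [lab' ca' cb']]] := limit_pair_exists GU.
  rewrite (limit_pair_uniqueN FU ca cb ch) in bh *.
  rewrite (limit_pair_uniqueN GU ca' cb' ch2) in bh2 *.
  rewrite (limit_pair_uniqueT FU ca cb cg) (limit_pair_uniqueT GU ca' cb' cg2).
  have ba := limit_pair_boundary lab bh; have ba' := limit_pair_boundary lab' bh2.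
  exact: (iff_trans (bounded_suppN ba ba') (iff_sym (bounded_suppT ba ba'))).
- by move=> x y z _ _ _; apply: dN_tri.
- exact: dT_tri.
- move=> F FU _; have [a [b [_ ca cb]]] := limit_pair_exists FU.
  by exists (hN a b); apply: limit_pair_horoN.
- move=> F FU _; have [a [b [_ ca cb]]] := limit_pair_exists FU.
  by exists (hT a b); apply: limit_pair_horoT.
- move=> F G h g FU GU _ _ cF cG cg.
  have [a [b [lab ca cb]]] := limit_pair_exists FU.
  have [a' [b' [lab' ca' cb']]] := limit_pair_exists GU.
  have e1 := limit_pair_uniqueN FU ca cb cF; have e2 := limit_pair_uniqueN GU ca' cb' cG.
  have [aa bb] : a = a' /\ b = b'.
    apply: (limit_pairN_inj lab lab') => z Mz.
    exact: (congr1 (fun f => f (exist _ z Mz)) (etrans (esym e1) e2)).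
  rewrite (limit_pair_uniqueT FU ca cb cg) aa bb.
  exact: limit_pair_horoT.
- move=> F G h g FU GU _ _ cF cG ch.
  have [a [b [lab ca cb]]] := limit_pair_exists FU.
  have [a' [b' [lab' ca' cb']]] := limit_pair_exists GU.
  have e1 := limit_pair_uniqueT FU ca cb cF; have e2 := limit_pair_uniqueT GU ca' cb' cG.
  have [aa bb] : a = a' /\ b = b'.
    apply: (limit_pairT_inj lab lab') => z Mz.
    exact: (congr1 (fun f => f (exist _ z Mz)) (etrans (esym e1) e2)).
  rewrite (limit_pair_uniqueN FU ca cb ch) aa bb.
  exact: limit_pair_horoN.
move=> F h g FU _ bh ch cg; have [a [b [lab ca cb]]] := limit_pair_exists FU.
have hE := limit_pair_uniqueN FU ca cb ch; have gE := limit_pair_uniqueT FU ca cb cg.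
rewrite hE in bh; have ba := limit_pair_boundary lab bh.
by rewrite hE gE; split; [apply: (quasi_busemannN ba)|apply: (quasi_busemannT ba)].
Qed.

End Model.

End JordanAlgebra.

(** This covers u = 0, where the algebra and both compactifications are single points and the
    boundaries are empty. *)
Lemma horo_transfer_trivial (R : realType) (X : Type) (M M' : set X) (d d' : X -> X -> R)
  (b b' : X) (e : X -> X) : (forall x y : X, x = y) -> M b -> M' b' ->
  exists Phi, [/\ homeo_onto (horo_compact M d b) (horo_compact M' d' b') Phi,
    forall x, M x -> Phi (horo M d b x) = horo M' d' b' (e x) &
    forall h, horo_boundary M d b h -> exists2 h2, horo_boundary M' d' b' h2 &
      Phi @` horo_part M d b h = horo_part M' d' b' h2].
Proof.
move=> all_eq Mb Mb'.
have compactE (N : set X) (c : X -> X -> R) (x : X) : N x -> horo_compact N c x = [set horo N c x x].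
  move=> Nx; rewrite /horo_compact; have -> : horo N c x @` N = [set horo N c x x].
    apply/seteqP; split=> [_ [y _ <-]|_ ->]; first by rewrite (all_eq y x).
    by exists x.
  symmetry; apply/closure_id.
  exact: accessible_closed_set1 (hausdorff_accessible (@ptws_hausdorff R _)) _.
exists (fun=> horo M' d' b' b'); split=> [|x _|h]; first split.
- by move=> _ _; rewrite compactE.
- exact: cst_continuous.
- exists (fun=> horo M d b b); split.
  + by move=> _ _; rewrite (compactE _ _ _ Mb).
  + exact: cst_continuous.
  + by move=> x; rewrite (compactE _ _ _ Mb) => ->.
  + by move=> x; rewrite (compactE _ _ _ Mb') => ->.
- by rewrite (all_eq (e x) b').
- by rewrite /horo_boundary compactE // => -[-> []]; exists b.
Qed.

Lemma trivial_points (R : realType) (A : vectType R) (mul : A -> A -> A) :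
  (forall x y : A, x = y) ->
  [/\ cone_int mul 0 0, Tu mul 0 0 & PA mul 0 0].
Proof.
move=> all_eq; have i0 : cone_int mul 0 0.
  by exists 1 => // y _; exists 0 => //; apply: all_eq.
have no r (p : 'I_r -> A) lam : spec_decomp mul 0 0 p lam -> r = 0.
  by case: r p lam => // r p lam [[pp _ _] _]; case: (pp ord0) => _ /eqP[]; apply: all_eq.
split=> //; last split=> //.
  rewrite /Tu /= /jtr; case: xgetP => //= t _ [r [p [lam [sd ->]]]].
  by have r0 := no _ _ _ sd; subst r; rewrite big_ord0.
rewrite /jdet; case: xgetP => [t _ [r [p [lam [sd ->]]]]|nodec].
  by have r0 := no _ _ _ sd; subst r; rewrite big_ord0.
(* The empty frame decomposes 0 with empty product 1. A decomposition must be exhibited, since the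
   default value of [jdet] is 0. *)
exfalso; apply: (nodec 1); exists 0%N, (fun=> 0), (fun=> 0); rewrite big_ord0; split=> //.
by split; [split=> [[]//|[]//|]|]; rewrite big_ord0.
Qed.
Theorem theorem1p1 (R : realType) (A : vectType R) (mul : A -> A -> A) (u : A) :
  jordan_algebra mul u ->
  (* (a) exp_u : (A, ||.||_u) -> (A_+^o, d_T) *)
  ((forall x : A, cone_int mul u (jexp mul u x)) /\
   exists Phi : {ptws {x : A | [set: A] x} -> R} ->
                {ptws {x : A | cone_int mul u x} -> R},
     [/\ homeo_onto
           (horo_compact [set: A] (fun x y => spec_norm mul u (x - y)) 0)
           (horo_compact (cone_int mul u) (thompson mul) u) Phi,
         (forall x : A,
            Phi (horo [set: A] (fun x y => spec_norm mul u (x - y)) 0 x)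
            = horo (cone_int mul u) (thompson mul) u (jexp mul u x)) &
         (forall h, horo_boundary [set: A] (fun x y => spec_norm mul u (x - y)) 0 h ->
            exists2 h2, horo_boundary (cone_int mul u) (thompson mul) u h2 &
              Phi @` horo_part [set: A] (fun x y => spec_norm mul u (x - y)) 0 h
              = horo_part (cone_int mul u) (thompson mul) u h2)])
  /\
  (* (b) exp_u : (T_u, |.|_u) -> (P A_+^o, d_H) *)
  ((forall w : A, Tu mul u w -> PA mul u (jexp mul u w)) /\
   exists Phi : {ptws {x : A | Tu mul u x} -> R} ->
                {ptws {x : A | PA mul u x} -> R},
     [/\ homeo_onto
           (horo_compact (Tu mul u) (fun x y => var_norm mul u (x - y)) 0)
           (horo_compact (PA mul u) (hilbert mul) u) Phi,
         (forall w : A, Tu mul u w ->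
            Phi (horo (Tu mul u) (fun x y => var_norm mul u (x - y)) 0 w)
            = horo (PA mul u) (hilbert mul) u (jexp mul u w)) &
         (forall h, horo_boundary (Tu mul u) (fun x y => var_norm mul u (x - y)) 0 h ->
            exists2 h2, horo_boundary (PA mul u) (hilbert mul) u h2 &
              Phi @` horo_part (Tu mul u) (fun x y => var_norm mul u (x - y)) 0 h
              = horo_part (PA mul u) (hilbert mul) u h2)]).
Proof.
move=> JA; have [u0|u0] := eqVneq u 0.
  have all_eq (x y : A) : x = y.
    by rewrite -(jmul1 (mul := mul) (u := u) x) -(jmul1 (mul := mul) (u := u) y) u0 !(jmul0 (mul := mul) (u := u)).
  subst u; have [h1 h2 h3] := trivial_points mul all_eq.
  split; split; try by [move=> x; rewrite (all_eq (jexp _ _ _) 0)|move=> x _; rewrite (all_eq (jexp _ _ _) 0)].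
    have [//|//|Phi [p1 p2 p3]] := @horo_transfer_trivial R A [set: A] (cone_int mul 0)
      (fun x y => spec_norm mul 0 (x - y)) (thompson mul) 0 0 (jexp mul 0) all_eq.
    by exists Phi; split=> // x; apply: p2.
  exact: (@horo_transfer_trivial R A (Tu mul 0) (PA mul 0)
      (fun x y => var_norm mul 0 (x - y)) (hilbert mul) 0 0 (jexp mul 0) all_eq).
have eE : jexp mul u = fc (mul := mul) (u := u) expR by apply/funext => x; apply: jexpE.
have dE : (fun x y => spec_norm mul u (x - y)) = dN (mul := mul) (u := u) true.
  by apply/funext => x; apply/funext => y; apply: spec_normE.
have dE' : (fun x y => var_norm mul u (x - y)) = dN (mul := mul) (u := u) false.
  by apply/funext => x; apply/funext => y; apply: var_normE.
rewrite eE dE dE'; split; split.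
- by move=> x; apply: cone_int_fc_exp.
- have [Phi [p1 p2 p3]] := @exp_compactification R A mul u JA u0 true.
  by exists Phi; split=> // x; apply: p2.
- by move=> w hw; apply: (@exp_MT R A mul u JA u0 false).
- exact: (@exp_compactification R A mul u JA u0 false).
Qed.
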